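(* Let $\mathcal T$ be an algebraic triangulated category and let $n\geq 1$. Then $\mathcal T$ has a mod-$n$ reduction, and thus $\mathcal T$ has infinite $n$-order.
   Context: **Dg categories.** A dg category $\mathcal B$ is a category enriched in chain complexes of abelian groups (homological grading: differentials lower degree by 1). A $\mathcal B$-module $M$ is a covariant dg functor from $\mathcal B$ to chain complexes of abelian groups; it is representable if there are an object $Y$ and a $0$-cycle $u\in M(Y)_0$ (the universal $0$-cycle) such that $\mathcal B(Y,Z)\to M(Z)$, $\varphi\mapsto\varphi\cdot u$, is an isomorphism of chain complexes for every object $Z$. A closed morphism $f:X\to Y$ is a $0$-cycle in $\mathcal B(X,Y)$. The dg category $\mathcal B$ is pretriangulated if it has a zero object and: (a) for every object $X$ and integer $m$ the $\mathcal B$-module $\mathcal B(X,-)[m]$, with $(\mathcal B(X,Z)[m])_{m+k}=\mathcal B(X,Z)_k$, $d(f[m])=(-1)^m (df)[m]$, $\varphi\cdot(\psi[m])=(-1)^{m|\varphi|}(\varphi\psi)[m]$, is representable; (b) for every closed morphism $f:X\to Y$ the $\mathcal B$-module $M$ with $M(Z)_k=\mathcal B(Y,Z)_k\oplus\mathcal B(X,Z)_{k+1}$, $d(a,b)=(d(a),af-d(b))$, $\varphi\cdot(a,b)=(\varphi a,(-1)^{|\varphi|}\varphi b)$, is representable; a representing object is a mapping cone $Cf$ of $f$. The homology category $\mathbf H(\mathcal B)$ has the same objects as $\mathcal B$ and morphisms $\mathbf H(\mathcal B)(X,Y)=H_0(\mathcal B(X,Y))$. For pretriangulated $\mathcal B$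 it is triangulated: the shift $X[1]$ represents $\mathcal B(X,-)[-1]$, and the distinguished triangles are those isomorphic in $\mathbf H(\mathcal B)$ to the image of $X\xrightarrow{f}Y\xrightarrow{i}Cf\xrightarrow{\bar p}X[1]$ for a closed morphism $f$, where $(i,u)\in\mathcal B(Y,Cf)_0\oplus\mathcal B(X,Cf)_1$ is the universal $0$-cycle of the mapping cone, $p\in\mathcal B(Cf,X)_{-1}$ is the cycle characterized by $p\cdot(i,u)=(0,1_X)$, and $\bar p$ is the closed morphism corresponding to $p$ (its composite with the universal degree-1 element in $\mathcal B(X,X[1])_1$). A triangulated category is algebraic if it is equivalent, as a triangulated category, to $\mathbf H(\mathcal B)$ for some pretriangulated dg category $\mathcal B$. **Mod-$n$ reduction.** A mod-$n$ reduction of a triangulated category $\mathcal T$ consists of a triangulated category $\mathcal T/n$ and an exact functor $\rho_*:\mathcal T\to\mathcal T/n$ that has a right adjoint $\rho^*$ and such that for every object $X$ of $\mathcal T$ there is a distinguished triangle $X\xrightarrow{n\cdot}X\xrightarrow{\eta_X}\rho^*(\rho_*X)\to\Sigma X$, where $\eta_X$ is the unit of the adjunction. **$n$-order.** For an object $K$ of a triangulated category $\mathcal T$ and $n\ge1$, $K/n$ denotes any cone of $n\cdot\mathrm{Id}_K$, i.e. there is a distinguished triangle $K\xrightarrow{n\cdot}K\xrightarrow{\pi}K/n\to\Sigma K$. An extension of $f:K\to X$ is a morphism $\bar f:K/n\to X$ with $\bar f\pi=f$. Inductively: every object has $n$-order $\geq 0$; for $k\geq1$, $X$ has $n$-order $\geq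 k$ iff for every object $K$ and every morphism $f:K\to X$ there is an extension $\bar f:K/n\to X$ such that some (hence any) cone of $\bar f$ has $n$-order $\geq k-1$. The $n$-order of $X$ is the largest $k$ (possibly infinite) such that $X$ has $n$-order $\geq k$. The $n$-order of $\mathcal T$ is the $n$-order of a zero object of $\mathcal T$. *)

(* Defs.v *)
From HB Require Import structures.
From mathcomp Require Import all_boot all_order all_algebra.
From mathcomp Require Import generic_quotient ring_quotient zify ring.
From mathcomp Require Import boolp.

Set Implicit Arguments.
Unset Strict Implicit.
Unset Printing Implicit Defensive.

Import Order.TTheory GRing.Theory Num.Theory.
Local Open Scope ring_scope.
Local Open Scope quotient_scope.

Record preaddCat := PreaddCat {
  ob :> Type;
  hom : ob -> ob -> zmodType;
  idm : forall X, hom X X;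
  comp : forall X Y Z, hom Y Z -> hom X Y -> hom X Z;
  compA : forall X Y Z W (h : hom Z W) (g : hom Y Z) (f : hom X Y),
    comp h (comp g f) = comp (comp h g) f;
  comp1f : forall X Y (f : hom X Y), comp (idm Y) f = f;
  compf1 : forall X Y (f : hom X Y), comp f (idm X) = f;
  compDl : forall X Y Z (g g' : hom Y Z) (f : hom X Y),
    comp (g + g') f = comp g f + comp g' f;
  compDr : forall X Y Z (g : hom Y Z) (f f' : hom X Y),
    comp g (f + f') = comp g f + comp g f' }.

Arguments idm {p} X.

Declare Scope cat_scope.
Delimit Scope cat_scope with cat.
Local Open Scope cat_scope.
Notation "g ∘ f" := (comp g f) (at level 40, left associativity) : cat_scope.

Record functor (A B : preaddCat) := Functor {
  fob :> A -> B;
  fmap : forall X Y, hom X Y -> hom (fob X) (fob Y);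
  fmap1 : forall X, fmap (idm X) = idm (fob X);
  fmapM : forall X Y Z (g : hom Y Z) (f : hom X Y),
    fmap (g ∘ f) = fmap g ∘ fmap f }.

Definition additive_functor A B (F : functor A B) : Prop :=
  forall X Y (f g : hom X Y), fmap F (f + g) = fmap F f + fmap F g.

Definition id_functor (A : preaddCat) : functor A A :=
  @Functor A A id (fun X Y f => f) (fun X => erefl) (fun X Y Z g f => erefl).

Section CompFunctor.
Variables (A B C : preaddCat) (G : functor B C) (F : functor A B).

Lemma comp_functor1 X : fmap G (fmap F (idm X)) = idm (G (F X)).
Proof. by rewrite !fmap1. Qed.

Lemma comp_functorM X Y Z (g : hom Y Z) (f : hom X Y) :
  fmap G (fmap F (g ∘ f)) = fmap G (fmap F g) ∘ fmap G (fmap F f).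
Proof. by rewrite !fmapM. Qed.

Definition comp_functor : functor A C :=
  @Functor A C (fun X => G (F X)) (fun X Y f => fmap G (fmap F f))
    comp_functor1 comp_functorM.
End CompFunctor.

Record nat_iso A B (F G : functor A B) := NatIso {
  nat_iso_fun :> forall X, hom (F X) (G X);
  nat_iso_inv : forall X, hom (G X) (F X);
  nat_iso_invK : forall X, nat_iso_inv X ∘ nat_iso_fun X = idm (F X);
  nat_iso_funK : forall X, nat_iso_fun X ∘ nat_iso_inv X = idm (G X);
  nat_iso_nat : forall X Y (f : hom X Y),
    nat_iso_fun Y ∘ fmap F f = fmap G f ∘ nat_iso_fun X }.

Definition is_equivalence A B (F : functor A B) : Prop :=
  exists G : functor B A,
    inhabited (nat_iso (comp_functor G F) (id_functor A)) /\
    inhabited (nat_iso (comp_functor F G) (id_functor B)).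

(* [adjunction F G]: G is right adjoint to F *)
Record adjunction A B (F : functor A B) (G : functor B A) := Adjunction {
  adj_unit : forall X : A, hom X (G (F X));
  adj_counit : forall Y : B, hom (F (G Y)) Y;
  adj_unit_nat : forall X X' (f : hom X X'),
    adj_unit X' ∘ f = fmap G (fmap F f) ∘ adj_unit X;
  adj_counit_nat : forall Y Y' (g : hom Y Y'),
    adj_counit Y' ∘ fmap F (fmap G g) = g ∘ adj_counit Y;
  adj_triangle_l : forall X,
    adj_counit (F X) ∘ fmap F (adj_unit X) = idm (F X);
  adj_triangle_r : forall Y,
    fmap G (adj_counit Y) ∘ adj_unit (G Y) = idm (G Y) }.

Definition is_iso (A : preaddCat) (X Y : A) (f : hom X Y) : Prop :=
  exists g : hom Y X, g ∘ f = idm X /\ f ∘ g = idm Y.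

Definition is_zero_ob (A : preaddCat) (Z : A) : Prop :=
  forall X, (forall f : hom X Z, f = 0) /\ (forall f : hom Z X, f = 0).

Definition is_biproduct (A : preaddCat) (X Y P : A) (i : hom X P) (j : hom Y P)
    (p : hom P X) (q : hom P Y) : Prop :=
  [/\ p ∘ i = idm X, q ∘ j = idm Y, p ∘ j = 0, q ∘ i = 0
    & i ∘ p + j ∘ q = idm P].

Definition is_additive (A : preaddCat) : Prop :=
  (exists Z : A, is_zero_ob Z) /\
  (forall X Y : A, exists (P : A) (i : hom X P) (j : hom Y P)
     (p : hom P X) (q : hom P Y), is_biproduct i j p q).

Record triData := TriData {
  tri_cat :> preaddCat;
  susp : functor tri_cat tri_cat;
  dist : forall X Y Z : tri_cat,
    hom X Y -> hom Y Z -> hom Z (susp X) -> Prop }.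

Arguments susp {t}.

Definition tri_isomorphic (A : preaddCat) (S : functor A A)
    (X Y Z : A) (f : hom X Y) (g : hom Y Z) (h : hom Z (S X))
    (X' Y' Z' : A) (f' : hom X' Y') (g' : hom Y' Z') (h' : hom Z' (S X'))
    : Prop :=
  exists (a : hom X X') (b : hom Y Y') (c : hom Z Z'),
    [/\ is_iso a, is_iso b & is_iso c] /\
    [/\ b ∘ f = f' ∘ a, c ∘ g = g' ∘ b & fmap S a ∘ h = h' ∘ c].

(* Verdier's axioms; the suspension is a self-equivalence, not necessarily an
   automorphism. *)
Record is_triangulated (T : triData) : Prop := IsTriangulated {
  tr_additive : is_additive T;
  tr_susp_additive : additive_functor (@susp T);
  tr_susp_equiv : is_equivalence (@susp T);
  tr_iso : forall (X Y Z : T) (f : hom X Y) (g : hom Y Z) (h : hom Z (susp X))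
      (X' Y' Z' : T) (f' : hom X' Y') (g' : hom Y' Z') (h' : hom Z' (susp X')),
    tri_isomorphic f g h f' g' h' -> dist f g h -> dist f' g' h';
  tr_id : forall X Z : T, is_zero_ob Z ->
    dist (idm X) (0 : hom X Z) (0 : hom Z (susp X));
  tr_cone : forall (X Y : T) (f : hom X Y),
    exists (Z : T) (g : hom Y Z) (h : hom Z (susp X)), dist f g h;
  tr_rot : forall (X Y Z : T) (f : hom X Y) (g : hom Y Z) (h : hom Z (susp X)),
    dist f g h <-> dist g h (- fmap susp f);
  tr_fill : forall (X Y Z : T) (f : hom X Y) (g : hom Y Z) (h : hom Z (susp X))
      (X' Y' Z' : T) (f' : hom X' Y') (g' : hom Y' Z') (h' : hom Z' (susp X'))
      (a : hom X X') (b : hom Y Y'),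
    dist f g h -> dist f' g' h' -> b ∘ f = f' ∘ a ->
    exists c : hom Z Z', c ∘ g = g' ∘ b /\ fmap susp a ∘ h = h' ∘ c;
  tr_oct : forall (X Y Z : T) (f : hom X Y) (g : hom Y Z)
      (U V W : T) (i : hom Y U) (p : hom U (susp X))
      (j : hom Z V) (q : hom V (susp Y)) (k : hom Z W) (r : hom W (susp X)),
    dist f i p -> dist g j q -> dist (g ∘ f) k r ->
    exists (a : hom U W) (b : hom W V),
      dist a b (fmap susp i ∘ q) /\
      [/\ a ∘ i = k ∘ g, r ∘ a = p, b ∘ k = j & q ∘ b = fmap susp f ∘ r] }.

Record triCat := TriCat {
  tri_data :> triData;
  tri_axioms : is_triangulated tri_data }.

Record exact_functor (T T' : triData) := ExactFunctor {
  exact_fun :> functor T T';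
  exact_add : additive_functor exact_fun;
  exact_susp : nat_iso (comp_functor exact_fun (@susp T))
                       (comp_functor (@susp T') exact_fun);
  exact_dist : forall (X Y Z : T)
      (f : hom X Y) (g : hom Y Z) (h : hom Z (susp X)),
    dist f g h ->
    dist (fmap exact_fun f) (fmap exact_fun g) (exact_susp X ∘ fmap exact_fun h)
}.

(* Homological grading by [int].  To avoid transports along equations between
   degrees, differentials, compositions and actions take the target degree as
   an argument, together with a proof of the relation between the degrees. *)

Definition ksign (i : int) : int := (-1) ^ i.

Record dgCat := DgCat {
  dgob :> Type;
  dghom : dgob -> dgob -> int -> zmodType;
  dgd : forall X Y (i j : int), j + 1 = i -> dghom X Y i -> dghom X Y j;
  dgid : forall X, dghom X X 0;
  dgcomp : forall X Y Z (i j k : int),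
    i + j = k -> dghom Y Z i -> dghom X Y j -> dghom X Z k;
  dgdD : forall X Y (i j : int) (e : j + 1 = i) (f g : dghom X Y i),
    dgd e (f + g) = dgd e f + dgd e g;
  dgdd : forall X Y (i j k : int) (e : j + 1 = i) (e' : k + 1 = j) (f : dghom X Y i),
    dgd e' (dgd e f) = 0;
  dgcompDl : forall X Y Z (i j k : int) (e : i + j = k)
      (g g' : dghom Y Z i) (f : dghom X Y j),
    dgcomp e (g + g') f = dgcomp e g f + dgcomp e g' f;
  dgcompDr : forall X Y Z (i j k : int) (e : i + j = k)
      (g : dghom Y Z i) (f f' : dghom X Y j),
    dgcomp e g (f + f') = dgcomp e g f + dgcomp e g f';
  dgcompA : forall X Y Z W (i j k ij jk l : int)
      (eij : i + j = ij) (ejk : j + k = jk) (el : i + jk = l) (el' : ij + k = l)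
      (h : dghom Z W i) (g : dghom Y Z j) (f : dghom X Y k),
    dgcomp el h (dgcomp ejk g f) = dgcomp el' (dgcomp eij h g) f;
  dgcomp1f : forall X Y (i : int) (e : 0 + i = i) (f : dghom X Y i),
    dgcomp e (dgid Y) f = f;
  dgcompf1 : forall X Y (i : int) (e : i + 0 = i) (f : dghom X Y i),
    dgcomp e f (dgid X) = f;
  dgd_id : forall X (j : int) (e : j + 1 = 0), dgd e (dgid X) = 0;
  dgd_comp : forall X Y Z (i j k i' j' k' : int) (e : i + j = k)
      (ei : i' + 1 = i) (ej : j' + 1 = j) (ek : k' + 1 = k)
      (e1 : i' + j = k') (e2 : i + j' = k')
      (g : dghom Y Z i) (f : dghom X Y j),
    dgd ek (dgcomp e g f) =
      dgcomp e1 (dgd ei g) f + dgcomp e2 g (dgd ej f) *~ ksign i }.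

(* covariant dg functors from B to chain complexes of abelian groups *)
Record dgMod (B : dgCat) := DgMod {
  mob :> B -> int -> zmodType;
  md : forall Z (i j : int), j + 1 = i -> mob Z i -> mob Z j;
  mact : forall Y Z (i j k : int),
    i + j = k -> dghom Y Z i -> mob Y j -> mob Z k;
  mdD : forall Z (i j : int) (e : j + 1 = i) (x y : mob Z i),
    md e (x + y) = md e x + md e y;
  mdd : forall Z (i j k : int) (e : j + 1 = i) (e' : k + 1 = j) (x : mob Z i),
    md e' (md e x) = 0;
  mactDl : forall Y Z (i j k : int) (e : i + j = k)
      (f g : dghom Y Z i) (x : mob Y j),
    mact e (f + g) x = mact e f x + mact e g x;
  mactDr : forall Y Z (i j k : int) (e : i + j = k)
      (f : dghom Y Z i) (x y : mob Y j),
    mact e f (x + y) = mact e f x + mact e f y;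
  mactA : forall X Y Z (i j k ij jk l : int)
      (eij : i + j = ij) (ejk : j + k = jk) (el : i + jk = l) (el' : ij + k = l)
      (g : dghom Y Z i) (f : dghom X Y j) (x : mob X k),
    mact el g (mact ejk f x) = mact el' (dgcomp eij g f) x;
  mact1 : forall Z (i : int) (e : 0 + i = i) (x : mob Z i), mact e (dgid Z) x = x;
  md_act : forall Y Z (i j k i' j' k' : int) (e : i + j = k)
      (ei : i' + 1 = i) (ej : j' + 1 = j) (ek : k' + 1 = k)
      (e1 : i' + j = k') (e2 : i + j' = k')
      (f : dghom Y Z i) (x : mob Y j),
    md ek (mact e f x) =
      mact e1 (dgd ei f) x + mact e2 f (md ej x) *~ ksign i }.

(* The maps phi |-> phi . u, for u a 0-cycle, are automatically chain maps, so
   they are isomorphisms of complexes as soon as they are bijective. *)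
Record representation (B : dgCat) (M : dgMod B) := Representation {
  rep_ob :> B;
  rep_elt : M rep_ob 0;
  rep_cycle : forall (j : int) (e : j + 1 = 0), md e rep_elt = 0;
  rep_fact : forall Z k, M Z k -> dghom rep_ob Z k;
  rep_factK : forall Z (k : int) (e : k + 0 = k) (x : M Z k),
    mact e (rep_fact x) rep_elt = x;
  rep_actK : forall Z (k : int) (e : k + 0 = k) (phi : dghom rep_ob Z k),
    rep_fact (mact e phi rep_elt) = phi }.

Definition representable (B : dgCat) (M : dgMod B) : Prop :=
  inhabited (representation M).

Lemma ksignM i j : ksign (i + j) = ksign i * ksign j.
Proof. by rewrite /ksign exprzDr ?unitrN1. Qed.

Lemma ksign1 : ksign 1 = -1. Proof. by []. Qed.

Lemma ksignK i : ksign i * ksign i = 1.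
Proof. by rewrite /ksign -exprzMl ?unitrN1 // mulrNN mulr1 exp1rz. Qed.

Lemma morphD_zmod (U V : zmodType) (f : U -> V) :
  {morph f : x y / x + y} -> zmod_morphism f.
Proof.
move=> fD x y.
suff fN z : f (- z) = - f z by rewrite fD fN.
have f0 : f 0 = 0 by apply: (addIr (f 0)); rewrite -fD !add0r.
by apply: (addIr (f z)); rewrite -fD !addNr.
Qed.

Section Additivity.
Variable B : dgCat.

HB.instance Definition _ (X Y : B) (i j : int) (e : j + 1 = i) :=
  GRing.isZmodMorphism.Build (dghom X Y i) (dghom X Y j) (dgd e)
    (morphD_zmod (@dgdD B X Y i j e)).

HB.instance Definition _ (X Y Z : B) (i j k : int) (e : i + j = k) (g : dghom Y Z i) :=
  GRing.isZmodMorphism.Build (dghom X Y j) (dghom X Z k) (dgcomp e g)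
    (morphD_zmod (@dgcompDr B X Y Z i j k e g)).

Definition dgcompr (X Y Z : B) (i j k : int) (e : i + j = k) (f : dghom X Y j)
  (g : dghom Y Z i) := dgcomp e g f.

HB.instance Definition _ (X Y Z : B) (i j k : int) (e : i + j = k) (f : dghom X Y j) :=
  GRing.isZmodMorphism.Build (dghom Y Z i) (dghom X Z k)
    (@dgcompr X Y Z i j k e f)
    (morphD_zmod (fun g g' => @dgcompDl B X Y Z i j k e g g' f)).

Lemma dgcompMzl (X Y Z : B) (i j k : int) (e : i + j = k)
    (g : dghom Y Z i) (f : dghom X Y j) (m : int) :
  dgcomp e (g *~ m) f = dgcomp e g f *~ m.
Proof. exact: (raddfMz (@dgcompr X Y Z i j k e f)). Qed.

Lemma dgcompNl (X Y Z : B) (i j k : int) (e : i + j = k)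
    (g : dghom Y Z i) (f : dghom X Y j) :
  dgcomp e (- g) f = - dgcomp e g f.
Proof. exact: (raddfN (@dgcompr X Y Z i j k e f)). Qed.

Lemma dgcomp0l (X Y Z : B) (i j k : int) (e : i + j = k) (f : dghom X Y j) :
  dgcomp e (0 : dghom Y Z i) f = 0.
Proof. exact: (raddf0 (@dgcompr X Y Z i j k e f)). Qed.

Lemma dgcomp0r (X Y Z : B) (i j k : int) (e : i + j = k) (g : dghom Y Z i) :
  dgcomp e g (0 : dghom X Y j) = 0.
Proof. exact: raddf0. Qed.

Variable M : dgMod B.

HB.instance Definition _ (Z : B) (i j : int) (e : j + 1 = i) :=
  GRing.isZmodMorphism.Build (M Z i) (M Z j) (md e)
    (morphD_zmod (@mdD B M Z i j e)).

HB.instance Definition _ (Y Z : B) (i j k : int) (e : i + j = k) (f : dghom Y Z i) :=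
  GRing.isZmodMorphism.Build (M Y j) (M Z k) (mact e f)
    (morphD_zmod (@mactDr B M Y Z i j k e f)).

Lemma mact0r (Y Z : B) (i j k : int) (e : i + j = k) (f : dghom Y Z i) :
  mact e f (0 : M Y j) = 0.
Proof. exact: raddf0. Qed.
End Additivity.

Section ShiftModule.
Variables (B : dgCat) (X : B) (m : int).

Definition shift_ob (Z : B) (i : int) : zmodType := dghom X Z (i - m).

Lemma shift_degd (i j : int) : j + 1 = i -> (j - m) + 1 = i - m.
Proof. lia. Qed.

Lemma shift_dega (i j k : int) : i + j = k -> i + (j - m) = k - m.
Proof. lia. Qed.

Definition shift_d Z (i j : int) (e : j + 1 = i) (x : shift_ob Z i) : shift_ob Z j :=
  dgd (shift_degd e) x *~ ksign m.

Definition shift_act Y Z (i j k : int) (e : i + j = k) (f : dghom Y Z i)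
    (x : shift_ob Y j) : shift_ob Z k :=
  dgcomp (shift_dega e) f x *~ ksign (m * i).

Lemma shift_dD Z (i j : int) (e : j + 1 = i) (x y : shift_ob Z i) :
  shift_d e (x + y) = shift_d e x + shift_d e y.
Proof. by rewrite /shift_d raddfD /= mulrzDl. Qed.

Lemma shift_dd Z (i j k : int) (e : j + 1 = i) (e' : k + 1 = j) (x : shift_ob Z i) :
  shift_d e' (shift_d e x) = 0.
Proof. by rewrite /shift_d raddfMz /= dgdd !mul0rz. Qed.

Lemma shift_actDl Y Z (i j k : int) (e : i + j = k)
    (f g : dghom Y Z i) (x : shift_ob Y j) :
  shift_act e (f + g) x = shift_act e f x + shift_act e g x.
Proof. by rewrite /shift_act dgcompDl mulrzDl. Qed.

Lemma shift_actDr Y Z (i j k : int) (e : i + j = k)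
    (f : dghom Y Z i) (x y : shift_ob Y j) :
  shift_act e f (x + y) = shift_act e f x + shift_act e f y.
Proof. by rewrite /shift_act dgcompDr mulrzDl. Qed.

Lemma shift_actA W Y Z (i j k ij jk l : int)
    (eij : i + j = ij) (ejk : j + k = jk) (el : i + jk = l) (el' : ij + k = l)
    (g : dghom Y Z i) (f : dghom W Y j) (x : shift_ob W k) :
  shift_act el g (shift_act ejk f x) = shift_act el' (dgcomp eij g f) x.
Proof.
rewrite /shift_act raddfMz /= -mulrzA -ksignM.
rewrite (dgcompA eij _ _ (shift_dega el')).
by congr (_ *~ ksign _); rewrite -eij; ring.
Qed.

Lemma shift_act1 Z (i : int) (e : 0 + i = i) (x : shift_ob Z i) :
  shift_act e (dgid Z) x = x.
Proof. by rewrite /shift_act dgcomp1f mulr0. Qed.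

Lemma shift_d_act Y Z (i j k i' j' k' : int) (e : i + j = k)
    (ei : i' + 1 = i) (ej : j' + 1 = j) (ek : k' + 1 = k)
    (e1 : i' + j = k') (e2 : i + j' = k')
    (f : dghom Y Z i) (x : shift_ob Y j) :
  shift_d ek (shift_act e f x) =
    shift_act e1 (dgd ei f) x + shift_act e2 f (shift_d ej x) *~ ksign i.
Proof.
rewrite /shift_d /shift_act !raddfMz /=.
rewrite (dgd_comp _ ei (shift_degd ej) _ (shift_dega e1) (shift_dega e2)).
rewrite !mulrzDl -!mulrzA; congr (_ *~ _ + _ *~ _); last by ring.
by rewrite -ei mulrDr mulr1 ksignM -mulrA ksignK mulr1.
Qed.

Definition shift_mod : dgMod B :=
  DgMod shift_dD shift_dd shift_actDl shift_actDr shift_actA shift_act1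
    shift_d_act.
End ShiftModule.

Lemma degd0 : (-1) + 1 = 0 :> int. Proof. by []. Qed.
Lemma degd1 : 0 + 1 = 1 :> int. Proof. by []. Qed.
Lemma deg00 : 0 + 0 = 0 :> int. Proof. by []. Qed.

Section Cycles.
Variables (B : dgCat) (X Y : B).

Definition is_cycle : {pred dghom X Y 0} := [pred f | dgd degd0 f == 0].

Lemma is_cycle_closed : zmod_closed is_cycle.
Proof.
split=> [|f g]; rewrite !inE ?raddf0 // raddfB /= => /eqP-> /eqP->.
by rewrite subr0.
Qed.

HB.instance Definition _ :=
  GRing.isZmodClosed.Build (dghom X Y 0) is_cycle is_cycle_closed.

(* closed morphisms X -> Y *)
Record cycles := Cycle { cval : dghom X Y 0; cvalP : cval \in is_cycle }.

HB.instance Definition _ := [isSub for cval].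
HB.instance Definition _ := [Choice of cycles by <:].
HB.instance Definition _ := [SubChoice_isSubZmodule of cycles by <:].

Definition is_boundary : {pred cycles} :=
  [pred f : cycles | `[< exists h : dghom X Y 1, dgd degd1 h = cval f >]].

Lemma is_boundary_closed : zmod_closed is_boundary.
Proof.
split=> [|f g]; rewrite !inE.
  by apply/asboolP; exists 0; rewrite raddf0.
move=> /asboolP[h hf] /asboolP[k kg]; apply/asboolP; exists (h - k).
by rewrite raddfB /= hf kg.
Qed.

HB.instance Definition _ :=
  GRing.isZmodClosed.Build cycles is_boundary is_boundary_closed.

(* H_0(B(X,Y)) *)
Definition H0 : zmodType := Quotient.quot is_boundary.

Definition hclass (f : cycles) : H0 := \pi f.

End Cycles.

Section HomologyCategory.
Variable B : dgCat.
Implicit Types X Y Z W : B.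

Lemma cycle_d X Y (f : cycles X Y) j (e : j + 1 = 0) : dgd e (cval f) = 0.
Proof.
have ej : j = -1 by lia.
rewrite ej in e *; rewrite (_ : e = degd0); last exact: Prop_irrelevance.
exact/eqP/(cvalP f).
Qed.

Lemma cycle_inj X Y (f g : cycles X Y) : cval f = cval g -> f = g.
Proof. exact: val_inj. Qed.

Lemma cycle_idP X : dgid X \in @is_cycle B X X.
Proof. by rewrite inE dgd_id. Qed.

Definition cycle_id X : cycles X X := Cycle (cycle_idP X).

Lemma cycle_compP X Y Z (g : cycles Y Z) (f : cycles X Y) :
  dgcomp deg00 (cval g) (cval f) \in @is_cycle B X Z.
Proof.
rewrite inE (dgd_comp _ degd0 degd0 _ (addr0 _ : -1 + 0 = -1 :> int)
  (add0r _ : 0 + -1 = -1 :> int)).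
by rewrite !cycle_d dgcomp0l raddf0 mul0rz addr0.
Qed.

Definition cycle_comp X Y Z (g : cycles Y Z) (f : cycles X Y) : cycles X Z :=
  Cycle (cycle_compP g f).

Lemma hclassP X Y (f g : cycles X Y) :
  (exists h : dghom X Y 1, dgd degd1 h = cval f - cval g) <->
  hclass f = hclass g.
Proof.
split=> [h|fg]; first by apply/eqP; rewrite /hclass -Quotient.idealrBE; apply/asboolP.
by move/eqP: fg; rewrite /hclass -Quotient.idealrBE => /asboolP.
Qed.

Lemma hclassD X Y (f g : cycles X Y) : hclass (f + g) = hclass f + hclass g.
Proof. by rewrite /hclass !piE. Qed.

Lemma hclass_repr X Y (f : H0 X Y) : hclass (repr f) = f.
Proof. exact: reprK. Qed.

Definition hcomp X Y Z (g : H0 Y Z) (f : H0 X Y) : H0 X Z :=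
  hclass (cycle_comp (repr g) (repr f)).

Lemma hcompE X Y Z (g : cycles Y Z) (f : cycles X Y) :
  hcomp (hclass g) (hclass f) = hclass (cycle_comp g f).
Proof.
have [h hP] := (hclassP (repr (hclass g)) g).2 (hclass_repr _).
have [k kP] := (hclassP (repr (hclass f)) f).2 (hclass_repr _).
apply/hclassP => /=.
set g' := repr _ in hP *; set f' := repr _ in kP *.
exists (dgcomp (addr0 1) h (cval f') + dgcomp (add0r 1) (cval g) k).
rewrite raddfD /= (dgd_comp _ degd1 degd0 _ deg00 (addrN 1)) cycle_d.
rewrite dgcomp0r mul0rz addr0 hP dgcompDl dgcompNl.
rewrite (dgd_comp _ degd0 degd1 _ (addNr 1) deg00) cycle_d dgcomp0l add0r.
by rewrite mulr1z kP raddfB /= addrA addrNK.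
Qed.

Lemma hcompA X Y Z W (h : H0 Z W) (g : H0 Y Z) (f : H0 X Y) :
  hcomp h (hcomp g f) = hcomp (hcomp h g) f.
Proof.
rewrite -(hclass_repr h) -(hclass_repr g) -(hclass_repr f) !hcompE.
by congr hclass; apply: cycle_inj; apply: dgcompA.
Qed.

Lemma hcomp1f X Y (f : H0 X Y) : hcomp (hclass (cycle_id Y)) f = f.
Proof.
rewrite -(hclass_repr f) hcompE; congr hclass; apply: cycle_inj.
exact: dgcomp1f.
Qed.

Lemma hcompf1 X Y (f : H0 X Y) : hcomp f (hclass (cycle_id X)) = f.
Proof.
rewrite -(hclass_repr f) hcompE; congr hclass; apply: cycle_inj.
exact: dgcompf1.
Qed.

Lemma hcompDl X Y Z (g g' : H0 Y Z) (f : H0 X Y) :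
  hcomp (g + g') f = hcomp g f + hcomp g' f.
Proof.
rewrite -(hclass_repr g) -(hclass_repr g') -(hclass_repr f).
rewrite -hclassD !hcompE -hclassD; congr hclass; apply: cycle_inj.
exact: dgcompDl.
Qed.

Lemma hcompDr X Y Z (g : H0 Y Z) (f f' : H0 X Y) :
  hcomp g (f + f') = hcomp g f + hcomp g f'.
Proof.
rewrite -(hclass_repr g) -(hclass_repr f) -(hclass_repr f').
rewrite -hclassD !hcompE -hclassD; congr hclass; apply: cycle_inj.
exact: dgcompDr.
Qed.

Definition Hcat : preaddCat :=
  @PreaddCat B (@H0 B) (fun X => hclass (cycle_id X)) hcomp
    hcompA hcomp1f hcompf1 hcompDl hcompDr.

End HomologyCategory.

Section ConeModule.
Variables (B : dgCat) (X Y : B) (f : cycles X Y).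

Definition cone_ob (Z : B) (k : int) : zmodType :=
  (dghom Y Z k * dghom X Z (k + 1))%type.

Lemma cone_degd (i j : int) : j + 1 = i -> (j + 1) + 1 = i + 1.
Proof. lia. Qed.

Lemma cone_degf (i j : int) : j + 1 = i -> i + 0 = j + 1.
Proof. lia. Qed.

Lemma cone_dega (i j k : int) : i + j = k -> i + (j + 1) = k + 1.
Proof. lia. Qed.

Definition cone_d Z (i j : int) (e : j + 1 = i) (x : cone_ob Z i) : cone_ob Z j :=
  (dgd e x.1, dgcomp (cone_degf e) x.1 (cval f) - dgd (cone_degd e) x.2).

Definition cone_act Z W (i j k : int) (e : i + j = k) (phi : dghom Z W i)
    (x : cone_ob Z j) : cone_ob W k :=
  (dgcomp e phi x.1, dgcomp (cone_dega e) phi x.2 *~ ksign i).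

Lemma cone_dD Z (i j : int) (e : j + 1 = i) (x y : cone_ob Z i) :
  cone_d e (x + y) = cone_d e x + cone_d e y.
Proof.
congr pair => /=; rewrite raddfD //= dgcompDl opprD.
by rewrite addrACA.
Qed.

Lemma cone_dd Z (i j k : int) (e : j + 1 = i) (e' : k + 1 = j) (x : cone_ob Z i) :
  cone_d e' (cone_d e x) = 0.
Proof.
congr pair => /=; first exact: dgdd.
rewrite raddfB /= dgdd subr0.
have e2 : i + (-1) = k + 1 by lia.
rewrite (dgd_comp _ e degd0 _ (cone_degf e') e2) cycle_d dgcomp0r mul0rz addr0.
by rewrite subrr.
Qed.

Lemma cone_actDl Z W (i j k : int) (e : i + j = k)
    (g h : dghom Z W i) (x : cone_ob Z j) :
  cone_act e (g + h) x = cone_act e g x + cone_act e h x.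
Proof. by congr pair => /=; rewrite dgcompDl // mulrzDl. Qed.

Lemma cone_actDr Z W (i j k : int) (e : i + j = k)
    (g : dghom Z W i) (x y : cone_ob Z j) :
  cone_act e g (x + y) = cone_act e g x + cone_act e g y.
Proof. by congr pair => /=; rewrite dgcompDr // mulrzDl. Qed.

Lemma cone_actA V W Z (i j k ij jk l : int)
    (eij : i + j = ij) (ejk : j + k = jk) (el : i + jk = l) (el' : ij + k = l)
    (h : dghom W Z i) (g : dghom V W j) (x : cone_ob V k) :
  cone_act el h (cone_act ejk g x) = cone_act el' (dgcomp eij h g) x.
Proof.
congr pair => /=; first exact: dgcompA.
rewrite raddfMz /= -mulrzA (dgcompA eij _ _ (cone_dega el')).
by congr (_ *~ _); rewrite -eij ksignM mulrC.
Qed.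

Lemma cone_act1 Z (i : int) (e : 0 + i = i) (x : cone_ob Z i) :
  cone_act e (dgid Z) x = x.
Proof. by case: x => a b; congr pair => /=; rewrite dgcomp1f. Qed.

Lemma cone_d_act Z W (i j k i' j' k' : int) (e : i + j = k)
    (ei : i' + 1 = i) (ej : j' + 1 = j) (ek : k' + 1 = k)
    (e1 : i' + j = k') (e2 : i + j' = k')
    (g : dghom Z W i) (x : cone_ob Z j) :
  cone_d ek (cone_act e g x) =
    cone_act e1 (dgd ei g) x + cone_act e2 g (cone_d ej x) *~ ksign i.
Proof.
have mz (u : cone_ob W k') (m : int) : u *~ m = (u.1 *~ m, u.2 *~ m).
  have mn n : u *+ n = (u.1 *+ n, u.2 *+ n).
    by elim: n => [|n IHn] //; rewrite !mulrS IHn.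
  by case: m => n; rewrite ?NegzE ?mulrNz -!pmulrn mn.
rewrite mz; congr pair => /=; first exact: dgd_comp.
rewrite raddfB /= raddfMz /=.
rewrite (dgd_comp _ ei (cone_degd ej) _ (cone_dega e1) (cone_dega e2)).
rewrite -mulrzA ksignK mulr1z mulrzDl -mulrzA ksignK mulr1z.
rewrite -(dgcompA _ (cone_degf ej) (cone_dega e2)).
have -> : ksign i = - ksign i' by rewrite -ei ksignM ksign1 mulrN1.
by rewrite mulrNz opprD opprK addrCA.
Qed.

Definition cone_mod : dgMod B :=
  DgMod cone_dD cone_dd cone_actDl cone_actDr cone_actA cone_act1 cone_d_act.
End ConeModule.

Definition pretriangulated (B : dgCat) : Prop :=
  [/\ exists Z : B, forall (X : B) (k : int),
        (forall f : dghom X Z k, f = 0) /\ (forall f : dghom Z X k, f = 0),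
      forall (X : B) (m : int), representable (shift_mod X m)
    & forall (X Y : B) (f : cycles X Y), representable (cone_mod f)].

Section RepresentationTheory.
Variables (B : dgCat) (M : dgMod B) (R : representation M).

Lemma rep_inj Z (k : int) (e : k + 0 = k) (f g : dghom R Z k) :
  mact e f (rep_elt R) = mact e g (rep_elt R) -> f = g.
Proof. by move=> fg; rewrite -[f](rep_actK e) fg rep_actK. Qed.

Lemma rep_factD Z k (x y : M Z k) :
  rep_fact R (x + y) = rep_fact R x + rep_fact R y.
Proof.
by apply: (rep_inj (e := addr0 k)); rewrite mactDl !rep_factK.
Qed.

HB.instance Definition _ Z (k : int) :=
  GRing.isZmodMorphism.Build (M Z k) (dghom R Z k) (@rep_fact B M R Z k)
    (morphD_zmod (@rep_factD Z k)).

Lemma rep_fact_d Z (i j : int) (e : j + 1 = i) (x : M Z i) :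
  dgd e (rep_fact R x) = rep_fact R (md e x).
Proof.
apply: (rep_inj (e := addr0 j)); rewrite rep_factK.
have e2 : i + (-1) = j by lia.
rewrite -[in RHS](rep_factK R (addr0 i) x).
rewrite (md_act _ e degd0 _ (addr0 j) e2).
by rewrite rep_cycle mact0r mul0rz addr0.
Qed.
End RepresentationTheory.

(* A choice, for every X, of an object X[1] that represents B(X,-)[-1]; its
   universal 0-cycle is an element of degree 0 - (-1) = 1 of B(X,X[1]). *)
Definition shift_choice (B : dgCat) : Type :=
  forall X : B, representation (shift_mod X (-1)).

Section HomologyShift.
Variables (B : dgCat) (s : shift_choice B).
Implicit Types X Y Z : B.

Definition sh_unit X : dghom X (s X) 1 := rep_elt (s X).

Lemma sh_unit_d X (j : int) (e : j + 1 = 1) : dgd e (sh_unit X) = 0.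
Proof.
have ej : j = -1 - -1 by lia.
rewrite ej in e *.
have /eqP := rep_cycle (s X) degd0; rewrite /= /shift_d.
rewrite (_ : @shift_degd (-1) 0 (-1) degd0 = e); last exact: Prop_irrelevance.
by rewrite mulrN1z oppr_eq0 => /eqP.
Qed.

(* x f, for x in B(Y,Z)[-1] and a closed morphism f : X -> Y *)
Definition sh_pull X Y Z (k : int) (f : cycles X Y)
    (x : shift_mod Y (-1) Z k) : shift_mod X (-1) Z k :=
  dgcomp (addr0 (k - (-1))) x (cval f).

Lemma sh_pullD X Y Z (k : int) (f : cycles X Y)
    (x y : shift_mod Y (-1) Z k) :
  sh_pull f (x + y) = sh_pull f x + sh_pull f y.
Proof. exact: dgcompDl. Qed.

Lemma sh_pull_d X Y Z (i j : int) (e : j + 1 = i) (f : cycles X Y)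
    (x : shift_mod Y (-1) Z i) :
  md e (sh_pull f x) = sh_pull f (md e x).
Proof.
rewrite /= /shift_d /sh_pull dgcompMzl; congr (_ *~ _).
have e2 : i - (-1) + (-1) = j - (-1) by lia.
rewrite (dgd_comp _ (shift_degd (-1) e) degd0 _ (addr0 (j - (-1))) e2).
by rewrite cycle_d dgcomp0r mul0rz addr0.
Qed.

Lemma sh_pull_act X Y Z W (i j k : int) (e : i + j = k) (f : cycles X Y)
    (g : dghom Z W i) (x : shift_mod Y (-1) Z j) :
  sh_pull f (mact e g x) = mact e g (sh_pull f x).
Proof.
rewrite /= /shift_act /sh_pull dgcompMzl; congr (_ *~ _).
by apply/esym; apply: dgcompA.
Qed.

Lemma sh_cycleP X Y (f : cycles X Y) :
  rep_fact (s X) (sh_pull f (rep_elt (s Y))) \in @is_cycle B (s X) (s Y).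
Proof.
rewrite inE rep_fact_d sh_pull_d rep_cycle.
by rewrite /sh_pull dgcomp0l raddf0.
Qed.

(* the closed morphism f[1] : X[1] -> Y[1] with f[1] u_X = u_Y f *)
Definition sh_cycle X Y (f : cycles X Y) : cycles (s X) (s Y) :=
  Cycle (sh_cycleP f).

Lemma sh_cycle_unique X Y (f : cycles X Y) (g : cycles (s X) (s Y))
    (e : 0 + 0 = 0 :> int) :
  mact e (cval g) (rep_elt (s X)) = sh_pull f (rep_elt (s Y)) ->
  g = sh_cycle f.
Proof.
by move=> gP; apply: cycle_inj; rewrite /= -gP rep_actK.
Qed.

Definition sh_map X Y (f : H0 X Y) : H0 (s X) (s Y) :=
  hclass (sh_cycle (repr f)).

Lemma sh_mapE X Y (f : cycles X Y) : sh_map (hclass f) = hclass (sh_cycle f).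
Proof.
have [h hP] := (hclassP (repr (hclass f)) f).2 (hclass_repr _).
apply/hclassP; set f' := repr _ in hP *.
pose x : shift_mod X (-1) (s Y) 1 :=
  dgcomp (erefl : 1 + 1 = 1 - (-1) :> int) (sh_unit Y) h.
exists (rep_fact (s X) x).
rewrite rep_fact_d -[RHS](raddfB (@rep_fact _ _ (s X) (s Y) 0)).
congr (rep_fact _ _); rewrite /= /shift_d /x.
rewrite (dgd_comp _ (erefl : 0 + 1 = 1 :> int) degd1 _
  (erefl : 0 + 1 = 0 - -1 :> int) (addr0 1)).
rewrite sh_unit_d dgcomp0l [0 + dgcomp _ _ _ *~ _]add0r hP.
rewrite -mulrzA ksignK mulr1z raddfB /=.
by congr (_ - _); congr dgcomp; apply: Prop_irrelevance.
Qed.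

Lemma sh_map1 X : sh_map (idm (X : Hcat B)) = idm (rep_ob (s X) : Hcat B).
Proof.
rewrite sh_mapE; congr hclass; apply/esym.
apply: (sh_cycle_unique (e := deg00)).
by rewrite mact1 /sh_pull dgcompf1.
Qed.

Lemma sh_mapM (X Y Z : Hcat B) (g : hom Y Z) (f : hom X Y) :
  sh_map (g ∘ f) = hcomp (sh_map g) (sh_map f).
Proof.
rewrite -(hclass_repr g) -(hclass_repr f) /= hcompE !sh_mapE hcompE.
congr hclass; apply/esym.
apply: (sh_cycle_unique (e := deg00)).
rewrite -[cval (cycle_comp _ _)]/(dgcomp deg00 _ _).
rewrite -(mactA deg00 deg00 deg00) rep_factK -sh_pull_act rep_factK.
by rewrite /sh_pull; apply/esym/dgcompA.
Qed.

Definition Hshift : functor (Hcat B) (Hcat B) :=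
  @Functor (Hcat B) (Hcat B) (fun X => rep_ob (s X)) sh_map sh_map1 sh_mapM.

(* [cone_triangle f i q]: X -f-> Y -i-> Cf -q-> X[1] is the triangle of a
   mapping cone of f *)
Definition cone_triangle X Y (f : cycles X Y) (C : representation (cone_mod f))
    (i : cycles Y C) (q : cycles C (s X)) : Prop :=
  cval i = (rep_elt C).1 /\
  exists p : dghom C X (-1),
    [/\ (forall (j : int) (e : j + 1 = -1), dgd e p = 0),
        mact (addr0 (-1)) p (rep_elt C) = (0, dgid X)
      & cval q = dgcomp (erefl : 1 + -1 = 0 :> int) (sh_unit X) p].

Definition Hdist (X Y Z : Hcat B) (f : hom X Y) (g : hom Y Z)
    (h : hom Z (Hshift X)) : Prop :=
  exists (X' Y' : B) (f' : cycles X' Y') (C : representation (cone_mod f'))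
      (i : cycles Y' C) (q : cycles C (s X')),
    cone_triangle i q /\
    @tri_isomorphic (Hcat B) Hshift X' Y' (rep_ob C) (hclass f')
      (hclass i) (hclass q) X Y Z f g h.

Definition Htri : triData := @TriData (Hcat B) Hshift Hdist.

End HomologyShift.

Definition algebraic (T : triCat) : Prop :=
  exists (B : dgCat) (s : shift_choice B), pretriangulated B /\
    exists F : exact_functor T (Htri s), is_equivalence F.

Record mod_reduction (T : triCat) (n : nat) := ModReduction {
  red_cat : triCat;
  red_fun : exact_functor T red_cat;
  red_adj : functor red_cat T;
  red_adjunction : adjunction red_fun red_adj;
  red_triangle : forall X : T,
    exists h : hom (red_adj (red_fun X)) (susp X),
      dist (idm X *+ n) (adj_unit red_adjunction X) h }.

Definition is_cone (T : triData) (X Y : T) (f : hom X Y) (C : T) : Prop :=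
  exists (g : hom Y C) (h : hom C (susp X)), dist f g h.

(* [Kn] ranges over all the cones of n . Id_K: K/n is any of them. *)
Fixpoint n_order_ge (T : triData) (n k : nat) (X : T) : Prop :=
  if k is k'.+1 then
    forall (K : T) (f : hom K X)
        (Kn : T) (pi : hom K Kn) (d : hom Kn (susp K)),
      dist (idm K *+ n) pi d ->
      exists fbar : hom Kn X, fbar ∘ pi = f /\
        exists C : T, is_cone fbar C /\ n_order_ge n k' C
  else True.

Definition infinite_n_order_ob (T : triData) (n : nat) (X : T) : Prop :=
  forall k, n_order_ge n k X.

Definition infinite_n_order (T : triCat) (n : nat) : Prop :=
  forall Z : T, is_zero_ob Z -> infinite_n_order_ob n Z.

(* Main.v *)
(* Let H(B) be the algebraic triangulated category, and let B/n be the dg category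
   of pairs (X, e), with X in B and e in B(X,X)_1 such that d e = n and e^2 = 0
   (modules in B over the Koszul resolution of Z/n), and of the graded maps that
   commute strictly with e.  It is again pretriangulated, since shifts and cones in
   B inherit an e.  The cone of n . 1_X, with its universal elements i, u and its
   projections p, s, carries e = u s, and restriction along i identifies the maps
   from it to (Y, e) with B(X,Y).  Hence the cones of n give a dg functor left
   adjoint to the forgetful functor, with unit i, and on homology this adjunction is
   a mod-n reduction, because i is the second map of the triangle of n . 1_X.

   For the n-order, the right adjoint rho^* of an exact functor is exact; so a
   morphism f : K -> rho^* Y extends to rho^* of the transpose rho_* K -> Y of f,
   whose cone is again of the form rho^* Z, and zero objects are in the image of
   rho^*. *)
From HB Require Import structures.
From mathcomp Require Import all_boot all_order all_algebra.
From mathcomp Require Import zify ring boolp.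
Require Import Defs.

Set Implicit Arguments.
Unset Strict Implicit.
Unset Printing Implicit Defensive.

Import GRing.Theory.
Local Open Scope ring_scope.
Local Open Scope cat_scope.

(** * Preadditive categories and adjunctions *)

(** The target of a reduction must carry the whole triangulated structure, and B/n is again just a
    pretriangulated dg category. Verdier's axioms are therefore proved for the homology category of
    any pretriangulated dg category and applied to B/n. Since T is only equivalent to H(B), the
    adjunction is finally transported along a quasi-inverse. The main obstacle is the bookkeeping of
    degrees and signs. Cones and shifts are replaced by equational data: a cone is split as a graded
    object by maps i, u, p, s, and a shift is a closed invertible element. Every dg functor
    preserves such data, so it is exact on homology. Identities between graded maps become equations
    between operators, where the differential is itself an operator ∂; words are normalised by
    rewriting, and the remaining linear identity is decided by computation. Strict commutation with
    e is what gives the cone of f an e with d e = n: the cross terms i e f p and i f e p cancel on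
    the nose. *)

Section Preadditive.
Variable A : preaddCat.
Implicit Types X Y Z W : A.

Lemma comp0f X Y Z (f : hom X Y) : (0 : hom Y Z) ∘ f = 0.
Proof. by apply: (addIr (0 ∘ f)); rewrite -compDl !add0r. Qed.

Lemma compf0 X Y Z (g : hom Y Z) : g ∘ (0 : hom X Y) = 0.
Proof. by apply: (addIr (g ∘ 0)); rewrite -compDr !add0r. Qed.

Lemma compNf X Y Z (g : hom Y Z) (f : hom X Y) : (- g) ∘ f = - (g ∘ f).
Proof. by apply: (addIr (g ∘ f)); rewrite -compDl !addNr comp0f. Qed.

Lemma compfN X Y Z (g : hom Y Z) (f : hom X Y) : g ∘ (- f) = - (g ∘ f).
Proof. by apply: (addIr (g ∘ f)); rewrite -compDr !addNr compf0. Qed.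

Lemma compBl X Y Z (g g' : hom Y Z) (f : hom X Y) :
  (g - g') ∘ f = g ∘ f - g' ∘ f.
Proof. by rewrite compDl compNf. Qed.

Lemma compBr X Y Z (g : hom Y Z) (f f' : hom X Y) :
  g ∘ (f - f') = g ∘ f - g ∘ f'.
Proof. by rewrite compDr compfN. Qed.

Lemma compMnl X Y Z (g : hom Y Z) (f : hom X Y) n :
  (g *+ n) ∘ f = (g ∘ f) *+ n.
Proof. by elim: n => [|n IHn]; rewrite ?comp0f // !mulrS compDl IHn. Qed.

Lemma compMnr X Y Z (g : hom Y Z) (f : hom X Y) n :
  g ∘ (f *+ n) = (g ∘ f) *+ n.
Proof. by elim: n => [|n IHn]; rewrite ?compf0 // !mulrS compDr IHn. Qed.

Lemma compMzl X Y Z (g : hom Y Z) (f : hom X Y) (m : int) :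
  (g *~ m) ∘ f = (g ∘ f) *~ m.
Proof. by case: m => n; rewrite ?NegzE ?mulrNz -!pmulrn ?compNf compMnl. Qed.

Lemma compMzr X Y Z (g : hom Y Z) (f : hom X Y) (m : int) :
  g ∘ (f *~ m) = (g ∘ f) *~ m.
Proof. by case: m => n; rewrite ?NegzE ?mulrNz -!pmulrn ?compfN compMnr. Qed.

Lemma is_iso_id X : is_iso (idm X).
Proof. by exists (idm X); rewrite comp1f. Qed.

Lemma is_iso_comp X Y Z (g : hom Y Z) (f : hom X Y) :
  is_iso g -> is_iso f -> is_iso (g ∘ f).
Proof.
move=> [g' [g'g gg']] [f' [f'f ff']]; exists (f' ∘ g').
by rewrite !compA -(compA f') g'g compf1 f'f -(compA g) ff' compf1 gg'.
Qed.

Lemma zero_hom_to Z X (f g : hom X Z) : is_zero_ob Z -> f = g.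
Proof. by move=> /(_ X)[+ _] => fZ; rewrite (fZ f) (fZ g). Qed.

Lemma zero_hom_from Z X (f g : hom Z X) : is_zero_ob Z -> f = g.
Proof. by move=> /(_ X)[_] => fZ; rewrite (fZ f) (fZ g). Qed.

Lemma zero_ob_id Z : idm Z = 0 -> is_zero_ob Z.
Proof.
by move=> Z0 X; split=> f; [rewrite -[f]comp1f | rewrite -[f]compf1];
  rewrite Z0 ?comp0f ?compf0.
Qed.

Lemma zero_ob_iso Z Z' (f : hom Z Z') : is_zero_ob Z -> is_zero_ob Z' -> is_iso f.
Proof.
by move=> Z0 Z'0; exists 0; split; [apply: zero_hom_to | apply: zero_hom_from].
Qed.

(** Yoneda in the form in which exact sequences deliver it: a right inverse [g] comes from
    surjectivity, and the kernel condition applies to [g ∘ f - idm X]. *)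
Lemma bijective_comp_iso X Y (f : hom X Y) :
  (forall W (x : hom W X), f ∘ x = 0 -> x = 0) ->
  (forall W (y : hom W Y), exists x, f ∘ x = y) -> is_iso f.
Proof.
move=> finj fsurj; have [g fg] := fsurj Y (idm Y); exists g; split=> //.
by apply/eqP; rewrite -subr_eq0; apply/eqP/finj; rewrite compBr compA fg
  compf1 comp1f subrr.
Qed.

End Preadditive.

Lemma fmap_iso A B (F : functor A B) (X Y : A) (f : hom X Y) :
  is_iso f -> is_iso (fmap F f).
Proof. by case=> g [gf fg]; exists (fmap F g); rewrite -!fmapM gf fg !fmap1. Qed.

Section AdditiveFunctor.
Variables (A B : preaddCat) (F : functor A B).
Hypothesis FD : additive_functor F.

Lemma fmap0 X Y : fmap F (0 : hom X Y) = 0.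
Proof. by apply: (addIr (fmap F 0)); rewrite -FD !add0r. Qed.


Lemma fmapMn X Y (f : hom X Y) n : fmap F (f *+ n) = fmap F f *+ n.
Proof. by elim: n => [|n IHn]; rewrite ?fmap0 // !mulrS FD IHn. Qed.

End AdditiveFunctor.

(** * Fully faithful functors, equivalences and adjunctions *)

Definition faithful A B (F : functor A B) : Prop :=
  forall (X Y : A) (f g : hom X Y), fmap F f = fmap F g -> f = g.

Definition full A B (F : functor A B) : Prop :=
  forall (X Y : A) (g : hom (F X) (F Y)), exists f : hom X Y, fmap F f = g.

Definition ess_surj A B (F : functor A B) : Prop :=
  forall Y : B, exists (X : A) (f : hom (F X) Y), is_iso f.

Lemma equivalence_faithful A B (F : functor A B) : is_equivalence F -> faithful F.
Proof.
case=> G [[a] _] X Y f g fg.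
have faE h : h = a Y ∘ fmap G (fmap F h) ∘ nat_iso_inv a X.
  by rewrite (nat_iso_nat a) -compA (nat_iso_funK a) compf1.
by rewrite (faE f) (faE g) fg.
Qed.

Lemma equivalence_inverse_faithful A B (F : functor A B) (G : functor B A) :
  nat_iso (comp_functor F G) (id_functor B) -> faithful G.
Proof.
move=> a X Y f g fg.
have faE h : h = a Y ∘ fmap F (fmap G h) ∘ nat_iso_inv a X.
  by rewrite (nat_iso_nat a) -compA (nat_iso_funK a) compf1.
by rewrite (faE f) (faE g) fg.
Qed.

(** The preimage of [g] is [fmap G g] conjugated by the isomorphism [G F = id]; it is checked after
    applying [G], which is faithful. *)
Lemma equivalence_full A B (F : functor A B) : is_equivalence F -> full F.
Proof.
case=> G [[a] [b]] X Y g; exists (a Y ∘ fmap G g ∘ nat_iso_inv a X).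
apply: (equivalence_inverse_faithful b).
set f := _ ∘ _ ∘ _.
have GFf : fmap G (fmap F f) = nat_iso_inv a Y ∘ (f ∘ a X).
  by rewrite -[f ∘ _](nat_iso_nat a f) compA (nat_iso_invK a) comp1f.
rewrite GFf /f -!compA (nat_iso_invK a) compf1 (compA (nat_iso_inv a Y)).
by rewrite (nat_iso_invK a) comp1f.
Qed.

Lemma equivalence_ess_surj A B (F : functor A B) : is_equivalence F -> ess_surj F.
Proof.
case=> G [_ [b]] Y; exists (G Y), (b Y); exists (nat_iso_inv b Y).
by split; [exact: (nat_iso_invK b) | exact: (nat_iso_funK b)].
Qed.

Section FullyFaithful.
Variables (A B : preaddCat) (F : functor A B).
Hypotheses (Ffaithful : faithful F) (Ffull : full F).
Variables (G0 : B -> A) (e : forall Y, hom (F (G0 Y)) Y).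
Variable e' : forall Y, hom Y (F (G0 Y)).
Hypotheses (eK : forall Y, e' Y ∘ e Y = idm _) (e'K : forall Y, e Y ∘ e' Y = idm _).

Definition ff_lift X X' (g : hom (F X) (F X')) : hom X X' :=
  projT1 (cid (Ffull g)).

Lemma ff_liftK X X' (g : hom (F X) (F X')) : fmap F (ff_lift g) = g.
Proof. exact: projT2 (cid (Ffull g)). Qed.

Definition ff_inv_map Y Y' (g : hom Y Y') : hom (G0 Y) (G0 Y') :=
  ff_lift (e' Y' ∘ g ∘ e Y).

Lemma ff_inv_map1 Y : ff_inv_map (idm Y) = idm (G0 Y).
Proof. by apply: Ffaithful; rewrite ff_liftK compf1 eK fmap1. Qed.

Lemma ff_inv_mapM X Y Z (g : hom Y Z) (f : hom X Y) :
  ff_inv_map (g ∘ f) = ff_inv_map g ∘ ff_inv_map f.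
Proof.
apply: Ffaithful; rewrite fmapM !ff_liftK !compA.
by rewrite -(compA _ (e Y) (e' Y)) e'K compf1.
Qed.

Definition ff_inv : functor B A := Functor ff_inv_map1 ff_inv_mapM.

Lemma ff_counit_nat Y Y' (g : hom Y Y') :
  e Y' ∘ fmap F (fmap ff_inv g) = g ∘ e Y.
Proof. by rewrite ff_liftK !compA e'K comp1f. Qed.

Definition ff_unit X : hom X (G0 (F X)) := ff_lift (e' (F X)).
Definition ff_unit_inv X : hom (G0 (F X)) X := ff_lift (e (F X)).

Lemma ff_unitK X : ff_unit_inv X ∘ ff_unit X = idm X.
Proof. by apply: Ffaithful; rewrite fmapM !ff_liftK e'K fmap1. Qed.

Lemma ff_unit_invK X : ff_unit X ∘ ff_unit_inv X = idm (G0 (F X)).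
Proof. by apply: Ffaithful; rewrite fmapM !ff_liftK eK fmap1. Qed.

Lemma ff_unit_inv_nat X X' (f : hom X X') :
  ff_unit_inv X' ∘ fmap ff_inv (fmap F f) = f ∘ ff_unit_inv X.
Proof. by apply: Ffaithful; rewrite !fmapM !ff_liftK !compA e'K comp1f. Qed.

Lemma ff_unit_nat X X' (f : hom X X') :
  ff_unit X' ∘ f = fmap ff_inv (fmap F f) ∘ ff_unit X.
Proof.
by apply: Ffaithful; rewrite !fmapM !ff_liftK -!compA e'K compf1.
Qed.

Lemma ff_equivalence : is_equivalence F.
Proof.
exists ff_inv; split; constructor.
- exact: (@NatIso _ _ (comp_functor ff_inv F) (id_functor A)
    ff_unit_inv ff_unit ff_unit_invK ff_unitK ff_unit_inv_nat).
- exact: (@NatIso _ _ (comp_functor F ff_inv) (id_functor B)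
    e e' eK e'K ff_counit_nat).
Qed.

Lemma ff_triangle_l X : e (F X) ∘ fmap F (ff_unit X) = idm (F X).
Proof. by rewrite ff_liftK e'K. Qed.

Lemma ff_triangle_r Y : fmap ff_inv (e Y) ∘ ff_unit (G0 Y) = idm (G0 Y).
Proof.
apply: Ffaithful; rewrite fmapM !ff_liftK -(compA _ (e (F (G0 Y)))) (e'K (F (G0 Y))).
by rewrite compf1 eK fmap1.
Qed.

(** The two natural isomorphisms in [is_equivalence] need not satisfy the triangle identities. Here
    the quasi-inverse is rebuilt with its unit defined as the lift of the inverse counit, which
    forces them. *)
Definition ff_adjunction : adjunction F ff_inv :=
  @Adjunction _ _ F ff_inv ff_unit e ff_unit_nat ff_counit_nat ff_triangle_l ff_triangle_r.

End FullyFaithful.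

Lemma ff_ess_surj_equivalence A B (F : functor A B) :
  faithful F -> full F -> ess_surj F -> is_equivalence F.
Proof.
move=> Ffaith Ffull Fess.
pose G0 Y := projT1 (cid (Fess Y)).
have e_ex Y : exists e : hom (F (G0 Y)) Y, is_iso e := projT2 (cid (Fess Y)).
pose e Y := projT1 (cid (e_ex Y)).
have e_iso Y : is_iso (e Y) := projT2 (cid (e_ex Y)).
pose e' Y := projT1 (cid (e_iso Y)).
have [eK e'K] := all_and2 (fun Y => projT2 (cid (e_iso Y))).
exact: (ff_equivalence Ffaith Ffull eK e'K).
Qed.

Section CompAdjunction.
Variables (A B C : preaddCat) (F : functor A B) (G : functor B A).
Variables (F' : functor B C) (G' : functor C B).
Variables (a : adjunction F G) (a' : adjunction F' G').

Definition comp_unit X : hom X (G (G' (F' (F X)))) :=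
  fmap G (adj_unit a' (F X)) ∘ adj_unit a X.

Definition comp_counit Y : hom (F' (F (G (G' Y)))) Y :=
  adj_counit a' Y ∘ fmap F' (adj_counit a (G' Y)).

Lemma comp_unit_nat X X' (f : hom X X') :
  comp_unit X' ∘ f = fmap G (fmap G' (fmap F' (fmap F f))) ∘ comp_unit X.
Proof.
by rewrite /comp_unit -compA (adj_unit_nat a) !compA -!fmapM (adj_unit_nat a').
Qed.

Lemma comp_counit_nat Y Y' (g : hom Y Y') :
  comp_counit Y' ∘ fmap F' (fmap F (fmap G (fmap G' g))) = g ∘ comp_counit Y.
Proof.
rewrite /comp_counit -compA -fmapM (adj_counit_nat a) fmapM !compA.
by rewrite (adj_counit_nat a').
Qed.

Lemma comp_triangle_l X :
  comp_counit (F' (F X)) ∘ fmap F' (fmap F (comp_unit X)) = idm (F' (F X)).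
Proof.
rewrite /comp_counit /comp_unit -compA -fmapM (fmapM F) compA.
by rewrite (adj_counit_nat a) -compA (adj_triangle_l a) compf1 (adj_triangle_l a').
Qed.

Lemma comp_triangle_r Y :
  fmap G (fmap G' (comp_counit Y)) ∘ comp_unit (G (G' Y)) = idm (G (G' Y)).
Proof.
rewrite /comp_counit /comp_unit compA -fmapM (fmapM G') -compA.
by rewrite -(adj_unit_nat a') compA (adj_triangle_r a') comp1f (adj_triangle_r a).
Qed.

Definition comp_adjunction : adjunction (comp_functor F' F) (comp_functor G G') :=
  @Adjunction _ _ (comp_functor F' F) (comp_functor G G') comp_unit comp_counit
    comp_unit_nat comp_counit_nat comp_triangle_l comp_triangle_r.
End CompAdjunction.

(** * Triangulated categories *)

(* The part of Verdier's axioms from which the five lemma and the converse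
   rotation follow. *)
Record rotatable (T : triData) : Prop := Rotatable {
  rt_zero : exists Z : T, is_zero_ob Z;
  rt_suspD : additive_functor (@susp T);
  rt_suspI : faithful (@susp T);
  rt_susp_full : full (@susp T);
  rt_iso : forall (X Y Z : T) (f : hom X Y) (g : hom Y Z) (h : hom Z (susp X))
      (X' Y' Z' : T) (f' : hom X' Y') (g' : hom Y' Z') (h' : hom Z' (susp X')),
    tri_isomorphic f g h f' g' h' -> dist f g h -> dist f' g' h';
  rt_id : forall X Z : T, is_zero_ob Z ->
    dist (idm X) (0 : hom X Z) (0 : hom Z (susp X));
  rt_cone : forall (X Y : T) (f : hom X Y),
    exists (Z : T) (g : hom Y Z) (h : hom Z (susp X)), dist f g h;
  rt_rot : forall (X Y Z : T) (f : hom X Y) (g : hom Y Z) (h : hom Z (susp X)),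
    dist f g h -> dist g h (- fmap susp f);
  rt_fill : forall (X Y Z : T) (f : hom X Y) (g : hom Y Z) (h : hom Z (susp X))
      (X' Y' Z' : T) (f' : hom X' Y') (g' : hom Y' Z') (h' : hom Z' (susp X'))
      (a : hom X X') (b : hom Y Y'),
    dist f g h -> dist f' g' h' -> b ∘ f = f' ∘ a ->
    exists c : hom Z Z', c ∘ g = g' ∘ b /\ fmap susp a ∘ h = h' ∘ c }.

Lemma triangulated_rotatable (T : triData) : is_triangulated T -> rotatable T.
Proof.
move=> tT; split.
- by case: (tr_additive tT).
- exact: tr_susp_additive.
- exact: equivalence_faithful (tr_susp_equiv tT).
- exact: equivalence_full (tr_susp_equiv tT).
- exact: tr_iso.
- exact: tr_id.
- exact: tr_cone.
- by move=> X Y Z f g h /(tr_rot tT).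
- exact: tr_fill.
Qed.

Section Rotatable.
Variables (T : triData) (rT : rotatable T).

Section Triangle.
Variables (X Y Z : T) (f : hom X Y) (g : hom Y Z) (h : hom Z (susp X)).
Hypothesis fgh : dist f g h.

(** Filling in from the triangle [X = X -> 0] factors [g ∘ f] through a zero object. *)
Lemma dist_comp0 : g ∘ f = 0.
Proof.
have [Z0 Z00] := rt_zero rT.
have [|c [cg _]] := rt_fill rT (a := idm X) (b := f) (rt_id rT X Z00) fgh.
  by [].
by rewrite -cg compf0.
Qed.

(** The rotated triangle [W -> 0 -> susp W] maps to the rotation of the given one by [x] and 0. The
    fill-in goes from [susp W] to [susp X], and fullness of the suspension turns it into [y]. *)
Lemma dist_exact_mid W (x : hom W Y) : g ∘ x = 0 -> exists y, x = f ∘ y.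
Proof.
move=> gx; have [Z0 Z00] := rt_zero rT.
have [|c [_]] := rt_fill rT (a := x) (b := 0 : hom Z0 Z)
  (rt_rot rT (rt_id rT W Z00)) (rt_rot rT fgh).
  by rewrite compf0 gx.
have [y <-] := rt_susp_full rT c.
rewrite compfN compNf -!fmapM => /oppr_inj/(rt_suspI rT) xE.
by exists y; rewrite -xE compf1.
Qed.
End Triangle.

Section Triangle2.
Variables (X Y Z : T) (f : hom X Y) (g : hom Y Z) (h : hom Z (susp X)).
Hypothesis fgh : dist f g h.

Lemma dist_comp0s : fmap susp f ∘ h = 0.
Proof.
by apply: oppr_inj; rewrite -compNf oppr0; apply: dist_comp0 (rt_rot rT (rt_rot rT fgh)).
Qed.

Lemma dist_exact_right W (x : hom W Z) : h ∘ x = 0 -> exists y, x = g ∘ y.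
Proof. exact: dist_exact_mid (rt_rot rT fgh) _ _. Qed.

Lemma dist_exact_susp W (x : hom W (susp X)) :
  fmap susp f ∘ x = 0 -> exists y, x = h ∘ y.
Proof.
move=> fx; apply: (dist_exact_mid (rt_rot rT (rt_rot rT fgh))).
by rewrite compNf fx oppr0.
Qed.
End Triangle2.

(** * Five lemma, uniqueness of cones and converse rotation *)

Section FiveLemma.
Variables (X Y Z : T) (f : hom X Y) (g : hom Y Z) (h : hom Z (susp X)).
Variables (X' Y' Z' : T) (f' : hom X' Y') (g' : hom Y' Z') (h' : hom Z' (susp X')).
Variables (a : hom X X') (b : hom Y Y') (c : hom Z Z').
Hypotheses (fgh : dist f g h) (fgh' : dist f' g' h').
Hypotheses (bf : b ∘ f = f' ∘ a) (cg : c ∘ g = g' ∘ b) (ah : fmap susp a ∘ h = h' ∘ c).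

(** A chase in the exact sequences of maps from [W], one half for each hypothesis of
    [bijective_comp_iso]. *)
Lemma dist_five : is_iso a -> is_iso b -> is_iso c.
Proof.
move=> [a' [a'a aa']] [b' [b'b bb']].
have b'f : b' ∘ f' = f ∘ a'.
  by rewrite -[f']compf1 -aa' (compA f') -bf !compA b'b comp1f.
have Sa'a : fmap susp a' ∘ fmap susp a = idm _ by rewrite -fmapM a'a fmap1.
have Saa' : fmap susp a ∘ fmap susp a' = idm _ by rewrite -fmapM aa' fmap1.
have h'c : fmap susp a' ∘ h' ∘ c = h by rewrite -compA -ah compA Sa'a comp1f.
apply: bijective_comp_iso => W x.
  move=> cx; have hx : h ∘ x = 0 by rewrite -h'c -compA cx compf0.
  have [y xE] := dist_exact_right fgh hx; rewrite xE in cx *.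
  have [] := @dist_exact_mid _ _ _ _ _ _ fgh' _ (b ∘ y).
    by rewrite compA -cg -compA.
  move=> z byE; have -> : y = f ∘ (a' ∘ z).
    by rewrite compA -b'f -compA -byE compA b'b comp1f.
  by rewrite compA (dist_comp0 fgh) comp0f.
have [] := @dist_exact_susp _ _ _ _ _ _ fgh _ (fmap susp a' ∘ (h' ∘ x)).
  by rewrite compA -fmapM -b'f fmapM -!compA [_ ∘ (h' ∘ x)]compA
     (dist_comp0s fgh') comp0f compf0.
move=> z hz; have [] := @dist_exact_right _ _ _ _ _ _ fgh' _ (x - c ∘ z).
  by rewrite compBr compA -ah -compA -hz compA Saa' comp1f subrr.
move=> y xE; exists (z + g ∘ (b' ∘ y)).
by rewrite compDr !compA cg -(compA g') bb' compf1 -xE addrC subrK.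
Qed.
End FiveLemma.

Lemma dist_cone_iso (X Y Z Z' : T) (f : hom X Y) (g : hom Y Z) (h : hom Z (susp X))
    (g' : hom Y Z') (h' : hom Z' (susp X)) :
  dist f g h -> dist f g' h' ->
  exists c : hom Z Z', [/\ is_iso c, c ∘ g = g' & h = h' ∘ c].
Proof.
move=> fgh fgh'.
have [|c [cg hc]] := rt_fill rT (a := idm X) (b := idm Y) fgh fgh'.
  by rewrite comp1f compf1.
exists c; split.
- apply: (dist_five fgh fgh' _ cg hc (is_iso_id X) (is_iso_id Y)).
  by rewrite comp1f compf1.
- by rewrite cg compf1.
- by rewrite -hc fmap1 comp1f.
Qed.

Lemma dist_iso_cone (X Y Z Z' : T) (f : hom X Y) (g : hom Y Z) (h : hom Z (susp X))
    (c : hom Z Z') (g' : hom Y Z') (h' : hom Z' (susp X)) :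
  dist f g h -> is_iso c -> c ∘ g = g' -> h = h' ∘ c -> dist f g' h'.
Proof.
move=> fgh ic cg hc; apply: (rt_iso rT) fgh; exists (idm X), (idm Y), c.
split; first by split=> //; apply: is_iso_id.
by split; rewrite ?compf1 ?comp1f // fmap1 comp1f.
Qed.

(** A cone triangle of [f] rotated three times and the given triangle rotated twice both start with
    [- fmap susp f]. Their third objects are thus isomorphic, and this isomorphism desuspends to one
    from the cone of [f] to [Z]. *)
Lemma dist_rot_inv (X Y Z : T) (f : hom X Y) (g : hom Y Z) (h : hom Z (susp X)) :
  dist g h (- fmap susp f) -> dist f g h.
Proof.
move=> ghf; have [Z' [g' [h' fgh']]] := rt_cone rT f.
have := dist_cone_iso (rt_rot rT (rt_rot rT (rt_rot rT fgh')))
  (rt_rot rT (rt_rot rT ghf)).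
case=> c' []; have [c <-] := rt_susp_full rT c' => -[d' [d'c cd']].
rewrite compfN compNf -!fmapM.
move=> /oppr_inj/(rt_suspI rT) cg /oppr_inj/(rt_suspI rT) hc.
apply: (dist_iso_cone fgh' _ cg hc).
have [d dE] := rt_susp_full rT d'; exists d.
by split; apply: (rt_suspI rT); rewrite fmapM dE fmap1.
Qed.
End Rotatable.

(** * Right adjoints of exact functors and the n-order *)

Section Transpose.
Variables (A B : preaddCat) (F : functor A B) (G : functor B A) (a : adjunction F G).

Definition transpose X Y (x : hom X (G Y)) : hom (F X) Y := adj_counit a Y ∘ fmap F x.

Lemma transpose_inj X Y : injective (@transpose X Y).
Proof.
move=> x y xy.
have xE (z : hom X (G Y)) : z = fmap G (transpose z) ∘ adj_unit a X.
  by rewrite fmapM -compA -(adj_unit_nat a) compA (adj_triangle_r a) comp1f.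
by rewrite (xE x) xy -xE.
Qed.

Lemma transpose_surj X Y (y : hom (F X) Y) : exists x, transpose x = y.
Proof.
exists (fmap G y ∘ adj_unit a X).
by rewrite /transpose fmapM compA (adj_counit_nat a) -compA (adj_triangle_l a) compf1.
Qed.

Lemma transpose_comp X X' Y (x : hom X (G Y)) (w : hom X' X) :
  transpose (x ∘ w) = transpose x ∘ fmap F w.
Proof. by rewrite /transpose fmapM compA. Qed.

Lemma transpose_compG X Y Y' (g : hom Y Y') (x : hom X (G Y)) :
  transpose (fmap G g ∘ x) = g ∘ transpose x.
Proof. by rewrite /transpose fmapM !compA (adj_counit_nat a). Qed.

Hypothesis FD : additive_functor F.

Lemma transposeD X Y (x y : hom X (G Y)) :
  transpose (x + y) = transpose x + transpose y.
Proof. by rewrite /transpose FD compDr. Qed.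

Lemma transpose_eq0 X Y (x : hom X (G Y)) : transpose x = 0 -> x = 0.
Proof.
by move=> x0; apply: transpose_inj; rewrite x0 /transpose (fmap0 FD) compf0.
Qed.

Lemma right_adjoint_zero_ob Y : is_zero_ob Y -> is_zero_ob (G Y).
Proof.
by move=> Y0; apply/zero_ob_id/transpose_eq0/(zero_hom_to _ _ Y0).
Qed.
End Transpose.

Section RightAdjointExact.
Variables (T T' : triCat) (F : exact_functor T T') (G : functor T' T).
Variable a : adjunction F G.
Let rT := triangulated_rotatable (tri_axioms T).
Let rT' := triangulated_rotatable (tri_axioms T').
Let FD := exact_add F.

(** Transposition for maps into [susp (G X)]. It replaces a comparison of [susp (G X)] with
    [G (susp X)], and is bijective because every [W] is a suspension up to isomorphism. *)
Definition susp_transpose W X (u : hom W (susp (G X))) : hom (F W) (susp X) :=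
  fmap susp (adj_counit a X) ∘ (exact_susp F (G X) ∘ fmap F u).

Lemma susp_transposeE W X (x : hom W (G X)) :
  susp_transpose (fmap susp x) = fmap susp (transpose a x) ∘ exact_susp F W.
Proof.
rewrite /susp_transpose (nat_iso_nat (exact_susp F)) compA.
by rewrite -(fmapM (@susp T')).
Qed.

Lemma susp_transpose_comp W W' X (u : hom W (susp (G X))) (w : hom W' W) :
  susp_transpose (u ∘ w) = susp_transpose u ∘ fmap F w.
Proof. by rewrite /susp_transpose fmapM !compA. Qed.

Lemma susp_transposeG W X Y (f : hom X Y) (u : hom W (susp (G X))) :
  susp_transpose (fmap susp (fmap G f) ∘ u) = fmap susp f ∘ susp_transpose u.
Proof.
rewrite /susp_transpose fmapM !compA; congr (_ ∘ _).
rewrite -[_ ∘ fmap F _]compA (nat_iso_nat (exact_susp F)) compA -(fmapM (@susp T')).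
by rewrite -(fmapM (@susp T')) (adj_counit_nat a).
Qed.

Lemma desuspend (W : T) : exists (W' : T) (w : hom (susp W') W), is_iso w.
Proof. exact: equivalence_ess_surj (tr_susp_equiv (tri_axioms T)) W. Qed.

Lemma susp_transpose_eq0 W X (u : hom W (susp (G X))) : susp_transpose u = 0 -> u = 0.
Proof.
move=> u0; have [W' [w [w' [w'w ww']]]] := desuspend W.
have [x xE] := rt_susp_full rT (u ∘ w).
have : susp_transpose (fmap susp x) = 0 by rewrite xE susp_transpose_comp u0 comp0f.
rewrite susp_transposeE => /(congr1 (fun z => z ∘ nat_iso_inv (exact_susp F) W')).
rewrite comp0f -compA (nat_iso_funK (exact_susp F)) compf1 -(fmap0 (rt_suspD rT')).
move=> /(rt_suspI rT')/(transpose_eq0 FD) x0.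
by rewrite -[u]compf1 -ww' compA -xE x0 (fmap0 (rt_suspD rT)) comp0f.
Qed.

Lemma susp_transpose_surj W X (v : hom (F W) (susp X)) :
  exists u, susp_transpose u = v.
Proof.
have [W' [w [w' [w'w ww']]]] := desuspend W.
have [y yE] := rt_susp_full rT' (v ∘ fmap F w ∘ nat_iso_inv (exact_susp F) W').
have [x xE] := transpose_surj a y; exists (fmap susp x ∘ w').
rewrite susp_transpose_comp susp_transposeE xE yE.
rewrite -[_ ∘ exact_susp F W']compA (nat_iso_invK (exact_susp F)).
by rewrite compf1 -compA -fmapM ww' fmap1 compf1.
Qed.

(** For a cone [C] of [G f], the counits at [X] and [Y] extend to a map [F C -> Z], whose transpose
    [C -> G Z] is shown invertible. After transposition, the maps from [W] into the two objects lie
    in exact sequences with the same outer terms, so a five-lemma chase applies. The third map is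
    carried over from the cone. *)
Lemma right_adjoint_exact (X Y Z : T') (f : hom X Y) (g : hom Y Z) (h : hom Z (susp X)) :
  dist f g h -> exists h' : hom (G Z) (susp (G X)), dist (fmap G f) (fmap G g) h'.
Proof.
move=> fgh; have [C [i [p fip]]] := rt_cone rT (fmap G f).
have [|c [ci cp]] := rt_fill rT' (a := adj_counit a X) (b := adj_counit a Y)
   (exact_dist F fip) fgh.
  exact: (adj_counit_nat a).
have [c1 c1E] := transpose_surj a c.
have tc W (w : hom W C) : transpose a (c1 ∘ w) = c ∘ fmap F w.
  by rewrite transpose_comp c1E.
have sp W (w : hom W C) : susp_transpose (p ∘ w) = h ∘ (c ∘ fmap F w).
  by rewrite /susp_transpose fmapM !compA -[X in X ∘ _]compA cp.
have c1i : c1 ∘ i = fmap G g.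
  apply: (transpose_inj (a := a)); rewrite tc ci -[fmap G g]compf1.
  by rewrite transpose_compG /transpose fmap1 compf1.
have ic1 : is_iso c1.
  apply: bijective_comp_iso => W.
    move=> w c1w; have cw : c ∘ fmap F w = 0.
      by rewrite -tc c1w /transpose (fmap0 FD) compf0.
    have pw : p ∘ w = 0 by apply: susp_transpose_eq0; rewrite sp cw compf0.
    have [y wE] := dist_exact_right rT fip pw; rewrite wE in c1w *.
    have gy : g ∘ transpose a y = 0.
      by rewrite -transpose_compG -c1i -compA c1w /transpose (fmap0 FD) compf0.
    have [x xE] := dist_exact_mid rT' fgh gy; have [x1 x1E] := transpose_surj a x.
    have -> : y = fmap G f ∘ x1.
      by apply: (transpose_inj (a := a)); rewrite transpose_compG x1E.
    by rewrite compA (dist_comp0 rT fip) comp0f.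
  (* Surjectivity: the image of [z] under [h] lifts along [p] to [w]; the remaining difference dies
     under [h], so it comes from [Y]. *)
  move=> z; have [u uE] := susp_transpose_surj (h ∘ transpose a z).
  have fu : fmap susp (fmap G f) ∘ u = 0.
    apply: susp_transpose_eq0; rewrite susp_transposeG uE compA.
    by rewrite (dist_comp0s rT' fgh) comp0f.
  have [w wE] := dist_exact_susp rT fip fu.
  have [|y yE] := dist_exact_right rT' fgh (x := transpose a z - c ∘ fmap F w).
    by rewrite compBr -uE wE sp subrr.
  have [y1 y1E] := transpose_surj a y.
  exists (w + i ∘ y1); apply: (transpose_inj (a := a)).
  rewrite compDr (transposeD a FD) tc (compA c1) c1i transpose_compG y1E -yE.
  by rewrite addrC subrK.
have [c1' [c1'K c1K]] := ic1.
exists (p ∘ c1'); apply: (dist_iso_cone rT fip ic1 c1i).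
by rewrite -compA c1'K compf1.
Qed.
End RightAdjointExact.

Section InfiniteOrder.
Variables (T : triCat) (n : nat) (M : mod_reduction T n).
Let rT := triangulated_rotatable (tri_axioms T).
Let G := red_adj M.
Let a := red_adjunction M.

(** The induction runs over objects merely isomorphic to some [G Y], because a given zero object of
    [T] need not be a value of [G]. *)
Lemma red_adj_n_order k (X : T) (Y : red_cat M) (x : hom X (G Y)) :
  is_iso x -> n_order_ge n k X.
Proof.
elim: k X Y x => // k IHk X Y x [x' [x'x xx']] K f Kn pi d npd.
have [h nh] := red_triangle M K.
(* The arbitrary cone [Kn] is identified with the one given by the unit of the adjunction. *)
have [c [[c' [c'c cc']] cpi dE]] := dist_cone_iso rT npd nh.
pose f1 := transpose a (x ∘ f).
have [Z [g [e f1ge]]] := tr_cone (tri_axioms (red_cat M)) f1.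
have Gf1 : fmap G f1 ∘ adj_unit a K = x ∘ f.
  apply: (transpose_inj (a := a)).
  by rewrite transpose_compG /transpose (adj_triangle_l a) compf1.
have [e1 Gf1ge] := right_adjoint_exact a f1ge.
exists (x' ∘ fmap G f1 ∘ c); split.
  by rewrite -compA cpi -compA Gf1 compA x'x comp1f.
exists (G Z); split; last exact: (IHk _ Z (idm _) (is_iso_id _)).
exists (fmap G g ∘ x), (fmap susp c' ∘ e1); apply: (rt_iso rT) Gf1ge.
exists c', x', (idm _); split.
  split; [by exists c | by exists x | exact: is_iso_id].
split.
- by rewrite -[RHS]compA cc' compf1.
- by rewrite comp1f -compA xx' compf1.
- by rewrite compf1.
Qed.

Lemma mod_reduction_infinite_n_order : infinite_n_order T n.
Proof.
move=> Z Z0 k; have [Z' Z'0] := rt_zero (triangulated_rotatable (tri_axioms (red_cat M))).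
have GZ'0 := right_adjoint_zero_ob a (exact_add (red_fun M)) Z'0.
exact: (red_adj_n_order k (zero_ob_iso (0 : hom Z (G Z')) Z0 GZ'0)).
Qed.
End InfiniteOrder.

(** * Degree-free calculus in a dg category *)

(** Reflection for linear identities in an abelian group: both sides are reified over a common list
    of atoms, and their integer coefficients are compared by evaluation. *)
Inductive zexp := Zvar of nat | Zzero | Zadd of zexp & zexp | Zopp of zexp.

Fixpoint zeval (V : zmodType) (env : seq V) e : V :=
  match e with
  | Zvar i => nth 0 env i
  | Zzero => 0
  | Zadd e1 e2 => zeval env e1 + zeval env e2
  | Zopp e1 => - zeval env e1
  end.

Fixpoint zcoef e (i : nat) : int :=
  match e with
  | Zvar j => (i == j)%:Z
  | Zzero => 0
  | Zadd e1 e2 => zcoef e1 i + zcoef e2 i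
  | Zopp e1 => - zcoef e1 i
  end.

Lemma zevalE (V : zmodType) (env : seq V) e :
  zeval env e = \sum_(i < size env) env`_i *~ zcoef e i.
Proof.
elim: e => [j||e1 IH1 e2 IH2|e IH] /=.
- have [jlt|jge] := ltnP j (size env).
    rewrite (bigD1 (Ordinal jlt)) //= eqxx mulr1z big1 ?addr0 // => i.
    by rewrite -val_eqE /= => /negPf->; rewrite mulr0z.
  rewrite nth_default // big1 // => i _.
  by rewrite ltn_eqF ?mulr0z // (leq_trans (ltn_ord i)).
- by rewrite big1 // => i _; rewrite mulr0z.
- by rewrite IH1 IH2 -big_split; apply: eq_bigr => i _; rewrite mulrzDr.
- by rewrite IH -sumrN; apply: eq_bigr => i _; rewrite mulrNz.
Qed.

Lemma zeval_eq (V : zmodType) (env : seq V) e1 e2 :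
  all (fun i => zcoef e1 i == zcoef e2 i) (iota 0 (size env)) ->
  zeval env e1 = zeval env e2.
Proof.
move=> /allP e12; rewrite !zevalE; apply: eq_bigr => i _.
by rewrite (eqP (e12 i _)) // mem_iota ltn_ord.
Qed.

(* Atoms are compared up to conversion, because convertible degrees are not
   always syntactically equal. *)
Ltac zmem x env :=
  match env with
  | ?y :: _ => let _ := match constr:(tt) with _ => unify x y end in constr:(true)
  | _ :: ?env' => zmem x env'
  | _ => constr:(false)
  end.

Ltac zindex x env :=
  match env with
  | ?y :: _ => let _ := match constr:(tt) with _ => unify x y end in constr:(0%N)
  | _ :: ?env' => let i := zindex x env' in constr:(S i)
  end.

Ltac zenv env t :=
  match t with
  | GRing.add ?a ?b => let env1 := zenv env a in zenv env1 b
  | GRing.opp ?a => zenv env a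
  | GRing.zero => env
  | _ => match zmem t env with
         | true => env
         | false => constr:(t :: env)
         end
  end.

Ltac zreify env t :=
  match t with
  | GRing.add ?a ?b =>
      let e1 := zreify env a in let e2 := zreify env b in constr:(Zadd e1 e2)
  | GRing.opp ?a => let e := zreify env a in constr:(Zopp e)
  | GRing.zero => constr:(Zzero)
  | _ => let i := zindex t env in constr:(Zvar i)
  end.

Ltac zmod_eq :=
  match goal with
  | |- @eq ?T ?a ?b =>
      let env0 := zenv (@nil T) a in let env := zenv env0 b in
      let e1 := zreify env a in let e2 := zreify env b in
      exact (@zeval_eq _ env e1 e2 erefl)
  end.

(* For every object [W], an element [f] of [dghom X Y i] acts by composition
   on the families of elements of the groups [dghom W X k]; the operators on
   these families form a preadditive category, in which the differential becomes
   a (graded) commutator and the degrees disappear from the equations. *)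
Section Operators.
Variables (B : dgCat) (W : B).

Definition family (X : B) := forall k, dghom W X k.

(** Additivity is what makes composition distribute over a sum in its right argument. *)
Record operator (X Y : B) := Operator {
  opfun :> family X -> family Y;
  opfunD : forall x y k, opfun (fun k => x k + y k) k = opfun x k + opfun y k }.

Lemma operatorP X Y (f g : operator X Y) : (forall x k, f x k = g x k) -> f = g.
Proof.
case: f g => [f fD] [g gD] /= fg.
have E : f = g by apply: funext => x; apply: functional_extensionality_dep => k.
by rewrite {}E in fD *; congr Operator; apply: Prop_irrelevance.
Qed.

Program Definition operator_zero X Y := @Operator X Y (fun _ _ => 0) _.
Next Obligation. by rewrite addr0. Qed.
Program Definition operator_opp X Y (f : operator X Y) :=
  @Operator X Y (fun x k => - f x k) _.
Next Obligation. by rewrite opfunD opprD. Qed.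
Program Definition operator_add X Y (f g : operator X Y) :=
  @Operator X Y (fun x k => f x k + g x k) _.
Next Obligation. by rewrite !opfunD addrACA. Qed.

HB.instance Definition _ X Y := gen_eqMixin (operator X Y).
HB.instance Definition _ X Y := gen_choiceMixin (operator X Y).

Lemma operator_addA X Y : associative (@operator_add X Y).
Proof. by move=> f g h; apply: operatorP => x k; apply: addrA. Qed.
Lemma operator_addC X Y : commutative (@operator_add X Y).
Proof. by move=> f g; apply: operatorP => x k; apply: addrC. Qed.
Lemma operator_add0 X Y : left_id (@operator_zero X Y) (@operator_add X Y).
Proof. by move=> f; apply: operatorP => x k; apply: add0r. Qed.
Lemma operator_addN X Y :
  left_inverse (@operator_zero X Y) (@operator_opp X Y) (@operator_add X Y).
Proof. by move=> f; apply: operatorP => x k; apply: addNr. Qed.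

HB.instance Definition _ X Y := GRing.isZmodule.Build (operator X Y)
  (@operator_addA X Y) (@operator_addC X Y) (@operator_add0 X Y) (@operator_addN X Y).

Definition operator_id X := @Operator X X id (fun x y k => erefl).

Program Definition operator_comp X Y Z (g : operator Y Z) (f : operator X Y) :=
  @Operator X Z (fun x => g (f x)) _.
Next Obligation.
rewrite -opfunD; congr (opfun g (_ : family Y) k).
by apply: functional_extensionality_dep => j; apply: opfunD.
Qed.

Program Definition operators : preaddCat :=
  @PreaddCat B operator operator_id operator_comp _ _ _ _ _.
Next Obligation. by apply: operatorP. Qed.
Next Obligation. by apply: operatorP. Qed.
Next Obligation. by apply: operatorP. Qed.
Next Obligation. by apply: operatorP. Qed.
Next Obligation. by apply: operatorP => x k; apply: (opfunD g). Qed.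

Lemma op_deg (i k : int) : i + (k - i) = k. Proof. lia. Qed.

(** The value in degree [k] uses the member of degree [k - i]; one operator covers all degrees, so
    [i] drops out of its type. *)
Program Definition op_of X Y i (f : dghom X Y i) : hom (X : operators) Y :=
  @Operator X Y (fun x k => dgcomp (op_deg i k) f (x (k - i))) _.
Next Obligation. exact: dgcompDr. Qed.

Program Definition opd (X : B) : @hom operators X X :=
  @Operator X X (fun x k => dgd (erefl (k + 1)) (x (k + 1))) _.
Next Obligation. exact: dgdD. Qed.

Lemma family_comp X Y i a b k (f : dghom X Y i) (x : family X) (e : i + a = k)
    (e' : i + b = k) : dgcomp e f (x a) = dgcomp e' f (x b).
Proof.
have ab : a = b by lia.
by rewrite {a}ab in e *; congr dgcomp; apply: Prop_irrelevance.
Qed.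

Lemma family_d X (x : family X) i i' j (e : j + 1 = i) (e' : j + 1 = i') :
  dgd e (x i) = dgd e' (x i').
Proof.
have ii' : i = i' by lia.
by rewrite {i}ii' in e *; congr dgd; apply: Prop_irrelevance.
Qed.

Lemma op_ofD X Y i (f g : dghom X Y i) : op_of (f + g) = op_of f + op_of g.
Proof. by apply: operatorP => x k; apply: dgcompDl. Qed.

HB.instance Definition _ X Y i := GRing.isZmodMorphism.Build (dghom X Y i)
  (hom (X : operators) Y) (@op_of X Y i) (morphD_zmod (@op_ofD X Y i)).

Lemma op_ofMz X Y i (f : dghom X Y i) m : op_of (f *~ m) = op_of f *~ m.
Proof. exact: (raddfMz (@op_of X Y i)). Qed.

Lemma op_ofB X Y i (f g : dghom X Y i) : op_of (f - g) = op_of f - op_of g.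
Proof. exact: (raddfB (@op_of X Y i)). Qed.

Lemma op_ofN X Y i (f : dghom X Y i) : op_of (- f) = - op_of f.
Proof. exact: (raddfN (@op_of X Y i)). Qed.

Lemma op_of0 X Y i : op_of (0 : dghom X Y i) = 0.
Proof. exact: (raddf0 (@op_of X Y i)). Qed.

Lemma op_of_comp X Y Z i j k (e : i + j = k) (g : dghom Y Z i) (f : dghom X Y j) :
  op_of (dgcomp e g f) = op_of g ∘ op_of f.
Proof.
apply: operatorP => x l /=.
have e1 : j + (l - k) = l - i by lia.
rewrite -(dgcompA _ e1 (op_deg i l)); congr dgcomp; exact: family_comp.
Qed.

Lemma op_of_id X : op_of (dgid X) = idm (X : operators).
Proof.
apply: operatorP => x k /=; move: (op_deg 0 k); rewrite subr0 => e.
exact: dgcomp1f.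
Qed.

(** This is the Leibniz rule for [f ∘ x], solved for the term that contains the differential of
    [f]. *)
Lemma op_of_d X Y i j (e : j + 1 = i) (f : dghom X Y i) :
  op_of (dgd e f) = opd Y ∘ op_of f - (op_of f ∘ opd X) *~ ksign i.
Proof.
apply: (addIr ((op_of f ∘ opd X) *~ ksign i)); rewrite subrK.
have opMz (h : hom (X : operators) Y) (m : int) x k : (h *~ m : operator X Y) x k = h x k *~ m.
  have opMn n : (h *+ n : operator X Y) x k = h x k *+ n.
    by elim: n => // n IHn; rewrite !mulrS -IHn.
  by case: m => n; rewrite ?NegzE ?mulrNz -!pmulrn -opMn.
apply: operatorP => x k /=; rewrite -[LHS]/(_ + _) opMz /=.
have e1 : j + (k + 1 - i) = k by lia.
have e2 : i + (k - i) = k by lia.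
have e3 : k - i + 1 = k + 1 - i by lia.
rewrite (dgd_comp _ e e3 _ e1 e2); congr (_ + _ *~ _).
  exact: family_comp.
by congr dgcomp; [apply: Prop_irrelevance | apply: family_d].
Qed.

End Operators.

Definition unit_family (B : dgCat) (X : B) : family X X :=
  fun k => match k return dghom X X k with Posz 0 => dgid X | _ => 0 end.

(** The operator of [f], applied to the family that is the identity in degree 0 and zero elsewhere,
    returns [f] in degree [i]. *)
Lemma op_of_inj (B : dgCat) (X Y : B) i (f g : dghom X Y i) :
  (forall W, op_of W f = op_of W g) -> f = g.
Proof.
move=> /(_ X) fg.
have fE (h : dghom X Y i) : h = op_of X h (@unit_family B X) i.
  rewrite /=; move: (op_deg i i); rewrite subrr => e.
  by rewrite [RHS]dgcompf1.
by rewrite (fE f) fg -fE.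
Qed.

Arguments opd [B] W X.

(* Keeps the conversion tests of [zmod_eq] from unfolding the atoms. *)
#[global] Opaque op_of opd operator_comp operator_id.
#[global] Arguments operators : simpl never.
#[global] Arguments comp : simpl never.
#[global] Arguments idm : simpl never.

Notation "⟦ f ⟧" := (op_of _ f) (at level 0, format "⟦ f ⟧") : cat_scope.
Notation "∂" := (opd _ _) (at level 0) : cat_scope.

(** Words are kept associated to the right, so a rule for [h ∘ g] also needs a version that fires
    when another factor follows. *)
Lemma compAr (A : preaddCat) (X Y Z : A) (h : hom Y Z) (g : hom X Y) (k : hom X Z) :
  h ∘ g = k -> forall V (f : hom V X), h ∘ (g ∘ f) = k ∘ f.
Proof. by move=> <- V f; rewrite compA. Qed.

Lemma compAl (A : preaddCat) (X Y Z V : A) (h : hom Y Z) (g : hom X Y)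
    (f : hom V X) : h ∘ g ∘ f = h ∘ (g ∘ f).
Proof. by rewrite compA. Qed.

Definition compE := (compDl, compDr, compNf, compfN, compAl, comp0f, compf0, comp1f, compf1).

Section Differential.
Variables (B : dgCat) (W : B).
Implicit Types X Y : B.

Lemma op_of_d0 X Y j (e : j + 1 = 0) (f : dghom X Y 0) :
  op_of W (dgd e f) = ∂ ∘ ⟦f⟧ - ⟦f⟧ ∘ ∂.
Proof. by rewrite op_of_d mulr1z. Qed.

Lemma op_of_d1 X Y j (e : j + 1 = 1) (f : dghom X Y 1) :
  op_of W (dgd e f) = ∂ ∘ ⟦f⟧ + ⟦f⟧ ∘ ∂.
Proof. by rewrite op_of_d mulrN1z opprK. Qed.

Lemma op_of_dN1 X Y j (e : j + 1 = -1) (f : dghom X Y (-1)) :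
  op_of W (dgd e f) = ∂ ∘ ⟦f⟧ + ⟦f⟧ ∘ ∂.
Proof. by rewrite op_of_d mulrN1z opprK. Qed.

Lemma op_of_cycle X Y (f : cycles X Y) : opd W Y ∘ ⟦cval f⟧ = ⟦cval f⟧ ∘ ∂.
Proof.
by apply/eqP; rewrite -subr_eq0 -(op_of_d0 degd0) cycle_d raddf0.
Qed.

Lemma op_of_closed0 X Y j (e : j + 1 = 0) (f : dghom X Y 0) : dgd e f = 0 ->
  opd W Y ∘ ⟦f⟧ = ⟦f⟧ ∘ ∂.
Proof.
by move=> f0; apply/eqP; rewrite -subr_eq0 -(op_of_d0 e) f0 raddf0.
Qed.

Lemma op_of_closedN1 X Y j (e : j + 1 = -1) (f : dghom X Y (-1)) : dgd e f = 0 ->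
  opd W Y ∘ ⟦f⟧ = - (⟦f⟧ ∘ ∂).
Proof.
by move=> f0; apply/eqP; rewrite -addr_eq0 -(op_of_dN1 e) f0 raddf0.
Qed.
End Differential.

Lemma is_cycle_op (B : dgCat) (X Y : B) (f : dghom X Y 0) :
  (forall W, opd W Y ∘ ⟦f⟧ = ⟦f⟧ ∘ ∂) -> f \in @is_cycle B X Y.
Proof.
by move=> fD; rewrite inE; apply/eqP/op_of_inj => W; rewrite op_of_d0 fD subrr raddf0.
Qed.

Lemma hclass_eq (B : dgCat) (X Y : B) (f g : cycles X Y) (h : dghom X Y 1) :
  (forall W, opd W Y ∘ ⟦h⟧ + ⟦h⟧ ∘ ∂ = ⟦cval f⟧ - ⟦cval g⟧) -> hclass f = hclass g.
Proof.
move=> hD; apply/hclassP; exists h; apply: op_of_inj => W.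
by rewrite op_of_d1 hD raddfB.
Qed.

Lemma hclass_eq_op (B : dgCat) (X Y : B) (f g : cycles X Y) :
  hclass f = hclass g ->
  exists h : dghom X Y 1, forall W, opd W Y ∘ ⟦h⟧ = ⟦cval f⟧ - ⟦cval g⟧ - ⟦h⟧ ∘ ∂.
Proof.
move=> /hclassP[h hD]; exists h => W.
by rewrite -raddfB /= -hD op_of_d1 addrK.
Qed.

(** * Mapping cones and shifts *)

(* A mapping cone [C] of [f], split as a graded object.  The signs in [cd_pu] and
   [cd_id] come from the action [phi . (a, b) = (phi a, (-1)^|phi| phi b)]. *)
Record cone_data (B : dgCat) (X Y : B) (f : cycles X Y) (C : B) := ConeData {
  cd_i : dghom Y C 0;
  cd_u : dghom X C 1;
  cd_p : dghom C X (-1);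
  cd_s : dghom C Y 0;
  cd_di : dgd degd0 cd_i = 0;
  cd_du : dgd degd1 cd_u = dgcomp deg00 cd_i (cval f);
  cd_dp : dgd (erefl : -2 + 1 = -1 :> int) cd_p = 0;
  cd_ds : dgd degd0 cd_s = dgcomp (erefl : 0 + -1 = -1 :> int) (cval f) cd_p;
  cd_pi : dgcomp (erefl : -1 + 0 = -1 :> int) cd_p cd_i = 0;
  cd_pu : dgcomp (erefl : -1 + 1 = 0 :> int) cd_p cd_u = - dgid X;
  cd_si : dgcomp deg00 cd_s cd_i = dgid Y;
  cd_su : dgcomp (erefl : 0 + 1 = 1 :> int) cd_s cd_u = 0;
  cd_id : dgcomp deg00 cd_i cd_s - dgcomp (erefl : 1 + -1 = 0 :> int) cd_u cd_p = dgid C }.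

Section ConeRules.
Variables (B : dgCat) (X Y : B) (f : cycles X Y) (C : B) (c : cone_data f C) (W : B).

Lemma op_cd_di : opd W C ∘ ⟦cd_i c⟧ = ⟦cd_i c⟧ ∘ ∂.
Proof. exact: op_of_closed0 (cd_di c). Qed.

Lemma op_cd_du : opd W C ∘ ⟦cd_u c⟧ = ⟦cd_i c⟧ ∘ ⟦cval f⟧ - ⟦cd_u c⟧ ∘ ∂.
Proof. by rewrite -(op_of_comp W deg00) -(cd_du c) op_of_d1 addrK. Qed.

Lemma op_cd_dp : opd W X ∘ ⟦cd_p c⟧ = - (⟦cd_p c⟧ ∘ ∂).
Proof. exact: op_of_closedN1 (cd_dp c). Qed.

Lemma op_cd_ds : opd W Y ∘ ⟦cd_s c⟧ = ⟦cval f⟧ ∘ ⟦cd_p c⟧ + ⟦cd_s c⟧ ∘ ∂.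
Proof. by rewrite -(op_of_comp W (erefl : 0 + -1 = -1 :> int)) -(cd_ds c) op_of_d0 subrK. Qed.

Lemma op_cd_pi : op_of W (cd_p c) ∘ ⟦cd_i c⟧ = 0.
Proof. by rewrite -(op_of_comp W (erefl : -1 + 0 = -1 :> int)) (cd_pi c) raddf0. Qed.

Lemma op_cd_pu : op_of W (cd_p c) ∘ ⟦cd_u c⟧ = - idm _.
Proof. by rewrite -(op_of_comp W (erefl : -1 + 1 = 0 :> int)) (cd_pu c) raddfN /= op_of_id. Qed.

Lemma op_cd_si : op_of W (cd_s c) ∘ ⟦cd_i c⟧ = idm _.
Proof. by rewrite -(op_of_comp W deg00) (cd_si c) op_of_id. Qed.

Lemma op_cd_su : op_of W (cd_s c) ∘ ⟦cd_u c⟧ = 0.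
Proof. by rewrite -(op_of_comp W (erefl : 0 + 1 = 1 :> int)) (cd_su c) raddf0. Qed.

Lemma op_cd_id : op_of W (cd_i c) ∘ ⟦cd_s c⟧ = idm _ + ⟦cd_u c⟧ ∘ ⟦cd_p c⟧.
Proof.
by rewrite -op_of_id -(cd_id c) raddfB /= !op_of_comp subrK.
Qed.

Definition cone_rules :=
  (op_cd_di, op_cd_du, op_cd_dp, op_cd_ds, op_cd_pi, op_cd_pu, op_cd_si, op_cd_su,
   op_cd_id, (compAr op_cd_di, compAr op_cd_du, compAr op_cd_dp, compAr op_cd_ds),
   (compAr op_cd_pi, compAr op_cd_pu, compAr op_cd_si, compAr op_cd_su, compAr op_cd_id)).
End ConeRules.

Section ConeOfRepresentation.
Variables (B : dgCat) (X Y : B) (f : cycles X Y) (R : representation (cone_mod f)).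

Let i : dghom Y R 0 := (rep_elt R).1.
Let u : dghom X R 1 := (rep_elt R).2.
Let p : dghom R X (-1) :=
  rep_fact R ((0, dgid X) : dghom Y X (-1) * dghom X X (-1 + 1)).
Let s : dghom R Y 0 :=
  rep_fact R ((dgid Y, 0) : dghom Y Y 0 * dghom X Y (0 + 1)).

Lemma rep_cone_act Z k (e : k + 0 = k) (e' : k + 1 = k + 1) (g : dghom R Z k) :
  mact e g (rep_elt R) = (dgcomp e g i, dgcomp e' g u *~ ksign k).
Proof. by congr pair; congr (_ *~ _); congr dgcomp; apply: Prop_irrelevance. Qed.

(** Universality as a test: maps out of the cone are compared on [i] and [u]. This gives both the
    differential of [s] and the splitting of the identity. *)
Lemma rep_cone_inj Z k (g h : dghom R Z k) :
  (forall W, op_of W g ∘ ⟦i⟧ = ⟦h⟧ ∘ ⟦i⟧) ->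
  (forall W, op_of W g ∘ ⟦u⟧ = ⟦h⟧ ∘ ⟦u⟧) -> g = h.
Proof.
move=> gi gu; apply: (rep_inj (e := addr0 k)); rewrite !(rep_cone_act _ (erefl _)).
congr pair; last congr (_ *~ _).
  by apply: op_of_inj => W; rewrite !op_of_comp.
by apply: op_of_inj => W; rewrite !op_of_comp.
Qed.

Lemma rep_cone_d : dgd degd0 i = 0 /\ dgd degd1 u = dgcomp deg00 i (cval f).
Proof.
case: (pair_equal_spec (dgd degd0 i) 0
  (dgcomp (cone_degf degd0) i (cval f) - dgd (cone_degd degd0) u) 0) => + _.
case; first exact: (rep_cycle R degd0).
move=> -> /eqP; rewrite subr_eq0 => /eqP iu; split=> //.
transitivity (dgd (cone_degd degd0) u); first by congr dgd; apply: Prop_irrelevance.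
by rewrite -iu; congr dgcomp; apply: Prop_irrelevance.
Qed.

Lemma rep_cone_p : dgcomp (erefl : -1 + 0 = -1 :> int) p i = 0 /\
  dgcomp (erefl : -1 + 1 = 0 :> int) p u = - dgid X.
Proof.
have := rep_factK R (erefl : -1 + 0 = -1 :> int)
  ((0, dgid X) : dghom Y X (-1) * dghom X X (-1 + 1)).
rewrite (rep_cone_act _ (erefl _)) => /pair_equal_spec[-> pu]; split=> //.
by apply: oppr_inj; rewrite opprK -[RHS]pu mulrN1z.
Qed.

Lemma rep_cone_s : dgcomp deg00 s i = dgid Y /\
  dgcomp (erefl : 0 + 1 = 1 :> int) s u = 0.
Proof.
have := rep_factK R deg00 ((dgid Y, 0) : dghom Y Y 0 * dghom X Y (0 + 1)).
rewrite (rep_cone_act _ (erefl _)) => /pair_equal_spec[-> su].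
by split.
Qed.

Lemma rep_cone_dp : dgd (erefl : -2 + 1 = -1 :> int) p = 0.
Proof.
rewrite rep_fact_d -[RHS](raddf0 (@rep_fact _ _ R X (-2))); congr rep_fact.
congr pair; first exact: raddf0.
by rewrite dgcomp0l dgd_id subr0.
Qed.

Let op_pi (W : B) : op_of W p ∘ ⟦i⟧ = 0.
Proof. by rewrite -(op_of_comp _ (erefl : -1 + 0 = -1 :> int)) rep_cone_p.1 raddf0. Qed.

Let op_pu (W : B) : op_of W p ∘ ⟦u⟧ = - idm _.
Proof.
by rewrite -(op_of_comp _ (erefl : -1 + 1 = 0 :> int)) rep_cone_p.2 raddfN /= op_of_id.
Qed.

Let op_si (W : B) : op_of W s ∘ ⟦i⟧ = idm _.
Proof. by rewrite -(op_of_comp _ deg00) rep_cone_s.1 op_of_id. Qed.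

Let op_su (W : B) : op_of W s ∘ ⟦u⟧ = 0.
Proof. by rewrite -(op_of_comp _ (erefl : 0 + 1 = 1 :> int)) rep_cone_s.2 raddf0. Qed.

Let op_di (W : B) : opd W R ∘ ⟦i⟧ = ⟦i⟧ ∘ ∂.
Proof. exact: op_of_closed0 rep_cone_d.1. Qed.

Let op_du (W : B) : opd W R ∘ ⟦u⟧ = ⟦i⟧ ∘ ⟦cval f⟧ - ⟦u⟧ ∘ ∂.
Proof. by rewrite -(op_of_comp W deg00) -rep_cone_d.2 op_of_d1 addrK. Qed.

Lemma rep_cone_ds : dgd degd0 s = dgcomp (erefl : 0 + -1 = -1 :> int) (cval f) p.
Proof.
apply: rep_cone_inj => W; rewrite op_of_d0 op_of_comp;
  rewrite !(op_pi, op_pu, op_si, op_su, op_di, op_du, compAr (op_si W),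
    compAr (op_su W), compE); zmod_eq.
Qed.

Lemma rep_cone_id :
  dgcomp deg00 i s - dgcomp (erefl : 1 + -1 = 0 :> int) u p = dgid R.
Proof.
apply: rep_cone_inj => W; rewrite raddfB /= !op_of_comp op_of_id;
  rewrite !(op_pi, op_pu, op_si, op_su, compE); zmod_eq.
Qed.

Definition rep_cone_data : cone_data f R :=
  ConeData rep_cone_d.1 rep_cone_d.2 rep_cone_dp rep_cone_ds rep_cone_p.1 rep_cone_p.2
    rep_cone_s.1 rep_cone_s.2 rep_cone_id.
End ConeOfRepresentation.

Section RepresentationOfCone.
Variables (B : dgCat) (X Y : B) (f : cycles X Y) (C : B) (c : cone_data f C).

Let elt : cone_mod f C 0 := (cd_i c, cd_u c : dghom X C (0 + 1)).

Let fact Z k (x : cone_mod f Z k) : dghom C Z k :=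
  dgcomp (addr0 k) x.1 (cd_s c) - dgcomp (addrK 1 k) x.2 (cd_p c) *~ ksign k.

Lemma cone_rep_cycle j (e : j + 1 = 0) : md e elt = 0.
Proof.
have ej : j = -1 by lia.
rewrite ej in e *; congr pair; apply: op_of_inj => W.
  by rewrite op_of_d0 op_cd_di subrr raddf0.
by rewrite raddfB /= op_of_comp op_of_d1 op_cd_du subrK subrr raddf0.
Qed.

Lemma cone_rep_factK Z k (e : k + 0 = k) (x : cone_mod f Z k) : mact e (fact x) elt = x.
Proof.
case: x => a b; congr pair; apply: op_of_inj => W.
  rewrite op_of_comp op_ofB op_ofMz !op_of_comp compBl compMzl !compAl.
  by rewrite op_cd_si op_cd_pi compf0 compf1 mul0rz subr0.
rewrite op_ofMz op_of_comp op_ofB op_ofMz !op_of_comp compBl compMzl !compAl.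
by rewrite op_cd_su op_cd_pu compf0 compfN compf1 sub0r !mulNrz opprK -mulrzA ksignK.
Qed.

Lemma cone_rep_actK Z k (e : k + 0 = k) (g : dghom C Z k) : fact (mact e g elt) = g.
Proof.
apply: op_of_inj => W; rewrite op_ofB op_ofMz !op_of_comp op_ofMz !op_of_comp.
rewrite compMzl -mulrzA ksignK mulr1z !compAl -compBr op_cd_id.
by rewrite addrK compf1.
Qed.

(** Conversely, a split cone represents the cone module: [(a, b)] factors as [a s] minus a signed
    [b p]. Cones can thus be built and transported by equations alone. *)
Definition cone_representation : representation (cone_mod f) :=
  Representation cone_rep_cycle cone_rep_factK cone_rep_actK.
End RepresentationOfCone.

Lemma ksign_opp a b : a + b = 0 -> ksign b = ksign a.
Proof. by move=> ab; rewrite -[RHS]mulr1 -(ksignK b) mulrA -ksignM ab mul1r. Qed.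

(** A shift is an object with a closed invertible element from [X]. The degrees are two separate
    parameters, so that literals such as 1 and -1 can be used without transport; that the inverse is
    closed is derived later. *)
Record shift_data (B : dgCat) (X S : B) (a b : int) := ShiftData {
  sd_u : dghom X S a;
  sd_v : dghom S X b;
  sd_du : forall j (e : j + 1 = a), dgd e sd_u = 0;
  sd_vu : forall e : b + a = 0, dgcomp e sd_v sd_u = dgid X;
  sd_uv : forall e : a + b = 0, dgcomp e sd_u sd_v = dgid S }.

Section ShiftRules.
Variables (B : dgCat) (X S : B) (a b : int) (c : shift_data X S a b).
Hypothesis ab : a + b = 0.

Lemma op_sd_vu W : op_of W (sd_v c) ∘ ⟦sd_u c⟧ = idm _.
Proof.
have ba : b + a = 0 by rewrite addrC.
by rewrite -(op_of_comp W ba) (sd_vu c ba) op_of_id.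
Qed.

Lemma op_sd_uv W : op_of W (sd_u c) ∘ ⟦sd_v c⟧ = idm _.
Proof. by rewrite -(op_of_comp W ab) (sd_uv c ab) op_of_id. Qed.

Lemma op_sd_du W : opd W S ∘ ⟦sd_u c⟧ = (⟦sd_u c⟧ ∘ ∂) *~ ksign a.
Proof.
have e : (a - 1) + 1 = a by rewrite subrK.
by apply/eqP; rewrite -subr_eq0 -(op_of_d W e) (sd_du c e) op_of0.
Qed.

Lemma op_sd_dv W : opd W X ∘ ⟦sd_v c⟧ = (⟦sd_v c⟧ ∘ ∂) *~ ksign b.
Proof.
rewrite -[∂ in RHS]compf1 -op_sd_uv !compA -[X in (X ∘ _) *~ _]compA op_sd_du.
rewrite compMzr !compMzl compA op_sd_vu comp1f (ksign_opp ab).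
by rewrite -mulrzA ksignK mulr1z.
Qed.
End ShiftRules.

Section OddShiftRules.
Variables (B : dgCat) (X S : B) (a b : int).
Hypotheses (ab : a + b = 0) (ka : ksign a = -1).
Variables (c : shift_data X S a b) (W : B).

Let op_odd_du : opd W S ∘ ⟦sd_u c⟧ = - (⟦sd_u c⟧ ∘ ∂).
Proof. by rewrite op_sd_du ka mulrN1z. Qed.

Let op_odd_dv : opd W X ∘ ⟦sd_v c⟧ = - (⟦sd_v c⟧ ∘ ∂).
Proof.
by rewrite (op_sd_dv c ab) (ksign_opp ab) ka mulrN1z.
Qed.

Definition odd_shift_rules :=
  let vu := op_sd_vu c ab W in let uv := op_sd_uv c ab W in
  (vu, uv, op_odd_du, op_odd_dv,
   (compAr vu, compAr uv, compAr op_odd_du, compAr op_odd_dv)).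
End OddShiftRules.

Definition shift_rules (B : dgCat) (X S : B) (c : shift_data X S 1 (-1)) (W : B) :=
  odd_shift_rules (erefl : 1 + -1 = 0 :> int) (erefl : ksign 1 = -1) c W.
Definition unshift_rules (B : dgCat) (X S : B) (c : shift_data X S (-1) 1) (W : B) :=
  odd_shift_rules (erefl : -1 + 1 = 0 :> int) (erefl : ksign (-1) = -1) c W.

Section ShiftOfRepresentation.
Variables (B : dgCat) (X : B) (m : int) (R : representation (shift_mod X m)).

Let u : dghom X R (0 - m) := rep_elt R.
Let one_deg : 0 + 0 = m - m :> int. Proof. lia. Qed.
(** Composing the identity with itself moves it from degree 0 to degree [m - m]. *)
Let one : shift_mod X m X m := dgcomp one_deg (dgid X) (dgid X).
(** The sign cancels the one by which a map of degree [m] acts on the shifted module. *)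
Let v : dghom R X m := rep_fact R one *~ ksign (m * m).

Lemma shift_rep_du j (e : j + 1 = 0 - m) : dgd e u = 0.
Proof.
have ej : j = -1 - m by lia.
rewrite ej in e *; have := rep_cycle R degd0; rewrite /= /shift_d.
rewrite (_ : shift_degd m degd0 = e); last exact: Prop_irrelevance.
by move/(congr1 (fun x => x *~ ksign m)); rewrite -mulrzA ksignK mul0rz.
Qed.

Lemma shift_rep_vu (e : m + (0 - m) = 0) : dgcomp e v u = dgid X.
Proof.
have vu := rep_factK R (addr0 m) one.
apply: op_of_inj => W; have := congr1 (@op_of B W _ _ _) vu; rewrite /= /shift_act.
rewrite op_ofMz !op_of_comp op_ofMz op_of_id comp1f => vu1.
by rewrite compMzl vu1.
Qed.

Lemma shift_rep_uv (e : (0 - m) + m = 0) : dgcomp e u v = dgid R.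
Proof.
apply: (rep_inj (e := deg00)); rewrite /= /shift_act; congr (_ *~ _).
have e' : m + (0 - m) = 0 by rewrite addrC.
apply: op_of_inj => W; rewrite !op_of_comp !compAl -(op_of_comp W e') shift_rep_vu.
by rewrite !op_of_id comp1f compf1.
Qed.

Definition rep_shift_data : shift_data X R (0 - m) m :=
  ShiftData shift_rep_du shift_rep_vu shift_rep_uv.
End ShiftOfRepresentation.

Section RepresentationOfShift.
Variables (B : dgCat) (X S : B) (m : int) (c : shift_data X S (0 - m) m).

Let elt : shift_mod X m S 0 := sd_u c.

Let fact Z k (x : shift_mod X m Z k) : dghom S Z k :=
  dgcomp (subrK m k) (x : dghom X Z (k - m)) (sd_v c) *~ ksign (m * k).

Lemma shift_rep_cycle j (e : j + 1 = 0) : md e elt = 0.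
Proof. by rewrite /= /shift_d (sd_du c) mul0rz. Qed.

Let mm0 : 0 - m + m = 0 :> int. Proof. exact: subrK. Qed.

Lemma shift_rep_factK Z k (e : k + 0 = k) (x : shift_mod X m Z k) : mact e (fact x) elt = x.
Proof.
apply: op_of_inj => W; rewrite /= /shift_act op_ofMz op_of_comp op_ofMz op_of_comp.
by rewrite compMzl -mulrzA ksignK mulr1z compAl op_sd_vu // compf1.
Qed.

Lemma shift_rep_actK Z k (e : k + 0 = k) (g : dghom S Z k) : fact (mact e g elt) = g.
Proof.
apply: op_of_inj => W; rewrite op_ofMz op_of_comp op_ofMz op_of_comp.
by rewrite compMzl -mulrzA ksignK mulr1z compAl op_sd_uv // compf1.
Qed.

Definition shift_representation : representation (shift_mod X m) :=
  Representation shift_rep_cycle shift_rep_factK shift_rep_actK.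
End RepresentationOfShift.

(** * The triangulated structure of H(B) *)

Definition opE := (op_ofD, op_ofB, op_ofN, op_of_comp, op_of_id, op_of0).

Section Closed.
Variable B : dgCat.

(* Opaque, so that rewriting with [cval_closed] finds [closed_hom] only. *)
Lemma closed_hom_sig (X Y : B) (f : dghom X Y 0) :
  (forall W, opd W Y ∘ ⟦f⟧ = ⟦f⟧ ∘ ∂) -> {c : cycles X Y | cval c = f}.
Proof. by move=> fD; exists (Cycle (is_cycle_op fD)). Qed.

Definition closed_hom (X Y : B) (f : dghom X Y 0)
  (fD : forall W, opd W Y ∘ ⟦f⟧ = ⟦f⟧ ∘ ∂) : cycles X Y := sval (closed_hom_sig fD).

Lemma cval_closed (X Y : B) (f : dghom X Y 0)
  (fD : forall W, opd W Y ∘ ⟦f⟧ = ⟦f⟧ ∘ ∂) : cval (closed_hom fD) = f.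
Proof. exact: svalP (closed_hom_sig fD). Qed.

Lemma cval_comp (X Y Z : B) (g : cycles Y Z) (f : cycles X Y) :
  cval (cycle_comp g f) = dgcomp deg00 (cval g) (cval f).
Proof. by []. Qed.

Lemma cval_id (X : B) : cval (cycle_id X) = dgid X.
Proof. by []. Qed.

Lemma cvalD (X Y : B) (f g : cycles X Y) : cval (f + g) = cval f + cval g.
Proof. by []. Qed.

Lemma cvalN (X Y : B) (f : cycles X Y) : cval (- f) = - cval f.
Proof. by []. Qed.

Lemma cval0 (X Y : B) : cval (0 : cycles X Y) = 0.
Proof. by []. Qed.

Lemma hclass_surj (X Y : B) (f : hom (X : Hcat B) Y) : exists g, f = hclass g.
Proof. by exists (repr f); rewrite hclass_repr. Qed.

Lemma hclass_op (X Y : B) (f g : cycles X Y) :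
  (forall W, op_of W (cval f) = ⟦cval g⟧) -> hclass f = hclass g.
Proof. by move=> fg; congr hclass; apply/cycle_inj/op_of_inj. Qed.

Lemma hclass_comp (X Y Z : B) (g : cycles Y Z) (f : cycles X Y) :
  (hclass g : hom (Y : Hcat B) Z) ∘ hclass f = hclass (cycle_comp g f).
Proof. exact: hcompE. Qed.

Lemma hclass0 (X Y : B) : hclass (0 : cycles X Y) = 0.
Proof. by apply: (addIr (hclass 0)); rewrite -hclassD !add0r. Qed.

Lemma hclassN (X Y : B) (f : cycles X Y) : hclass (- f) = - hclass f.
Proof. by apply: (addIr (hclass f)); rewrite -hclassD !addNr hclass0. Qed.
End Closed.

Section ConeTriangles.
Variables (B : dgCat) (s : shift_choice B).

(* Opaque, so that rewriting does not look into the representation. *)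
Lemma sh_data_sig (X : B) :
  {c : shift_data X (s X) 1 (-1) | sd_u c = sh_unit s X}.
Proof. by exists (rep_shift_data (s X)). Qed.

Definition sh_data (X : B) : shift_data X (s X) 1 (-1) := sval (sh_data_sig X).

Lemma sh_data_unit (X : B) : sd_u (sh_data X) = sh_unit s X.
Proof. exact: svalP (sh_data_sig X). Qed.

Lemma op_sh_cycle W (X Y : B) (f : cycles X Y) :
  op_of W (cval (sh_cycle s f)) = ⟦sd_u (sh_data Y)⟧ ∘ (⟦cval f⟧ ∘ ⟦sd_v (sh_data X)⟧).
Proof.
have fu : op_of W (cval (sh_cycle s f)) ∘ ⟦sd_u (sh_data X)⟧ =
    ⟦sd_u (sh_data Y)⟧ ∘ ⟦cval f⟧.
  have := rep_factK (s X) deg00 (sh_pull f (rep_elt (s Y))).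
  move=> /(congr1 (fun x : shift_mod X (-1) (s Y) 0 => op_of W x)).
  by rewrite /= /shift_act /sh_pull mulr1z !op_of_comp !sh_data_unit.
by rewrite compA -fu compAl op_sd_uv // compf1.
Qed.

Lemma fmap_Hshift (X Y : B) (f : cycles X Y) :
  fmap (@susp (Htri s)) (hclass f : hom (X : Hcat B) Y) = hclass (sh_cycle s f).
Proof. exact: sh_mapE. Qed.

Lemma fmap_Hshift_fun (X Y : B) (f : cycles X Y) :
  fmap (Hshift s) (hclass f : hom (X : Hcat B) Y) = hclass (sh_cycle s f).
Proof. exact: sh_mapE. Qed.

Section Cone.
Variables (X Y : B) (f : cycles X Y) (C : B) (c : cone_data f C).

Definition cone_incl : cycles Y C := closed_hom (op_cd_di c).

Lemma cone_proj_closed W :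
  opd W (s X) ∘ ⟦dgcomp (erefl : 1 + -1 = 0 :> int) (sd_u (sh_data X)) (cd_p c)⟧ =
  ⟦dgcomp (erefl : 1 + -1 = 0 :> int) (sd_u (sh_data X)) (cd_p c)⟧ ∘ ∂.
Proof.
by rewrite op_of_comp !(shift_rules, cone_rules c, compE) opprK.
Qed.

Definition cone_proj : cycles C (s X) := closed_hom cone_proj_closed.

Lemma cval_incl : cval cone_incl = cd_i c.
Proof. exact: cval_closed. Qed.

Lemma cval_proj :
  cval cone_proj = dgcomp (erefl : 1 + -1 = 0 :> int) (sd_u (sh_data X)) (cd_p c).
Proof. exact: cval_closed. Qed.

Lemma Hdist_cone : @dist (Htri s) _ _ _ (hclass f) (hclass cone_incl) (hclass cone_proj).
Proof.
exists X, Y, f, (cone_representation c), cone_incl, cone_proj; split; last first.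
  exists (idm _), (idm _), (idm _); split; first by split; apply: is_iso_id.
  by split; rewrite ?comp1f ?compf1 // fmap1 comp1f.
split; first exact: cval_incl.
exists (cd_p c); split; last by rewrite cval_proj -sh_data_unit.
  move=> j e; have ej : j = -2 by lia.
  by rewrite ej in e *; rewrite -[RHS](cd_dp c); congr dgd; apply: Prop_irrelevance.
congr pair.
  by rewrite -[RHS](cd_pi c); congr dgcomp; apply: Prop_irrelevance.
rewrite mulrN1z; apply: oppr_inj; rewrite opprK -[RHS](cd_pu c).
by congr dgcomp; apply: Prop_irrelevance.
Qed.
End Cone.

(** Every distinguished triangle has a split cone as its model: [p] is determined by its action on
    the universal cycle, so the projection is the one built from the splitting. *)
Lemma HdistP (X Y Z : Hcat B) (f : hom X Y) (g : hom Y Z) (h : hom Z (Hshift s X)) :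
  Hdist f g h -> exists (X' Y' C : B) (f' : cycles X' Y') (c : cone_data f' C),
    @tri_isomorphic (Hcat B) (Hshift s) X' Y' C (hclass f') (hclass (cone_incl c))
      (hclass (cone_proj c)) X Y Z f g h.
Proof.
move=> [X' [Y' [f' [C [i [q [[iE [p [dp pE qE]]] fgh]]]]]]].
exists X', Y', C, f', (rep_cone_data C).
suff [<- <-] : i = cone_incl (rep_cone_data C) /\ q = cone_proj (rep_cone_data C) by [].
split; apply: cycle_inj; rewrite ?iE ?qE ?cval_incl ?cval_proj //= sh_data_unit.
congr dgcomp.
by rewrite -[LHS](rep_actK (r := C) (addr0 (-1))) pE.
Qed.
End ConeTriangles.

Definition cvalE :=
  (cval_closed, cval_comp, cval_id, cvalD, cvalN, cval0, cval_incl, cval_proj).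

Notation dgc i j k := (@dgcomp _ _ _ _ i j k (erefl (k : int))).

Section TriIsomorphic.
Variables (A : preaddCat) (S : functor A A).

Lemma tri_isomorphic_trans (X Y Z : A) (f : hom X Y) (g : hom Y Z) (h : hom Z (S X))
    (X' Y' Z' : A) (f' : hom X' Y') (g' : hom Y' Z') (h' : hom Z' (S X'))
    (X2 Y2 Z2 : A) (f2 : hom X2 Y2) (g2 : hom Y2 Z2) (h2 : hom Z2 (S X2)) :
  tri_isomorphic f g h f' g' h' -> tri_isomorphic f' g' h' f2 g2 h2 ->
  tri_isomorphic f g h f2 g2 h2.
Proof.
move=> [a [b [c [[ia ib ic] [bf cg ah]]]]] [a2 [b2 [c2 [[ia2 ib2 ic2] [bf2 cg2 ah2]]]]].
exists (a2 ∘ a), (b2 ∘ b), (c2 ∘ c); split; first by split; apply: is_iso_comp.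
split.
- by rewrite -compA bf !compA bf2.
- by rewrite -compA cg !compA cg2.
- by rewrite fmapM -compA ah !compA ah2.
Qed.

Lemma tri_isomorphic_rot (X Y Z : A) (f : hom X Y) (g : hom Y Z) (h : hom Z (S X))
    (X' Y' Z' : A) (f' : hom X' Y') (g' : hom Y' Z') (h' : hom Z' (S X')) :
  tri_isomorphic f g h f' g' h' ->
  tri_isomorphic g h (- fmap S f) g' h' (- fmap S f').
Proof.
move=> [a [b [c [[ia ib ic] [bf cg ah]]]]]; exists b, c, (fmap S a).
split; first by split=> //; apply: fmap_iso.
by split=> //; rewrite compfN compNf -!fmapM bf.
Qed.

(** Conjugation by the isomorphisms reduces the fill-in axiom to model triangles. *)
Lemma tri_isomorphic_fill
    (X0 Y0 Z0 : A) (f0 : hom X0 Y0) (g0 : hom Y0 Z0) (h0 : hom Z0 (S X0))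
    (X Y Z : A) (f : hom X Y) (g : hom Y Z) (h : hom Z (S X))
    (X1 Y1 Z1 : A) (f1 : hom X1 Y1) (g1 : hom Y1 Z1) (h1 : hom Z1 (S X1))
    (X' Y' Z' : A) (f' : hom X' Y') (g' : hom Y' Z') (h' : hom Z' (S X'))
    (a : hom X X') (b : hom Y Y') :
  tri_isomorphic f0 g0 h0 f g h -> tri_isomorphic f1 g1 h1 f' g' h' ->
  (forall (a0 : hom X0 X1) (b0 : hom Y0 Y1), b0 ∘ f0 = f1 ∘ a0 ->
    exists c0 : hom Z0 Z1, c0 ∘ g0 = g1 ∘ b0 /\ fmap S a0 ∘ h0 = h1 ∘ c0) ->
  b ∘ f = f' ∘ a ->
  exists c : hom Z Z', c ∘ g = g' ∘ b /\ fmap S a ∘ h = h' ∘ c.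
Proof.
move=> [i [j [k [[_ [j' [j'j jj']] [k' [k'k kk']]] [jf0 kg0 ih0]]]]].
move=> [i1 [j1 [k1 [[[i1' [i1'i ii1']] [j1' [j1'j jj1']] _] [jf1 kg1 ih1]]]]].
move=> fill bf; have [|c0 [c0g c0h]] := fill (i1' ∘ a ∘ i) (j1' ∘ b ∘ j).
  rewrite -compA jf0 compA -(compA j1') bf -[f1]comp1f -j1'j -(compA _ j1) jf1.
  by rewrite -!compA [i1 ∘ _]compA ii1' comp1f.
exists (k1 ∘ c0 ∘ k'); split.
  have -> : g = k ∘ g0 ∘ j' by rewrite kg0 -compA jj' compf1.
  rewrite !compA -(compA _ k') k'k compf1 -(compA k1) c0g !compA kg1.
  by rewrite -(compA g' j1) jj1' compf1 -(compA (g' ∘ b)) jj' compf1.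
have -> : h = fmap S i ∘ h0 ∘ k' by rewrite ih0 -compA kk' compf1.
rewrite !compA -ih1 -(compA _ h1) -c0h !compA -!fmapM !compA ii1' comp1f.
by [].
Qed.
End TriIsomorphic.

Section Triangulated.
Variables (B : dgCat) (s : shift_choice B) (hB : pretriangulated B).
Implicit Types X Y Z : B.

Let T := Htri s.

Notation u_ X := (sd_u (sh_data s X)).
Notation v_ X := (sd_v (sh_data s X)).

Lemma cone_ex X Y (f : cycles X Y) : exists C, inhabited (cone_data f C).
Proof.
case: hB => _ _ /(_ X Y f)[R]; exists R; constructor; exact: rep_cone_data.
Qed.

Lemma desuspend_ex X : exists S, inhabited (shift_data X S (-1) 1).
Proof.
case: hB => _ /(_ X 1)[R] _; exists R; constructor.
exact: (rep_shift_data R).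
Qed.

Lemma Hcat_zero : exists Z : T, is_zero_ob Z.
Proof.
case: hB => -[Z Z0] _ _; exists Z; apply: zero_ob_id.
rewrite -(hclass0 Z Z); apply: hclass_op => W.
by rewrite cval0 ((Z0 Z 0).1 (cval (cycle_id Z))).
Qed.

Lemma Hshift_additive : additive_functor (@susp T).
Proof.
move=> X Y f g; have [f0 ->] := hclass_surj f; have [g0 ->] := hclass_surj g.
rewrite -hclassD !fmap_Hshift -hclassD; apply: hclass_op => W.
by rewrite cvalD op_ofD !op_sh_cycle cvalD op_ofD !compE.
Qed.

Lemma Hshift_full : full (@susp T).
Proof.
move=> X Y g; have [g0 ->] := hclass_surj g.
pose f := dgc (-1) 1 0 (v_ Y) (dgc 0 1 1 (cval g0) (u_ X)).
have fD W : opd W Y ∘ ⟦f⟧ = ⟦f⟧ ∘ ∂.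
  by rewrite !op_of_comp !(shift_rules, op_of_cycle, compAr (op_of_cycle _ g0), compE) opprK.
exists (hclass (closed_hom fD)); rewrite fmap_Hshift; apply: hclass_op => W.
by rewrite op_sh_cycle cvalE !op_of_comp !(shift_rules, compE).
Qed.

Lemma Hshift_faithful : faithful (@susp T).
Proof.
move=> X Y f g; have [f0 ->] := hclass_surj f; have [g0 ->] := hclass_surj g.
rewrite !fmap_Hshift => /hclass_eq_op[h hD].
(* The homotopy is conjugated back along the shifts; moving ∂ past an element of odd degree accounts
   for the sign. *)
apply: (@hclass_eq _ _ _ _ _ (- dgc (-1) 2 1 (v_ Y) (dgc 1 1 2 h (u_ X)))) => W.
rewrite op_ofN !op_of_comp !(shift_rules, op_sh_cycle, hD W, compAr (hD W), compE).
zmod_eq.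
Qed.

Lemma Hshift_ess_surj : ess_surj (@susp T).
Proof.
move=> Y; have [S [c]] := desuspend_ex Y.
pose f := dgc 1 (-1) 0 (sd_v c) (v_ S).
pose g := dgc 1 (-1) 0 (u_ S) (sd_u c).
have fD W : opd W Y ∘ ⟦f⟧ = ⟦f⟧ ∘ ∂.
  by rewrite op_of_comp !(shift_rules, unshift_rules c, compE) opprK.
have gD W : opd W (s S) ∘ ⟦g⟧ = ⟦g⟧ ∘ ∂.
  by rewrite op_of_comp !(shift_rules, unshift_rules c, compE) opprK.
exists S, (hclass (closed_hom fD)), (hclass (closed_hom gD)).
rewrite !hclass_comp; split; apply: hclass_op => W; rewrite !cvalE !opE.
  by rewrite !(shift_rules, unshift_rules c, compE).
by rewrite !(shift_rules, unshift_rules c, compE).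
Qed.

Lemma Hcat_additive : is_additive T.
Proof.
split; first exact: Hcat_zero.
move=> X Y; have [S [a]] := desuspend_ex X.
(* With [S = X[-1]], the cone of the zero map is the sum of [Y] and [S[1] = X]. *)
have [C [c]] := cone_ex (0 : cycles S Y).
pose i := dgc 1 (-1) 0 (cd_u c) (sd_u a).
pose p := - dgc 1 (-1) 0 (sd_v a) (cd_p c).
pose rules W := (unshift_rules a W, op_of0, cone_rules c W, compE).
have iD W : opd W C ∘ ⟦i⟧ = ⟦i⟧ ∘ ∂ by rewrite op_of_comp !rules; zmod_eq.
have pD W : opd W X ∘ ⟦p⟧ = ⟦p⟧ ∘ ∂ by rewrite op_ofN op_of_comp !rules; zmod_eq.
have qD W : opd W Y ∘ ⟦cd_s c⟧ = ⟦cd_s c⟧ ∘ ∂ by rewrite !rules; zmod_eq.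
exists C, (hclass (closed_hom iD)), (hclass (cone_incl c)), (hclass (closed_hom pD)),
  (hclass (closed_hom qD)).
by split; rewrite !hclass_comp -?hclass0 -?hclassD; apply: hclass_op => W;
  rewrite !cvalE !opE !rules; zmod_eq.
Qed.

Lemma Hdist_iso (X Y Z : T) (f : hom X Y) (g : hom Y Z) (h : hom Z (susp X))
    (X' Y' Z' : T) (f' : hom X' Y') (g' : hom Y' Z') (h' : hom Z' (susp X')) :
  tri_isomorphic f g h f' g' h' -> dist f g h -> dist f' g' h'.
Proof.
move=> fgh [X0 [Y0 [f0 [C [i [q [fiq fgh0]]]]]]]; exists X0, Y0, f0, C, i, q.
by split=> //; apply: tri_isomorphic_trans fgh0 fgh.
Qed.

Lemma Hdist_id (X Z : T) : is_zero_ob Z ->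
  dist (idm X) (0 : hom X Z) (0 : hom Z (susp X)).
Proof.
move=> Z0; have [C [c]] := cone_ex (cycle_id X).
apply: Hdist_iso (Hdist_cone s c).
have C0 : is_zero_ob (C : T).
  apply: zero_ob_id; rewrite -(hclass0 C C).
  (* For the identity, [d (u s) = i s - u p = 1], so [u s] contracts the cone. *)
  apply: (@hclass_eq _ _ _ _ _ (dgc 1 0 1 (cd_u c) (cd_s c))) => W.
  by rewrite !cvalE !opE !(cone_rules c, cval_id, op_of_id, compE); zmod_eq.
exists (idm X), (idm X), 0; split.
  by split; [apply: is_iso_id | apply: is_iso_id | apply: zero_ob_iso].
split; first by [].
  exact: (zero_hom_to _ _ Z0).
exact: (zero_hom_from _ _ C0).
Qed.

Lemma Hdist_ex (X Y : T) (f : hom X Y) :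
  exists (Z : T) (g : hom Y Z) (h : hom Z (susp X)), dist f g h.
Proof.
have [f0 ->] := hclass_surj f; have [C [c]] := cone_ex f0.
by exists C, (hclass (cone_incl c)), (hclass (cone_proj s c)); apply: Hdist_cone.
Qed.
End Triangulated.

Section FillAndRotation.
Variables (B : dgCat) (s : shift_choice B) (hB : pretriangulated B).
Implicit Types X Y Z : B.

Let T := Htri s.

Notation u_ X := (sd_u (sh_data s X)).
Notation v_ X := (sd_v (sh_data s X)).

Section ConeMap.
Variables (X Y X' Y' C C' : B) (f : cycles X Y) (f' : cycles X' Y').
Variables (c : cone_data f C) (c' : cone_data f' C').
Variables (a : cycles X X') (b : cycles Y Y') (h : dghom X Y' 1).
Hypothesis hD : forall W, opd W Y' ∘ ⟦h⟧ =
  ⟦cval b⟧ ∘ ⟦cval f⟧ - ⟦cval f'⟧ ∘ ⟦cval a⟧ - ⟦h⟧ ∘ ∂.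

(** A triangular matrix with diagonal [b], [a]; the entry [h] compensates for a square that commutes
    only up to homotopy. The signs reflect [p u = -1]. *)
Let m : dghom C C' 0 :=
  dgc 0 0 0 (cd_i c') (dgc 0 0 0 (cval b) (cd_s c)) -
  dgc 1 (-1) 0 (cd_u c') (dgc 0 (-1) (-1) (cval a) (cd_p c)) -
  dgc 0 0 0 (cd_i c') (dgc 1 (-1) 0 h (cd_p c)).

Lemma cone_map_closed W : opd W C' ∘ ⟦m⟧ = ⟦m⟧ ∘ ∂.
Proof.
rewrite !opE !(cone_rules c, cone_rules c', hD W, compAr (hD W), op_of_cycle,
  compAr (op_of_cycle W a), compAr (op_of_cycle W b), compE).
zmod_eq.
Qed.

Definition cone_map : cycles C C' := closed_hom cone_map_closed.

Lemma op_cone_map W : op_of W (cval cone_map) =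
  ⟦cd_i c'⟧ ∘ (⟦cval b⟧ ∘ ⟦cd_s c⟧) - ⟦cd_u c'⟧ ∘ (⟦cval a⟧ ∘ ⟦cd_p c⟧) -
  ⟦cd_i c'⟧ ∘ (⟦h⟧ ∘ ⟦cd_p c⟧).
Proof. by rewrite !cvalE !opE. Qed.

Lemma cone_map_incl W : op_of W (cval cone_map) ∘ ⟦cd_i c⟧ = ⟦cd_i c'⟧ ∘ ⟦cval b⟧.
Proof. by rewrite op_cone_map !(cone_rules c, compE); zmod_eq. Qed.

Lemma cone_map_proj W : op_of W (cd_p c') ∘ ⟦cval cone_map⟧ = ⟦cval a⟧ ∘ ⟦cd_p c⟧.
Proof. by rewrite op_cone_map !(cone_rules c', compE); zmod_eq. Qed.
End ConeMap.

Lemma Hdist_fill (X Y Z : T) (f : hom X Y) (g : hom Y Z) (h : hom Z (susp X))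
      (X' Y' Z' : T) (f' : hom X' Y') (g' : hom Y' Z') (h' : hom Z' (susp X'))
      (a : hom X X') (b : hom Y Y') :
    dist f g h -> dist f' g' h' -> b ∘ f = f' ∘ a ->
    exists c : hom Z Z', c ∘ g = g' ∘ b /\ fmap susp a ∘ h = h' ∘ c.
Proof.
move=> /HdistP[X0 [Y0 [C [f0 [c fgh]]]]] /HdistP[X1 [Y1 [C' [f1 [c' fgh']]]]].
apply: (tri_isomorphic_fill fgh fgh') => a0 b0.
have [{}a0 ->] := hclass_surj a0; have [{}b0 ->] := hclass_surj b0.
move=> bf; rewrite !hclass_comp in bf; have [k kD] := hclass_eq_op bf.
have hD W : opd W Y1 ∘ ⟦k⟧ =
    ⟦cval b0⟧ ∘ ⟦cval f0⟧ - ⟦cval f1⟧ ∘ ⟦cval a0⟧ - ⟦k⟧ ∘ ∂.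
  by rewrite kD !cvalE !op_of_comp.
exists (hclass (cone_map c c' hD)).
rewrite fmap_Hshift_fun !hclass_comp.
split; apply: hclass_op => W; rewrite !cval_comp ?cval_incl ?cval_proj !op_of_comp.
  exact: cone_map_incl.
rewrite op_sh_cycle !(shift_rules, compE) cone_map_proj.
by [].
Qed.

Lemma Hdist_rot (X Y Z : T) (f : hom X Y) (g : hom Y Z) (h : hom Z (susp X)) :
  dist f g h -> dist g h (- fmap susp f).
Proof.
move=> /HdistP[{}X0 [{}Y0 [C [f0 [c fgh]]]]].
apply: (Hdist_iso (tri_isomorphic_rot fgh)).
have [C' [c']] := cone_ex hB (cone_incl c).
(* The cone [C'] of the inclusion [Y0 -> C] is homotopy equivalent to [X0[1]]. In [t'], the term
   through [f0] is there because [u] of [C] is not closed: the two boundaries cancel. *)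
pose t := dgc 1 (-1) 0 (u_ X0) (dgc (-1) 0 (-1) (cd_p c) (cd_s c')).
pose t' := dgc 1 (-1) 0 (cd_u c') (dgc 0 (-1) (-1) (cval f0) (v_ X0)) -
  dgc 0 0 0 (cd_i c') (dgc 1 (-1) 0 (cd_u c) (v_ X0)).
pose rules W := (shift_rules, cone_rules c W, cone_rules c' W, cval_incl c,
  op_of_cycle W f0, compAr (op_of_cycle W f0), op_sh_cycle, compE).
have tD W : opd W (s X0) ∘ ⟦t⟧ = ⟦t⟧ ∘ ∂ by rewrite !opE !rules; zmod_eq.
have t'D W : opd W C' ∘ ⟦t'⟧ = ⟦t'⟧ ∘ ∂ by rewrite !opE !rules; zmod_eq.
apply: Hdist_iso (Hdist_cone s c').
exists (idm _), (idm _), (hclass (closed_hom tD)); split.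
  split; [exact: is_iso_id | exact: is_iso_id | ].
  exists (hclass (closed_hom t'D)); rewrite !hclass_comp; split.
    (* The homotopy cancels the two copies of [Y0] in [C']. Followed by the projection to [Y0[1]],
       the same homotopy makes the last square commute. *)
    apply: (@hclass_eq _ _ _ _ _
      (- dgc 1 0 1 (cd_u c') (dgc 0 0 0 (cd_s c) (cd_s c')))) => W.
    by rewrite !cvalE !opE !rules; zmod_eq.
  by apply: hclass_op => W; rewrite !cvalE !opE !rules; zmod_eq.
rewrite comp1f compf1 fmap1 comp1f compf1; split=> //.
  by rewrite hclass_comp; apply: hclass_op => W; rewrite !cvalE !opE !rules; zmod_eq.
rewrite fmap_Hshift -hclassN hclass_comp.
apply: (@hclass_eq _ _ _ _ _ (- dgc 1 0 1 (u_ Y0) (dgc 0 0 0 (cd_s c) (cd_s c')))) => W.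
by rewrite !cvalE !opE !rules; zmod_eq.
Qed.
End FillAndRotation.

(** * The octahedral axiom *)

Section Octahedron.
Variables (B : dgCat) (s : shift_choice B) (hB : pretriangulated B).
Implicit Types X Y Z : B.

Let T := Htri s.

Notation u_ X := (sd_u (sh_data s X)).
Notation v_ X := (sd_v (sh_data s X)).

Lemma Htri_rotatable : rotatable T.
Proof.
split.
- exact: (Hcat_zero s hB).
- exact: Hshift_additive.
- exact: Hshift_faithful.
- exact: Hshift_full.
- exact: Hdist_iso.
- exact: (Hdist_id hB).
- exact: (Hdist_ex hB).
- exact: (Hdist_rot hB).
- exact: Hdist_fill.
Qed.

Section ConeOctahedron.
Variables (X Y Z : B) (f : cycles X Y) (g : cycles Y Z).
Variables (U V W0 : B) (cf : cone_data f U) (cg : cone_data g V).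
Variable cgf : cone_data (cycle_comp g f) W0.

Let a : dghom U W0 0 := dgc 0 0 0 (cd_i cgf) (dgc 0 0 0 (cval g) (cd_s cf)) -
  dgc 1 (-1) 0 (cd_u cgf) (cd_p cf).
Let b : dghom W0 V 0 := dgc 0 0 0 (cd_i cg) (cd_s cgf) -
  dgc 1 (-1) 0 (cd_u cg) (dgc 0 (-1) (-1) (cval f) (cd_p cgf)).

Let rules W := (shift_rules, cone_rules cf W, cone_rules cg W, cone_rules cgf W,
  cval_comp g f, op_of_comp W deg00 (cval g) (cval f), compE,
  (op_of_cycle W f, compAr (op_of_cycle W f), op_of_cycle W g, compAr (op_of_cycle W g),
   op_sh_cycle)).

Lemma oct_left_closed W : opd W W0 ∘ ⟦a⟧ = ⟦a⟧ ∘ ∂.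
Proof. by rewrite !opE !rules; zmod_eq. Qed.

Lemma oct_right_closed W : opd W V ∘ ⟦b⟧ = ⟦b⟧ ∘ ∂.
Proof. by rewrite !opE !rules; zmod_eq. Qed.

Definition oct_left := closed_hom oct_left_closed.
Definition oct_right := closed_hom oct_right_closed.

(** The cone of [Cf -> C(gf)] is homotopy equivalent to [Cg]: [t t' = 1] holds strictly, and [t' t]
    is homotopic to 1 since the copies of [X] in [Cf] and in [C(gf)] cancel. *)
Lemma Hdist_oct : @dist T U W0 V (hclass oct_left) (hclass oct_right)
  (hclass (cycle_comp (sh_cycle s (cone_incl cf)) (cone_proj s cg))).
Proof.
have [C [c]] := cone_ex hB oct_left.
have cl : cval oct_left = a := cval_closed _.
have cr : cval oct_right = b := cval_closed _.
pose rules' W := (rules W, cone_rules c W, cl, op_of_comp, op_ofB).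
pose t := dgc 0 0 0 b (cd_s c) -
  dgc 1 (-1) 0 (cd_u cg) (dgc 0 (-1) (-1) (cd_s cf) (cd_p c)).
pose t' := dgc 0 0 0 (cd_i c) (dgc 0 0 0 (cd_i cgf) (cd_s cg)) -
  dgc 1 (-1) 0 (cd_u c) (dgc 0 (-1) (-1) (cd_i cf) (cd_p cg)).
have tD W : opd W V ∘ ⟦t⟧ = ⟦t⟧ ∘ ∂ by rewrite !opE !rules'; zmod_eq.
have t'D W : opd W C ∘ ⟦t'⟧ = ⟦t'⟧ ∘ ∂ by rewrite !opE !rules'; zmod_eq.
apply: Hdist_iso (Hdist_cone s c).
exists (idm _), (idm _), (hclass (closed_hom tD)); split.
  split; [exact: is_iso_id | exact: is_iso_id | ].
  exists (hclass (closed_hom t'D)); rewrite !hclass_comp; split; last first.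
    by apply: hclass_op => W; rewrite !cvalE !opE !rules'; zmod_eq.
  apply: (@hclass_eq _ _ _ _ _ (dgc 1 0 1 (cd_u c)
    (dgc 1 (-1) 0 (cd_u cf) (dgc (-1) 0 (-1) (cd_p cgf) (cd_s c))))) => W.
  by rewrite !cvalE !opE !rules'; zmod_eq.
rewrite comp1f compf1 fmap1 comp1f compf1; split=> //.
  by rewrite hclass_comp; apply: hclass_op => W; rewrite !cvalE ?cr !opE !rules'; zmod_eq.
rewrite hclass_comp.
apply: (@hclass_eq _ _ _ _ _ (dgc 1 0 1 (u_ U)
    (dgc 1 (-1) 0 (cd_u cf) (dgc (-1) 0 (-1) (cd_p cgf) (cd_s c))))) => W.
by rewrite !cvalE !opE !op_sh_cycle !cval_incl !rules'; zmod_eq.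
Qed.
End ConeOctahedron.
End Octahedron.

Section OctahedronEquations.
Variables (B : dgCat) (s : shift_choice B) (X Y Z : B) (f : cycles X Y) (g : cycles Y Z).
Variables (U V W0 : B) (cf : cone_data f U) (cg : cone_data g V).
Variable cgf : cone_data (cycle_comp g f) W0.

Lemma oct_left_incl : hclass (cycle_comp (oct_left cf cgf) (cone_incl cf)) =
  hclass (cycle_comp (cone_incl cgf) g).
Proof.
apply: hclass_op => W; rewrite !cvalE !opE.
by rewrite !(cone_rules cf, compE); zmod_eq.
Qed.

Lemma oct_left_proj : hclass (cycle_comp (cone_proj s cgf) (oct_left cf cgf)) =
  hclass (cone_proj s cf).
Proof.
apply: hclass_op => W; rewrite !cvalE !opE.
by rewrite !(cone_rules cgf, compE); zmod_eq.
Qed.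

Lemma oct_right_incl : hclass (cycle_comp (oct_right cg cgf) (cone_incl cgf)) =
  hclass (cone_incl cg).
Proof.
apply: hclass_op => W; rewrite !cvalE !opE.
by rewrite !(cone_rules cgf, compE); zmod_eq.
Qed.

Lemma oct_right_proj : hclass (cycle_comp (cone_proj s cg) (oct_right cg cgf)) =
  hclass (cycle_comp (sh_cycle s f) (cone_proj s cgf)).
Proof.
apply: hclass_op => W; rewrite !cvalE !opE op_sh_cycle.
by rewrite !(shift_rules, cone_rules cg, compE); zmod_eq.
Qed.
End OctahedronEquations.

Section Triangulated.
Variables (B : dgCat) (s : shift_choice B) (hB : pretriangulated B).

Local Notation "⟪ f ⟫" := (hclass f : @hom (Hcat B) _ _) (format "⟪ f ⟫").

Let T := Htri s.
Let rT : rotatable T := Htri_rotatable s hB.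

Lemma Hdist_octahedron (X Y Z : T) (f : hom X Y) (g : hom Y Z)
    (U V W : T) (i : hom Y U) (p : hom U (susp X))
    (j : hom Z V) (q : hom V (susp Y)) (k : hom Z W) (r : hom W (susp X)) :
  dist f i p -> dist g j q -> dist (g ∘ f) k r ->
  exists (a : hom U W) (b : hom W V),
    dist a b (fmap susp i ∘ q) /\
    [/\ a ∘ i = k ∘ g, r ∘ a = p, b ∘ k = j & q ∘ b = fmap susp f ∘ r].
Proof.
have [f0 ->] := hclass_surj f; have [g0 ->] := hclass_surj g.
rewrite hclass_comp => df dg dgf.
have [[U0 [cf]] [V0 [cg]] [W0 [cgf]]] :=
  And3 (cone_ex hB f0) (cone_ex hB g0) (cone_ex hB (cycle_comp g0 f0)).
(* The three given cones are replaced by split ones, and the model octahedron is conjugated back. *)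
have [u [[u' [u'u uu']] ui pu]] := dist_cone_iso rT df (Hdist_cone s cf).
have [v [[v' [v'v vv']] vj qv]] := dist_cone_iso rT dg (Hdist_cone s cg).
have [w [[w' [w'w ww']] wk rw]] := dist_cone_iso rT dgf (Hdist_cone s cgf).
pose a0 := ⟪oct_left cf cgf⟫; pose b0 := ⟪oct_right cg cgf⟫.
have a0i : a0 ∘ ⟪cone_incl cf⟫ = ⟪cone_incl cgf⟫ ∘ ⟪g0⟫.
  by rewrite !hclass_comp oct_left_incl.
have qa0 : ⟪cone_proj s cgf⟫ ∘ a0 = ⟪cone_proj s cf⟫.
  by rewrite hclass_comp oct_left_proj.
have b0k : b0 ∘ ⟪cone_incl cgf⟫ = ⟪cone_incl cg⟫.
  by rewrite hclass_comp oct_right_incl.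
have qb0 : ⟪cone_proj s cg⟫ ∘ b0 = fmap (@susp T) ⟪f0⟫ ∘ ⟪cone_proj s cgf⟫.
  by rewrite fmap_Hshift !hclass_comp oct_right_proj.
exists (w' ∘ a0 ∘ u), (v' ∘ b0 ∘ w); split.
  apply: (rt_iso rT) (Hdist_oct s hB cf cg cgf); exists u', w', v'; split.
    by split; [exists u | exists w | exists v].
  split.
  - by rewrite -[RHS]compA uu' compf1.
  - by rewrite -[RHS]compA ww' compf1.
  - rewrite -hclass_comp -(fmap_Hshift s) -ui fmapM !compA -fmapM u'u fmap1 comp1f.
    by rewrite qv -!compA vv' compf1.
split.
- by rewrite -compA ui -compA a0i compA -wk compA w'w comp1f.
- by rewrite rw pu !compA -(compA _ w) ww' compf1 qa0.
- by rewrite -compA wk -compA b0k -vj compA v'v comp1f.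
- by rewrite qv rw !compA -(compA _ v) vv' compf1 qb0.
Qed.

Theorem Htri_triangulated : is_triangulated T.
Proof.
split.
- exact: (Hcat_additive s hB).
- exact: rt_suspD.
- apply: ff_ess_surj_equivalence (rt_suspI rT) (rt_susp_full rT) _.
  exact: Hshift_ess_surj.
- exact: rt_iso.
- exact: rt_id.
- exact: rt_cone.
- by move=> *; split; [apply: rt_rot | apply: dist_rot_inv].
- exact: rt_fill.
- exact: Hdist_octahedron.
Qed.
End Triangulated.

(** * Dg functors *)

Record dgFunctor (B B' : dgCat) := DgFunctor {
  dgf_ob :> B -> B';
  dgf : forall X Y i, dghom X Y i -> dghom (dgf_ob X) (dgf_ob Y) i;
  dgfD : forall X Y i (f g : dghom X Y i), dgf (f + g) = dgf f + dgf g;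
  dgf_d : forall X Y i j (e : j + 1 = i) (f : dghom X Y i), dgf (dgd e f) = dgd e (dgf f);
  dgf1 : forall X, dgf (dgid X) = dgid (dgf_ob X);
  dgfM : forall X Y Z i j k (e : i + j = k) (g : dghom Y Z i) (f : dghom X Y j),
    dgf (dgcomp e g f) = dgcomp e (dgf g) (dgf f) }.

Section DgFunctor.
Variables (B B' : dgCat) (F : dgFunctor B B').

HB.instance Definition _ X Y i := GRing.isZmodMorphism.Build (dghom X Y i)
  (dghom (F X) (F Y) i) (@dgf B B' F X Y i) (morphD_zmod (@dgfD B B' F X Y i)).

Lemma dgf0 X Y i : dgf F (0 : dghom X Y i) = 0.
Proof. exact: raddf0. Qed.

Lemma dgfN X Y i (f : dghom X Y i) : dgf F (- f) = - dgf F f.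
Proof. exact: raddfN. Qed.

Lemma dgfB X Y i (f g : dghom X Y i) : dgf F (f - g) = dgf F f - dgf F g.
Proof. exact: raddfB. Qed.

Lemma dgf_cycleP X Y (f : cycles X Y) : dgf F (cval f) \in @is_cycle B' (F X) (F Y).
Proof. by rewrite inE -dgf_d cycle_d dgf0. Qed.

Definition dgf_cycle X Y (f : cycles X Y) : cycles (F X) (F Y) := Cycle (dgf_cycleP f).

Lemma cval_dgf X Y (f : cycles X Y) : cval (dgf_cycle f) = dgf F (cval f).
Proof. by []. Qed.

Definition Hfun_map X Y (f : hom (X : Hcat B) Y) : hom (F X : Hcat B') (F Y) :=
  hclass (dgf_cycle (repr f)).

Lemma Hfun_mapE X Y (f : cycles X Y) : Hfun_map (hclass f) = hclass (dgf_cycle f).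
Proof.
have [h hD] := (hclassP (repr (hclass f)) f).2 (hclass_repr _).
apply/hclassP; exists (dgf F h); rewrite -dgf_d hD.
exact: dgfB.
Qed.

Lemma Hfun_map1 X : Hfun_map (idm (X : Hcat B)) = idm (F X : Hcat B').
Proof. by rewrite Hfun_mapE; congr hclass; apply/cycle_inj/dgf1. Qed.

Lemma Hfun_mapM (X Y Z : Hcat B) (g : hom Y Z) (f : hom X Y) :
  Hfun_map (g ∘ f) = Hfun_map g ∘ Hfun_map f.
Proof.
have [g0 ->] := hclass_surj g; have [f0 ->] := hclass_surj f.
rewrite hclass_comp !Hfun_mapE hclass_comp; congr hclass; apply/cycle_inj/dgfM.
Qed.

Definition Hfun : functor (Hcat B) (Hcat B') :=
  @Functor (Hcat B) (Hcat B') F Hfun_map Hfun_map1 Hfun_mapM.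

Lemma fmap_Hfun X Y (f : cycles X Y) :
  fmap Hfun (hclass f : hom (X : Hcat B) Y) = hclass (dgf_cycle f).
Proof. exact: Hfun_mapE. Qed.

Lemma Hfun_additive : additive_functor Hfun.
Proof.
move=> X Y f g; have [f0 ->] := hclass_surj f; have [g0 ->] := hclass_surj g.
by rewrite -hclassD !fmap_Hfun -hclassD; congr hclass; apply/cycle_inj/dgfD.
Qed.

(** A split cone is given by equations, which a dg functor preserves; the components recorded are
    those that enter the triangle. *)
Lemma dgf_cone X Y (f : cycles X Y) C (c : cone_data f C) :
  {c' : cone_data (dgf_cycle f) (F C) |
    [/\ cd_i c' = dgf F (cd_i c) & cd_p c' = dgf F (cd_p c)]}.
Proof.
unshelve eexists (@ConeData B' _ _ (dgf_cycle f) (F C)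
  (dgf F (cd_i c)) (dgf F (cd_u c)) (dgf F (cd_p c)) (dgf F (cd_s c)) _ _ _ _ _ _ _ _ _).
- by rewrite -dgf_d cd_di dgf0.
- by rewrite -dgf_d cd_du dgfM.
- by rewrite -dgf_d cd_dp dgf0.
- by rewrite -dgf_d cd_ds dgfM.
- by rewrite -dgfM cd_pi dgf0.
- by rewrite -dgfM cd_pu dgfN dgf1.
- by rewrite -dgfM cd_si dgf1.
- by rewrite -dgfM cd_su dgf0.
- by rewrite -!dgfM -dgfB cd_id dgf1.
- by [].
Qed.

Lemma dgf_shift X S a b (c : shift_data X S a b) :
  {c' : shift_data (F X) (F S) a b | sd_u c' = dgf F (sd_u c) /\ sd_v c' = dgf F (sd_v c)}.
Proof.
unshelve eexists (@ShiftData B' _ _ a b (dgf F (sd_u c)) (dgf F (sd_v c)) _ _ _).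
- by move=> j e; rewrite -dgf_d sd_du dgf0.
- by move=> e; rewrite -dgfM sd_vu dgf1.
- by move=> e; rewrite -dgfM sd_uv dgf1.
- by [].
Qed.

Variables (s : shift_choice B) (s' : shift_choice B').
Notation u_ X := (sd_u (sh_data s X)).
Notation v_ X := (sd_v (sh_data s X)).
Notation u'_ X := (sd_u (sh_data s' X)).
Notation v'_ X := (sd_v (sh_data s' X)).

Let Fs X : shift_data (F X) (F (s X)) 1 (-1) := sval (dgf_shift (sh_data s X)).

Let Fs_u X : sd_u (Fs X) = dgf F (u_ X).
Proof. by case: (svalP (dgf_shift (sh_data s X))). Qed.

Let Fs_v X : sd_v (Fs X) = dgf F (v_ X).
Proof. by case: (svalP (dgf_shift (sh_data s X))). Qed.

(** Both [F (X[1])] and [(F X)[1]] carry a closed invertible element of degree 1 from [F X];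
    comparing these gives the suspension isomorphism. *)
Let to X := dgc 1 (-1) 0 (u'_ (F X)) (sd_v (Fs X)).
Let from X := dgc 1 (-1) 0 (sd_u (Fs X)) (v'_ (F X)).

Lemma Hfun_susp_closed X W : opd W (s' (F X)) ∘ ⟦to X⟧ = ⟦to X⟧ ∘ ∂.
Proof. by rewrite !opE !(shift_rules, compE); zmod_eq. Qed.

Lemma Hfun_susp_inv_closed X W : opd W (F (s X)) ∘ ⟦from X⟧ = ⟦from X⟧ ∘ ∂.
Proof. by rewrite !opE !(shift_rules, compE); zmod_eq. Qed.

Definition Hfun_susp X := closed_hom (Hfun_susp_closed X).
Definition Hfun_susp_inv X := closed_hom (Hfun_susp_inv_closed X).

Lemma Hfun_susp_invK X :
  (hclass (Hfun_susp_inv X) : @hom (Hcat B') _ _) ∘ hclass (Hfun_susp X) = idm _.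
Proof.
rewrite hclass_comp; apply: hclass_op => W.
by rewrite !cvalE !opE !(shift_rules, compE).
Qed.

Lemma Hfun_suspK X :
  (hclass (Hfun_susp X) : @hom (Hcat B') _ _) ∘ hclass (Hfun_susp_inv X) = idm _.
Proof.
rewrite hclass_comp; apply: hclass_op => W.
by rewrite !cvalE !opE !(shift_rules, compE).
Qed.

Lemma cval_sh_cycle X Y (f : cycles X Y) : cval (sh_cycle s f) =
  dgc 1 (-1) 0 (u_ Y) (dgc 0 (-1) (-1) (cval f) (v_ X)).
Proof. by apply: op_of_inj => W; rewrite op_sh_cycle !op_of_comp. Qed.

Lemma Hfun_susp_nat (X Y : Hcat B) (f : hom X Y) :
  (hclass (Hfun_susp Y) : @hom (Hcat B') _ _) ∘ fmap Hfun (fmap (@susp (Htri s)) f) =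
  fmap (@susp (Htri s')) (fmap Hfun f) ∘ hclass (Hfun_susp X).
Proof.
have [f0 ->] := hclass_surj f.
rewrite fmap_Hshift !fmap_Hfun fmap_Hshift !hclass_comp; apply: hclass_op => W.
rewrite !cvalE !opE op_sh_cycle !cval_dgf cval_sh_cycle !dgfM !opE.
by rewrite -Fs_u -Fs_v !(shift_rules, compE).
Qed.

Definition Hfun_susp_iso :
    nat_iso (comp_functor Hfun (@susp (Htri s))) (comp_functor (@susp (Htri s')) Hfun) :=
  @NatIso _ _ (comp_functor Hfun (@susp (Htri s))) (comp_functor (@susp (Htri s')) Hfun)
    (fun X : B => hclass (Hfun_susp X)) (fun X : B => hclass (Hfun_susp_inv X))
    Hfun_susp_invK Hfun_suspK Hfun_susp_nat.

Lemma Hfun_dist (X Y Z : Htri s) (f : hom X Y) (g : hom Y Z) (h : hom Z (susp X)) :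
  dist f g h ->
  @dist (Htri s') _ _ _ (fmap Hfun f) (fmap Hfun g) (Hfun_susp_iso X ∘ fmap Hfun h).
Proof.
move=> /HdistP[X0 [Y0 [C [f0 [c fgh]]]]].
have [a [b [k [[ia ib ik] [bf kg ah]]]]] := fgh.
have [c' [ci cp]] := dgf_cone c.
apply: Hdist_iso (Hdist_cone s' c').
exists (fmap Hfun a), (fmap Hfun b), (fmap Hfun k); split.
  by split; apply: fmap_iso.
split.
- by rewrite -(fmap_Hfun f0) -!(fmapM Hfun) bf.
- have -> : hclass (cone_incl c') = fmap Hfun (hclass (cone_incl c) : @hom (Hcat B) _ _).
    rewrite fmap_Hfun; apply: hclass_op => W.
    by rewrite cval_incl ci !cval_dgf cval_incl.
  by rewrite -!(fmapM Hfun) kg.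
rewrite -compA -(fmapM Hfun) -ah (fmapM Hfun) compA Hfun_susp_nat -compA.
congr (_ ∘ _); rewrite fmap_Hfun hclass_comp; apply: hclass_op => W.
rewrite !cvalE !opE !cval_dgf !cvalE !dgfM !opE cp.
by rewrite -Fs_u !(shift_rules, compE).
Qed.

Definition Hfun_exact : exact_functor (Htri s) (Htri s') :=
  @ExactFunctor (Htri s) (Htri s') Hfun Hfun_additive Hfun_susp_iso Hfun_dist.
End DgFunctor.

(** * Modules over the Koszul resolution of Z/n *)

Lemma ksign_cases i : ksign i = 1 \/ ksign i = -1.
Proof.
have /eqP := ksignK i; rewrite -expr2 sqrf_eq1 => /orP[] /eqP ->; first by left.
by right.
Qed.

Lemma ksign_pred i j : j + 1 = i -> ksign i = - ksign j.
Proof. by move=> <-; rewrite ksignM ksign1 mulrN1. Qed.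

Section DgModules.
Variables (B : dgCat) (n : nat).

(* Modules over the Koszul resolution [Z<e | d e = n, e^2 = 0>] of [Z/n]. *)
Record dgmodn := Dgmodn {
  dgm_ob :> B;
  dgm_e : dghom dgm_ob dgm_ob 1;
  dgm_d : dgd degd1 dgm_e = dgid dgm_ob *+ n;
  dgm_sq : dgcomp (erefl : 1 + 1 = 2 :> int) dgm_e dgm_e = 0 }.

Implicit Types X Y Z : dgmodn.

Lemma op_dgm_d X W : opd W X ∘ ⟦dgm_e X⟧ = idm _ *+ n - ⟦dgm_e X⟧ ∘ ∂.
Proof.
have := congr1 (@op_of B W _ _ _) (dgm_d X); rewrite op_of_d1 => /(canRL (addrK _)) ->.
by rewrite (raddfMn (@op_of B W X X 0)) /= op_of_id.
Qed.

Lemma op_dgm_sq X W : op_of W (dgm_e X) ∘ ⟦dgm_e X⟧ = 0.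
Proof. by rewrite -(op_of_comp W (erefl : 1 + 1 = 2 :> int)) dgm_sq op_of0. Qed.

Section Hom.
Variables (X Y : dgmodn) (i : int).

Lemma dgm_deg : i + 1 = 1 + i. Proof. exact: addrC. Qed.

Definition elinear : {pred dghom X Y i} :=
  [pred f | dgcomp (erefl (1 + i)) (dgm_e Y) f == dgcomp dgm_deg f (dgm_e X) *~ ksign i].

Lemma elinear_closed : zmod_closed elinear.
Proof.
split=> [|f g]; rewrite !inE ?dgcomp0r ?dgcomp0l ?mul0rz //.
rewrite raddfB /= dgcompDl dgcompNl mulrzDl mulNrz.
by move=> /eqP-> /eqP->.
Qed.

HB.instance Definition _ :=
  GRing.isZmodClosed.Build (dghom X Y i) elinear elinear_closed.

Record dgmhom := DgmHom { dgmval : dghom X Y i; dgmvalP : dgmval \in elinear }.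

HB.instance Definition _ := [isSub for dgmval].
HB.instance Definition _ := [Choice of dgmhom by <:].
HB.instance Definition _ := [SubChoice_isSubZmodule of dgmhom by <:].

Lemma elinear_op (f : dghom X Y i) :
  (forall W, op_of W (dgm_e Y) ∘ ⟦f⟧ = (⟦f⟧ ∘ ⟦dgm_e X⟧) *~ ksign i) -> f \in elinear.
Proof.
move=> fe; rewrite inE; apply/eqP/op_of_inj => W.
by rewrite op_ofMz !op_of_comp fe.
Qed.

Lemma op_elinear W (f : dgmhom) :
  op_of W (dgm_e Y) ∘ ⟦dgmval f⟧ = (⟦dgmval f⟧ ∘ ⟦dgm_e X⟧) *~ ksign i.
Proof.
have /eqP/(congr1 (@op_of B W _ _ _)) := dgmvalP f.
by rewrite op_ofMz !op_of_comp.
Qed.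

Lemma dgmval_inj (f g : dgmhom) : dgmval f = dgmval g -> f = g.
Proof. exact: val_inj. Qed.
End Hom.

(** Differentiating the relation between [e] and [f] produces a term [n f] on either side, since
    [d e = n] for both modules; these cancel. *)
Lemma dgm_dP X Y i j (e : j + 1 = i) (f : dgmhom X Y i) :
  dgd e (dgmval f) \in @elinear X Y j.
Proof.
apply: elinear_op => W; rewrite op_of_d.
rewrite !(compE, compMzl, compMzr) (compAr (op_elinear W f)) compMzl.
rewrite [⟦dgm_e Y⟧ ∘ (_ ∘ _)]compA (_ : ⟦dgm_e Y⟧ ∘ ∂ = idm _ *+ n - ∂ ∘ ⟦dgm_e Y⟧);
  last by rewrite op_dgm_d; zmod_eq.
rewrite !compE op_elinear !(op_dgm_d, compE, compMzr) (ksign_pred e).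
rewrite compMnl compMnr compf1 comp1f.
case: (ksign_cases j) => ->; rewrite ?(opprK (1 : int)) !(mulrN1z, mulr1z); zmod_eq.
Qed.

Definition dgm_dif X Y i j (e : j + 1 = i) (f : dgmhom X Y i) : dgmhom X Y j :=
  DgmHom (dgm_dP e f).

Lemma dgm_idP X : dgid X \in @elinear X X 0.
Proof. by apply: elinear_op => W; rewrite op_of_id comp1f compf1. Qed.

Definition dgm_id X : dgmhom X X 0 := DgmHom (dgm_idP X).

Lemma dgm_compP X Y Z i j k (e : i + j = k) (g : dgmhom Y Z i) (f : dgmhom X Y j) :
  dgcomp e (dgmval g) (dgmval f) \in @elinear X Z k.
Proof.
apply: elinear_op => W; rewrite op_of_comp (compAr (op_elinear W g)) compMzl !compAl.
by rewrite op_elinear compMzr -mulrzA -e ksignM mulrC.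
Qed.

Definition dgm_comp X Y Z i j k (e : i + j = k) (g : dgmhom Y Z i) (f : dgmhom X Y j) :
  dgmhom X Z k := DgmHom (dgm_compP e g f).

Lemma dgmvalMz X Y i (f : dgmhom X Y i) m : dgmval (f *~ m) = dgmval f *~ m.
Proof. exact: (raddfMz (val : dgmhom X Y i -> dghom X Y i)). Qed.

(** Kept transparent, so that differentials and composites agree with those of [B] by conversion. *)
Definition dgmod : dgCat.
Proof.
apply: (@DgCat dgmodn (fun X Y i => dgmhom X Y i) dgm_dif dgm_id dgm_comp).
- by move=> *; apply: dgmval_inj; apply: dgdD.
- by move=> *; apply: dgmval_inj; apply: dgdd.
- by move=> *; apply: dgmval_inj; apply: dgcompDl.
- by move=> *; apply: dgmval_inj; apply: dgcompDr.
- by move=> *; apply: dgmval_inj; apply: dgcompA.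
- by move=> *; apply: dgmval_inj; apply: dgcomp1f.
- by move=> *; apply: dgmval_inj; apply: dgcompf1.
- by move=> *; apply: dgmval_inj; apply: dgd_id.
- move=> X Y Z i j k i' j' k' e ei ej ek e1 e2 g f; apply: dgmval_inj.
  rewrite -[LHS]/(dgd ek (dgcomp e (dgmval g) (dgmval f))) (dgd_comp _ ei ej _ e1 e2).
  congr (_ + _); exact: esym (dgmvalMz (dgm_comp e2 g (dgm_dif ej f)) (ksign i)).
Defined.

Lemma dgmvalD (X Y : dgmod) i (f g : dghom X Y i) : dgmval (f + g) = dgmval f + dgmval g.
Proof. by []. Qed.

Lemma dgmval_d (X Y : dgmod) i j (e : j + 1 = i) (f : dghom X Y i) :
  dgmval (dgd e f) = dgd e (dgmval f).
Proof. by []. Qed.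

Lemma dgmval_id (X : dgmod) : dgmval (dgid X) = dgid (dgm_ob X).
Proof. by []. Qed.

Lemma dgmval_comp (X Y Z : dgmod) i j k (e : i + j = k) (g : dghom Y Z i) (f : dghom X Y j) :
  dgmval (dgcomp e g f) = dgcomp e (dgmval g) (dgmval f).
Proof. by []. Qed.

Definition dgmod_forget : dgFunctor dgmod B.
Proof.
by apply: (@DgFunctor dgmod B dgm_ob (fun X Y i f => dgmval f)).
Defined.
End DgModules.

(** * Shifts and cones of modules *)

Section DgModulePretriangulated.
Variables (B : dgCat) (n : nat).
Let M := dgmod B n.
Implicit Types X Y Z : M.

Let mulrnE := (compMnl, compMnr, mulrnDl, mulNrn).

Section Shift.
Variables (X : M) (m : int) (S : B) (c : shift_data (dgm_ob X) S (0 - m) m).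

Let mm : 0 - m + m = 0. Proof. exact: subrK. Qed.
Let e1 : 1 + m = 1 + m. Proof. by []. Qed.
Let e2 : 0 - m + (1 + m) = 1. Proof. lia. Qed.

(** Moving ∂ past [u] or [v] costs the sign of [m]; the factor in front restores [d e = n] and makes
    [u] and [v] linear over [e]. *)
Let e : dghom S S 1 :=
  dgcomp e2 (sd_u c) (dgcomp e1 (dgm_e X) (sd_v c)) *~ ksign m.

Let op_e W : op_of W e =
  (⟦sd_u c⟧ ∘ (⟦dgm_e X⟧ ∘ ⟦sd_v c⟧)) *~ ksign m.
Proof. by rewrite op_ofMz !op_of_comp. Qed.

Let op_du W : opd W S ∘ ⟦sd_u c⟧ = (⟦sd_u c⟧ ∘ ∂) *~ ksign m.
Proof. by rewrite op_sd_du (ksign_opp mm). Qed.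

Let rules W := (op_sd_vu c mm W, op_sd_uv c mm W, op_du W, op_sd_dv c mm W,
  (compAr (op_sd_vu c mm W), compAr (op_sd_uv c mm W), compAr (op_du W)),
  op_dgm_d X W, compAr (op_dgm_d X W), op_dgm_sq X W, compAr (op_dgm_sq X W),
  compE, mulrnE).

Lemma shift_dgm_d : dgd degd1 e = dgid S *+ n.
Proof.
apply: op_of_inj => W; rewrite op_of_d1 op_e (raddfMn (@op_of B W S S 0)) /= op_of_id.
by case: (ksign_cases m) => k; rewrite !(rules W, k, mulr1z, mulrN1z); zmod_eq.
Qed.

Lemma shift_dgm_sq : dgcomp (erefl : 1 + 1 = 2 :> int) e e = 0.
Proof.
apply: op_of_inj => W; rewrite op_of_comp op_e op_of0 compMzl compMzr.
by rewrite !rules !mul0rz.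
Qed.

Definition shift_dgm : M := Dgmodn shift_dgm_d shift_dgm_sq.

Lemma shift_dgm_u : sd_u c \in @elinear B n X shift_dgm (0 - m).
Proof.
apply: elinear_op => W; rewrite [X in X ∘ _]op_e (ksign_opp mm) compMzl.
by rewrite !rules.
Qed.

Lemma shift_dgm_v : sd_v c \in @elinear B n shift_dgm X m.
Proof.
apply: elinear_op => W; rewrite [X in _ = (_ ∘ X) *~ _]op_e compMzr.
by rewrite !rules -mulrzA ksignK.
Qed.

Definition shift_dgm_data : @shift_data M X shift_dgm (0 - m) m.
Proof.
apply: (@ShiftData M X shift_dgm _ _ (DgmHom shift_dgm_u) (DgmHom shift_dgm_v)) => *;
  apply: dgmval_inj; [exact: sd_du | exact: sd_vu | exact: sd_uv].
Qed.
End Shift.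

Section Cone.
Variables (X Y : M) (f : cycles X Y) (C : B).
Let f0 : cycles (dgm_ob X) (dgm_ob Y) := dgf_cycle (dgmod_forget B n) f.
Variable c : cone_data f0 C.

(** The diagonal action. Because [p u = -1], it satisfies [e u = - u e], the sign rule for the
    degree-1 element [u]. *)
Let e : dghom C C 1 :=
  dgc 0 1 1 (cd_i c) (dgc 1 0 1 (dgm_e Y) (cd_s c)) +
  dgc 1 0 1 (cd_u c) (dgc 1 (-1) 0 (dgm_e X) (cd_p c)).

Let op_e W : op_of W e =
  ⟦cd_i c⟧ ∘ (⟦dgm_e Y⟧ ∘ ⟦cd_s c⟧) + ⟦cd_u c⟧ ∘ (⟦dgm_e X⟧ ∘ ⟦cd_p c⟧).
Proof. by rewrite !opE. Qed.

Let op_ef W : op_of W (dgm_e Y) ∘ ⟦cval f0⟧ = ⟦cval f0⟧ ∘ ⟦dgm_e X⟧.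
Proof. by rewrite -[RHS]mulr1z; exact: (op_elinear W (cval f)). Qed.

Let rules W := (cone_rules c W, op_ef W, compAr (op_ef W),
  op_dgm_d X W, compAr (op_dgm_d X W), op_dgm_sq X W, compAr (op_dgm_sq X W),
  op_dgm_d Y W, compAr (op_dgm_d Y W), op_dgm_sq Y W, compAr (op_dgm_sq Y W),
  compE, mulrnE).

Lemma cone_dgm_d : dgd degd1 e = dgid C *+ n.
Proof.
apply: op_of_inj => W; rewrite op_of_d1 op_e (raddfMn (@op_of B W C C 0)) /= op_of_id.
by rewrite !rules; zmod_eq.
Qed.

Lemma cone_dgm_sq : dgcomp (erefl : 1 + 1 = 2 :> int) e e = 0.
Proof. by apply: op_of_inj => W; rewrite op_of_comp op_e op_of0 !rules; zmod_eq. Qed.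

Definition cone_dgm : M := Dgmodn cone_dgm_d cone_dgm_sq.

Lemma cone_dgm_i : cd_i c \in @elinear B n Y cone_dgm 0.
Proof.
by apply: elinear_op => W; rewrite [X in X ∘ _]op_e mulr1z !rules; zmod_eq.
Qed.

Lemma cone_dgm_u : cd_u c \in @elinear B n X cone_dgm 1.
Proof.
by apply: elinear_op => W; rewrite [X in X ∘ _]op_e mulrN1z !rules; zmod_eq.
Qed.

Lemma cone_dgm_p : cd_p c \in @elinear B n cone_dgm X (-1).
Proof.
by apply: elinear_op => W; rewrite [X in _ = (_ ∘ X) *~ _]op_e mulrN1z !rules; zmod_eq.
Qed.

Lemma cone_dgm_s : cd_s c \in @elinear B n cone_dgm Y 0.
Proof.
by apply: elinear_op => W; rewrite [X in _ = (_ ∘ X) *~ _]op_e mulr1z !rules; zmod_eq.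
Qed.

Definition cone_dgm_data : @cone_data M X Y f cone_dgm.
Proof.
apply: (@ConeData M X Y f cone_dgm (DgmHom cone_dgm_i) (DgmHom cone_dgm_u)
  (DgmHom cone_dgm_p) (DgmHom cone_dgm_s)); apply: dgmval_inj.
- exact: cd_di.
- exact: (cd_du c).
- exact: cd_dp.
- exact: (cd_ds c).
- exact: cd_pi.
- exact: cd_pu.
- exact: cd_si.
- exact: cd_su.
- exact: cd_id.
Qed.
End Cone.

Lemma dgmod_pretriangulated : pretriangulated B -> pretriangulated M.
Proof.
case=> [[Z0 Z00] shB coneB]; split.
- have d0 : dgd degd1 (0 : dghom Z0 Z0 1) = dgid Z0 *+ n.
    by rewrite raddf0 ((Z00 _ _).1 (dgid Z0)) mul0rn.
  exists (Dgmodn d0 (dgcomp0l _ _ _)) => X k.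
  by split=> f; apply: dgmval_inj; [apply: (Z00 _ _).1 | apply: (Z00 _ _).2].
- move=> X m; have [R] := shB X m; constructor.
  exact: shift_representation (shift_dgm_data (rep_shift_data R)).
- move=> X Y f; have [R] := coneB X Y (dgf_cycle (dgmod_forget B n) f); constructor.
  exact: cone_representation (cone_dgm_data (rep_cone_data R)).
Qed.
End DgModulePretriangulated.

(** * The mod-n reduction *)

Lemma inhabited_sig (A : Type) : inhabited A -> A.
Proof.
by move=> hA; have /cid[x _] : exists x : A, True by case: hA => x; exists x.
Qed.

Section Reduction.
Variables (B : dgCat) (n : nat) (hB : pretriangulated B).
Let M := dgmod B n.
Implicit Types X Y Z : B.

Definition Cn X : B := projT1 (cid (cone_ex hB (cycle_id X *+ n))).

Definition Cn_data X : cone_data (cycle_id X *+ n) (Cn X) :=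
  inhabited_sig (projT2 (cid (cone_ex hB (cycle_id X *+ n)))).

Notation i_ X := (cd_i (Cn_data X)).
Notation u_ X := (cd_u (Cn_data X)).
Notation p_ X := (cd_p (Cn_data X)).
Notation s_ X := (cd_s (Cn_data X)).

Lemma op_cycle_idMn W X : op_of W (cval (cycle_id X *+ n)) = idm _ *+ n.
Proof.
rewrite -op_of_id -[RHS](raddfMn (@op_of B W X X 0)); congr op_of.
by elim: (n) => // m IHm; rewrite !mulrS cvalD IHm.
Qed.

Definition Cn_rules W X := (cone_rules (Cn_data X) W, op_cycle_idMn W X, compE,
  (compMnl, compMnr, mulrnDl, mulNrn)).

(** Here [d u = n i] and [d s = n p], so [d (u s) = n (i s - u p)], and the bracket is the
    identity. *)
Lemma Cn_d X : dgd degd1 (dgc 1 0 1 (u_ X) (s_ X)) = dgid (Cn X) *+ n.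
Proof.
apply: op_of_inj => W; rewrite op_of_d1 (raddfMn (@op_of B W _ _ 0)) /= !opE.
by rewrite !(Cn_rules W X); zmod_eq.
Qed.

Lemma Cn_sq X : dgcomp (erefl : 1 + 1 = 2 :> int) (dgc 1 0 1 (u_ X) (s_ X))
  (dgc 1 0 1 (u_ X) (s_ X)) = 0.
Proof. by apply: op_of_inj => W; rewrite !opE !(Cn_rules W X). Qed.

Definition red_ob X : M := Dgmodn (Cn_d X) (Cn_sq X).

Lemma red_deg (k : int) : k + -1 = k - 1. Proof. by []. Qed.
Lemma red_deg1 (k : int) : 1 + (k - 1) = k. Proof. lia. Qed.

(* [red_map f] is the only e-linear map [phi] with [phi i = i f]: the relation
   [phi u = phi e i = (-1)^k e phi i] fixes it on the other summand. *)
Section RedMap.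
Variables (X Y : B) (k : int) (f : dghom X Y k).

Definition red_val : dghom (Cn X) (Cn Y) k :=
  dgcomp (add0r k) (i_ Y) (dgcomp (addr0 k) f (s_ X)) -
  dgcomp (red_deg1 k) (u_ Y) (dgcomp (red_deg k) f (p_ X)) *~ ksign k.

Lemma op_red_val W : op_of W red_val = ⟦i_ Y⟧ ∘ (⟦f⟧ ∘ ⟦s_ X⟧) -
  (⟦u_ Y⟧ ∘ (⟦f⟧ ∘ ⟦p_ X⟧)) *~ ksign k.
Proof. by rewrite op_ofB op_ofMz !op_of_comp. Qed.

Lemma red_valP : red_val \in @elinear B n (red_ob X) (red_ob Y) k.
Proof.
apply: elinear_op => W; rewrite /= op_red_val !op_of_comp.
by case: (ksign_cases k) => ->; rewrite ?mulrN1z ?mulr1z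
  !(Cn_rules W X, Cn_rules W Y); zmod_eq.
Qed.

Definition red_map : dghom (red_ob X) (red_ob Y) k := DgmHom red_valP.

Lemma op_red_map W : op_of W (dgmval red_map) = ⟦i_ Y⟧ ∘ (⟦f⟧ ∘ ⟦s_ X⟧) -
  (⟦u_ Y⟧ ∘ (⟦f⟧ ∘ ⟦p_ X⟧)) *~ ksign k.
Proof. exact: op_red_val. Qed.
End RedMap.

Lemma red_mapD X Y k (f g : dghom X Y k) : red_map (f + g) = red_map f + red_map g.
Proof.
apply/dgmval_inj/op_of_inj => W.
rewrite dgmvalD op_ofD !op_red_map op_ofD.
by rewrite !compE mulrzDl; zmod_eq.
Qed.

Lemma red_map_d X Y k j (e : j + 1 = k) (f : dghom X Y k) :
  red_map (dgd e f) = dgd e (red_map f).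
Proof.
apply/dgmval_inj/op_of_inj => W.
rewrite dgmval_d op_of_d !op_red_map op_of_d.
rewrite (ksign_pred e); case: (ksign_cases j) => ->;
  rewrite ?(opprK (1 : int)) !(mulr1z, mulrN1z) !(Cn_rules W X, Cn_rules W Y).
  by zmod_eq.
by zmod_eq.
Qed.

Lemma red_map1 X : red_map (dgid X) = dgid (red_ob X).
Proof.
apply/dgmval_inj/op_of_inj => W.
rewrite dgmval_id op_red_map mulr1z !op_of_id.
by rewrite !(Cn_rules W X); zmod_eq.
Qed.

Lemma red_mapM X Y Z i j k (e : i + j = k) (g : dghom Y Z i) (f : dghom X Y j) :
  red_map (dgcomp e g f) = dgcomp e (red_map g) (red_map f).
Proof.
apply/dgmval_inj/op_of_inj => W.
rewrite dgmval_comp op_of_comp !op_red_map op_of_comp -e ksignM.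
case: (ksign_cases i) => ->; case: (ksign_cases j) => ->;
  rewrite ?mulrNN ?mulrN1 ?mul1r !(mulr1z, mulrN1z) !(Cn_rules W Y, Cn_rules W X);
  zmod_eq.
Qed.

Definition red_functor : dgFunctor B M :=
  @DgFunctor B M red_ob red_map red_mapD red_map_d red_map1 red_mapM.
End Reduction.

(** * The adjunction on homology categories *)

Section ReductionAdjunction.
Variables (B : dgCat) (n : nat) (hB : pretriangulated B).
Let M := dgmod B n.

Notation i_ X := (cd_i (Cn_data n hB X)).
Notation u_ X := (cd_u (Cn_data n hB X)).
Notation p_ X := (cd_p (Cn_data n hB X)).
Notation s_ X := (cd_s (Cn_data n hB X)).

Lemma hclass_dgm (X Y : M) (f g : cycles X Y) :
  (forall W, op_of W (dgmval (cval f)) = ⟦dgmval (cval g)⟧) -> hclass f = hclass g.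
Proof. by move=> fg; congr hclass; apply/cycle_inj/dgmval_inj/op_of_inj. Qed.

(** The [e]-linear extension of the identity along [i]: as [u = e i] in the cone, [u] must go to the
    [e] of [Y], and [p u = -1] explains the minus sign. *)
Definition red_counit_val (Y : M) : dghom (Cn n hB (dgm_ob Y)) (dgm_ob Y) 0 :=
  s_ (dgm_ob Y) - dgc 1 (-1) 0 (dgm_e Y) (p_ (dgm_ob Y)).

Lemma red_counit_valP (Y : M) :
  red_counit_val Y \in @elinear B n (red_ob n hB (dgm_ob Y)) Y 0.
Proof.
apply: elinear_op => W; rewrite mulr1z /= !opE.
by rewrite !(Cn_rules n hB W, op_dgm_sq Y W, compAr (op_dgm_sq Y W)); zmod_eq.
Qed.

Lemma red_counit_cycle (Y : M) :
  (DgmHom (red_counit_valP Y) : dghom (red_ob n hB (dgm_ob Y) : M) Y 0) \in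
  @is_cycle M (red_ob n hB (dgm_ob Y)) Y.
Proof.
rewrite inE; apply/eqP/dgmval_inj/op_of_inj => W.
rewrite dgmval_d op_of_d0 [RHS](op_of0 W) /= !opE.
by rewrite !(Cn_rules n hB W, op_dgm_d Y W, compAr (op_dgm_d Y W)); zmod_eq.
Qed.

Definition red_counit (Y : M) : @cycles M (red_ob n hB (dgm_ob Y)) Y :=
  Cycle (red_counit_cycle Y).

Lemma op_red_counit W (Y : M) : op_of W (dgmval (cval (red_counit Y))) =
  ⟦s_ (dgm_ob Y)⟧ - ⟦dgm_e Y⟧ ∘ ⟦p_ (dgm_ob Y)⟧.
Proof. by rewrite /= !opE. Qed.

Let R := Hfun (red_functor n hB).
Let U := Hfun (dgmod_forget B n).

Definition red_unit (X : Hcat B) : hom X (U (R X)) := hclass (cone_incl (Cn_data n hB X)).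

Lemma red_unit_nat (X X' : Hcat B) (f : hom X X') :
  red_unit X' ∘ f = fmap U (fmap R f) ∘ red_unit X.
Proof.
have [f0 ->] := hclass_surj f.
rewrite (fmap_Hfun (red_functor n hB) f0) fmap_Hfun !hclass_comp; apply: hclass_op => W.
rewrite !cval_comp !cval_dgf !cval_incl !op_of_comp [X in _ = X ∘ _]op_red_map mulr1z.
by rewrite !(Cn_rules n hB W); zmod_eq.
Qed.

Lemma red_counit_nat (Y Y' : Hcat M) (g : hom Y Y') :
  (hclass (red_counit Y') : @hom (Hcat M) _ _) ∘ fmap R (fmap U g) =
  g ∘ hclass (red_counit Y).
Proof.
have [g0 ->] := hclass_surj g.
rewrite (fmap_Hfun (dgmod_forget B n) g0) fmap_Hfun !hclass_comp; apply: hclass_dgm => W.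
rewrite !cval_comp !dgmval_comp !op_of_comp !cval_dgf op_red_map mulr1z !op_red_counit.
rewrite [dgf _ _]/(dgmval (cval g0)) !(Cn_rules n hB W).
by rewrite (compAr (op_elinear W (cval g0))) mulr1z !compE; zmod_eq.
Qed.

Lemma red_triangle_l (X : Hcat B) :
  (hclass (red_counit (R X)) : @hom (Hcat M) _ _) ∘ fmap R (red_unit X) = idm (R X).
Proof.
rewrite fmap_Hfun !hclass_comp; apply: hclass_dgm => W.
rewrite !cval_comp !dgmval_comp !op_of_comp !cval_dgf op_red_map mulr1z !op_red_counit.
rewrite cval_incl [RHS]op_of_id /= op_of_comp !(Cn_rules n hB W).
by zmod_eq.
Qed.

Lemma red_triangle_r (Y : Hcat M) :
  fmap U (hclass (red_counit Y) : @hom (Hcat M) _ _) ∘ red_unit (U Y) = idm (U Y).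
Proof.
rewrite fmap_Hfun !hclass_comp; apply: hclass_op => W.
rewrite !cval_comp !op_of_comp cval_dgf [X in X ∘ _]op_red_counit cval_incl.
by rewrite !(Cn_rules n hB W) [RHS]op_of_id; zmod_eq.
Qed.
Definition red_adjunction_dg : adjunction R U :=
  @Adjunction _ _ R U red_unit (fun Y : M => hclass (red_counit Y))
    red_unit_nat red_counit_nat red_triangle_l red_triangle_r.

Lemma red_dist (s : shift_choice B) (X : Htri s) :
  dist (idm X *+ n) (red_unit X) (hclass (cone_proj s (Cn_data n hB X))).
Proof.
have -> : idm X *+ n = hclass (cycle_id X *+ n).
  elim: (n) => [|m IHm]; first by rewrite hclass0.
  by rewrite !mulrS hclassD IHm.
exact: Hdist_cone.
Qed.
End ReductionAdjunction.

(** * Transfer along the equivalence with H(B) *)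

Section CompExact.
Variables (T T' T2 : triData) (G : exact_functor T' T2) (F : exact_functor T T').

Definition comp_susp X : hom (G (F (susp X))) (susp (G (F X))) :=
  exact_susp G (F X) ∘ fmap G (exact_susp F X).

Definition comp_susp_inv X : hom (susp (G (F X))) (G (F (susp X))) :=
  fmap G (nat_iso_inv (exact_susp F) X) ∘ nat_iso_inv (exact_susp G) (F X).

Lemma comp_susp_invK X : comp_susp_inv X ∘ comp_susp X = idm _.
Proof.
rewrite /comp_susp_inv /comp_susp -compA (compA (nat_iso_inv (exact_susp G) (F X))).
by rewrite (nat_iso_invK (exact_susp G)) comp1f -fmapM (nat_iso_invK (exact_susp F)) fmap1.
Qed.

Lemma comp_suspK X : comp_susp X ∘ comp_susp_inv X = idm _.
Proof.
rewrite /comp_susp_inv /comp_susp -compA (compA (fmap G (exact_susp F X))) -(fmapM G).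
by rewrite (nat_iso_funK (exact_susp F)) fmap1 comp1f (nat_iso_funK (exact_susp G)).
Qed.

Lemma comp_susp_nat X Y (f : hom X Y) :
  comp_susp Y ∘ fmap G (fmap F (fmap susp f)) = fmap susp (fmap G (fmap F f)) ∘ comp_susp X.
Proof.
rewrite /comp_susp -compA -fmapM (nat_iso_nat (exact_susp F)) (fmapM G) compA.
by rewrite (nat_iso_nat (exact_susp G)) compA.
Qed.

Definition comp_susp_iso :=
  @NatIso _ _ (comp_functor (comp_functor G F) (@susp T))
    (comp_functor (@susp T2) (comp_functor G F)) comp_susp comp_susp_inv
    comp_susp_invK comp_suspK comp_susp_nat.

Lemma comp_exact_additive : additive_functor (comp_functor G F).
Proof. by move=> X Y f g; rewrite /= (exact_add F) (exact_add G). Qed.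

Lemma comp_exact_dist X Y Z (f : hom X Y) (g : hom Y Z) (h : hom Z (susp X)) :
  dist f g h -> dist (fmap G (fmap F f)) (fmap G (fmap F g))
    (comp_susp X ∘ fmap G (fmap F h)).
Proof.
by move=> /(exact_dist F)/(exact_dist G); rewrite fmapM compA.
Qed.

Definition comp_exact : exact_functor T T2 :=
  @ExactFunctor T T2 (comp_functor G F) comp_exact_additive comp_susp_iso comp_exact_dist.
End CompExact.

Section ModReduction.
Variables (T : triCat) (n : nat) (B : dgCat) (s : shift_choice B).
Hypothesis hB : pretriangulated B.
Variable F : exact_functor T (Htri s).
Hypothesis Feq : is_equivalence F.

(** The left adjoint is [T -> H(B) -> H(B/n)]. A cone [C] of [n] on [X] goes under [F] to a cone of
    [n] on [F X], hence is identified there with the reduction of [F X]; the quasi-inverse and its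
    unit bring this identification back to [T]. *)
Lemma algebraic_mod_reduction : inhabited (mod_reduction T n).
Proof.
pose M := dgmod B n.
have hM : pretriangulated M := dgmod_pretriangulated n hB.
have sM : shift_choice M by case: hM => _ shM _ X; exact: inhabited_sig (shM X (-1)).
pose F' := Hfun_exact (red_functor n hB) s sM.
pose U := Hfun (dgmod_forget B n).
have ess := equivalence_ess_surj Feq.
pose G0 Y := projT1 (cid (ess Y)).
have e_ex Y : exists e : hom (F (G0 Y)) Y, is_iso e := projT2 (cid (ess Y)).
pose e Y := projT1 (cid (e_ex Y)).
have e_iso Y : is_iso (e Y) := projT2 (cid (e_ex Y)).
pose e' Y := projT1 (cid (e_iso Y)).
have [eK e'K] := all_and2 (fun Y => projT2 (cid (e_iso Y))).
have Ffaith := equivalence_faithful Feq; have Ffull := equivalence_full Feq.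
pose aF := ff_adjunction Ffaith Ffull eK e'K.
pose a : adjunction (comp_exact F' F) _ := comp_adjunction aF (red_adjunction_dg n hB).
constructor; apply: (@ModReduction T n (TriCat (Htri_triangulated sM hM))
  (comp_exact F' F) _ a) => X.
have rT := triangulated_rotatable (tri_axioms T).
have rH := Htri_rotatable s hB.
have [C [g [h ngh]]] := tr_cone (tri_axioms T) (idm X *+ n).
have Fngh := exact_dist F ngh.
rewrite (fmapMn (exact_add F)) fmap1 in Fngh.
have [c [ic cg _]] := dist_cone_iso rH Fngh (red_dist n hB (F X)).
have ieta : is_iso (adj_unit aF C).
  exists (ff_unit_inv Ffull e C).
  by split; [exact: ff_unitK | exact: ff_unit_invK].
(* This isomorphism from [C] carries [g] to the unit of the composite adjunction. *)
have ik : is_iso (fmap (ff_inv Ffaith Ffull eK e'K) c ∘ adj_unit aF C).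
  by apply: is_iso_comp ieta; apply: fmap_iso.
have [k' [k'k _]] := ik; exists (h ∘ k').
apply: (dist_iso_cone rT ngh ik); last by rewrite -compA k'k compf1.
by rewrite -compA (adj_unit_nat aF) compA -(fmapM (ff_inv Ffaith Ffull eK e'K)) cg.
Qed.
End ModReduction.

Theorem theorem3p3 (T : triCat) (n : nat) (hT : algebraic T) (hn : (1 <= n)%N) :
  inhabited (mod_reduction T n) /\ infinite_n_order T n.
Proof.
have [B [s [hB [F Feq]]]] := hT; have [R] := algebraic_mod_reduction n hB Feq.
by split; [constructor | apply: mod_reduction_infinite_n_order].
Qed.
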